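(* With the notation of the context, suppose that $$w(\beta')=\max\{w(u')\mid u'\in\mathcal{M}'\}.$$ Then $$\alpha^*_{\mathcal{M}'}\big(G_v^{\mathcal{M}}(\Lambda,x)\big)=\pi_0^{-(p-1)w(\beta)}\bigg(\prod_{j=1}^N\frac{H(-v_j)}{[v_j']_{pv_j-v_j'}}\bigg)G_{v'}^{\mathcal{M}'}(\Lambda,x).$$
   Context: For $z\in\mathbb{C}_p$, $l\in\mathbb{Z}$ put $[z]_0=1$; $[z]_l=\frac{1}{(z+1)\cdots(z+l)}$ if $l>0$ and $z\notin\{-1,\dots,-l\}$; $[z]_l=z(z-1)\cdots(z+l+1)$ if $l<0$. Also $(z)_l=z(z+1)\cdots(z+l-1)$ for $l\ge0$. Let $A=\{\mathbf{a}_1,\dots,\mathbf{a}_N\}\subset\mathbb{Z}^n$ lie on a hyperplane $w(u)=1$, $w$ a linear form on $\mathbb{R}^n$ with rational coefficients; $\mathbb{Z}A$, $\mathbb{Q}A$ are the group and $\mathbb{Q}$-space generated by $A$, $C(A)$ the real cone generated by $A$, and $-C(A)^\circ$ the relative interior of $-C(A)$. Fix $Q\in\mathbb{Q}A$, $\beta\in\mathcal{M}:=(Q+\mathbb{Z}A)\cap(-C(A)^\circ)$, and $v=(v_1,\dots,v_N)\in\mathbb{Q}^N$ with all $v_j\in[-1,0]$ and $\beta=\sum_jv_j\mathbf{a}_j$. Fix a prime $p$ for which all $v_j$ are $p$-integral. Let $v_j'$ be the unique rational number in $[-1,0]$ with $pv_j-v_j'\in\{0,-1,\dots,-(p-1)\}$;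 put $v'=(v_1',\dots,v_N')$, $\beta'=\sum_jv_j'\mathbf{a}_j$, $\mathcal{M}'=(pQ+\mathbb{Z}A)\cap(-C(A)^\circ)$. (One has $v_j'=-1$ iff $v_j=-1$, $v_j'=0$ iff $v_j=0$.) $\mathbb{C}_p$ is the completion of an algebraic closure of $\mathbb{Q}_p$, with norm $|\cdot|$ and valuation $\mathrm{ord}$, $\mathrm{ord}\,p=1$. Let $\pi_0\in\mathbb{C}_p$ be a root of $\sum_{i\ge0}t^{p^i}/p^i=0$ with $\mathrm{ord}\,\pi_0=1/(p-1)$. Fix a positive integer $d$ with $dv_j\in\mathbb{Z}$ for all $j$ and a $d$-th root of $\pi_0$, which defines $\pi_0^r$ for $r\in\frac1d\mathbb{Z}$. Let $\theta(t)=\exp(\sum_{i\ge0}(\pi_0t)^{p^i}/p^i)$, $\hat\theta(t)=\prod_{j\ge0}\theta(t^{p^j})$, $\hat\theta_1(t)=\hat\theta(t)/\exp(\pi_0t)=\sum_{i\ge0}\hat\theta_{1,i}(\pi_0t)^i/i!$. Let $\exp(\pi_0t-\pi_0t^p)=\sum_{i\ge0}\sigma_it^i$ and $H(z)=\sum_{l\ge0}(-1)^l(z)_l\,\sigma_{pl}\,\pi_0^{-l}$, which converges for $z\in\mathbb{Z}_p$. Let $E=\{l\in\mathbb{Z}^N\mid l_j\le0\text{ if }v_j=-1,\ l_j\ge0\text{ if }v_j=0\}$ and $E_+=\{l\in\mathbb{Z}^N\mid l_j\ge0\text{ if }v_j=0\}$. For $l\in\mathbb{Z}$ (with $l\le0$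 if $v_j=-1$) set $g(v_j,l)=\sum_{i\ge0}[v_j]_{l-i}\hat\theta_{1,i}/i!$ (a convergent sum), and define $g(v'_j,l)$ likewise. For $u\in Q+\mathbb{Z}A$ put $$G_u(\Lambda)=\sum_{l\in E,\ \sum_j(v_j+l_j)\mathbf{a}_j=u}\bigg(\prod_{j=1}^Ng(v_j,l_j)\bigg)\Lambda^{v+l},\qquad G_v^{\mathcal{M}}(\Lambda,x)=\sum_{u\in\mathcal{M}}G_u(\Lambda)\pi_0^{w(u)}x^u.$$ For $u'\in pQ+\mathbb{Z}A$ define $G_{u'}(\Lambda)$ by the same formula with $v$ replaced by $v'$ ($E$ is unchanged), and $G_{v'}^{\mathcal{M}'}(\Lambda,x)=\sum_{u'\in\mathcal{M}'}G_{u'}(\Lambda)\pi_0^{w(u')}x^{u'}$. For $S\subseteq\mathbb{Z}^N$ let $C_S\{\Lambda_1x^{\mathbf{a}_1},\dots,\Lambda_Nx^{\mathbf{a}_N}\}$ be the space of formal series $\sum_{l\in S}c_l\prod_j(\Lambda_jx^{\mathbf{a}_j})^{l_j}$, $c_l\in\mathbb{C}_p$, such that for every $0<\delta<1$, $|c_l|\delta^{|l_1|+\dots+|l_N|}\to0$ (for each $\epsilon>0$ it is $<\epsilon$ for all but finitely many $l$). Then $G_v^{\mathcal{M}}(\Lambda,x)\in\Lambda^vx^\beta C_E\{\cdots\}$ and $G_{v'}^{\mathcal{M}'}(\Lambda,x)\in\Lambda^{v'}x^{\beta'}C_E\{\cdots\}$. The map $\alpha^*_{\mathcal{M}'}=\gamma_{\mathcal{M}'}\circ\theta(\Lambda,x)\circ\Phi^*:\Lambda^vx^\beta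 C_E\{\cdots\}\to\Lambda^{v'}x^{\beta'}C_E\{\cdots\}$ is the composition of: $\Phi^*$, replacing each $\Lambda_j$ by $\Lambda_j^p$ and each $x_i$ by $x_i^p$; multiplication by $\theta(\Lambda,x)=\prod_{j=1}^N\theta(\Lambda_jx^{\mathbf{a}_j})$, landing in $\Lambda^{v'}x^{\beta'}C_{E_+}\{\cdots\}$; and $\gamma_{\mathcal{M}'}$, which keeps the terms in monomials $\Lambda^{v'+l}x^{\sum_j(v_j'+l_j)\mathbf{a}_j}$, $l\in E_+$, with $\sum_j(v'_j+l_j)\mathbf{a}_j\in\mathcal{M}'$ and discards all other terms (under the hypothesis of the theorem the image lies in $\Lambda^{v'}x^{\beta'}C_E\{\cdots\}$). *)

(* Defs.v *)
From HB Require Import structures.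
From mathcomp Require Import all_boot all_order all_algebra finmap.
From mathcomp Require Import all_classical all_reals all_analysis.

Set Implicit Arguments.
Unset Strict Implicit.
Unset Printing Implicit Defensive.

Import Order.TTheory GRing.Theory Num.Theory.
Import numFieldNormedType.Exports.

Local Open Scope classical_set_scope.
Local Open Scope ring_scope.

Section Field.
Variables (R : realType) (p : nat) (K : fieldType) (nrm : K -> R).

(* The closure of Q in K.  When K is complete with |p| = 1/p and the absolute
   value is ultrametric, this is a copy of Q_p. *)
Definition Qp : set K :=
  [set x | forall eps : R, 0 < eps -> exists q : rat, nrm (x - ratr q) < eps].

Definition Qpbar : set K :=
  [set x | exists P : {poly K}, [/\ P != 0, forall i, Qp P`_i & root P x]].

(* (K, nrm) is the completion of an algebraic closure of Q_p, with its absolute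
   value normalized by |p| = 1/p. *)
Record is_Cp : Prop := IsCp {
  Cp_norm_ge0 : forall x, 0 <= nrm x;
  Cp_norm_eq0 : forall x, nrm x = 0 <-> x = 0;
  Cp_normM : forall x y, nrm (x * y) = nrm x * nrm y;
  Cp_normD : forall x y, nrm (x + y) <= Num.max (nrm x) (nrm y);
  Cp_norm_p : nrm p%:R = p%:R^-1;
  Cp_complete : forall u : nat -> K,
    (forall eps : R, 0 < eps -> exists n0 : nat, forall m n : nat,
       (n0 <= m)%N -> (n0 <= n)%N -> nrm (u m - u n) < eps) ->
    exists s : K, (fun n : nat => nrm (u n - s)) @ \oo --> (0 : R);
  Cp_Qpbar_closed : forall P : {poly K},
    (1 < size P)%N -> (forall i, Qpbar P`_i) ->
    exists2 x, Qpbar x & root P x;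
  Cp_Qpbar_dense : forall (x : K) (eps : R), 0 < eps ->
    exists2 y, Qpbar y & nrm (x - y) < eps
}.

Definition ord (x : K) : R := - (ln (nrm x) / ln p%:R).

Definition has_series (c : nat -> K) (s : K) : Prop :=
  (fun n : nat => nrm (\sum_(i < n) c i - s)) @ \oo --> (0 : R).

(* sum of a series, with value 0 when the series diverges *)
Definition series_sum (c : nat -> K) : K := xget 0 [set s | has_series c s].

(* unordered summation over an arbitrary index set *)
Definition has_fam_sum (I : choiceType) (c : I -> K) (s : K) : Prop :=
  forall eps : R, 0 < eps -> exists F : {fset I}, forall F' : {fset I},
    (F `<=` F')%fset -> nrm (\sum_(i <- F') c i - s) < eps.

(* sum of a family, with value 0 when the family is not summable *)
Definition fam_sum (I : choiceType) (c : I -> K) : K :=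
  xget 0 [set s | has_fam_sum c s].

End Field.

(* Formal power series in one variable t, as coefficient sequences. *)
Section PowerSeries.
Variable K : fieldType.
Implicit Types f g : nat -> K.

Definition ps_one : nat -> K := fun n => (n == 0%N)%:R.

Definition ps_mul f g : nat -> K :=
  fun n => \sum_(i < n.+1) f i * g (n - i)%N.

Definition ps_exp_n f (k : nat) : nat -> K := iter k (ps_mul f) ps_one.

(* exp(f) for f(0) = 0; the terms f^k/k! with k > n do not reach t^n *)
Definition ps_exp f : nat -> K :=
  fun n => \sum_(k < n.+1) ps_exp_n f k n / k`!%:R.

(* 1/g = sum_k (1 - g)^k for g(0) = 1 *)
Definition ps_inv g : nat -> K :=
  fun n => \sum_(k < n.+1) ps_exp_n (fun i => ps_one i - g i) k n.

Definition ps_div f g : nat -> K := ps_mul f (ps_inv g).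

(* f(t^m), for m > 0 *)
Definition ps_subst f (m : nat) : nat -> K :=
  fun n => if (m %| n)%N then f (n %/ m)%N else 0.

End PowerSeries.

Section Dwork.
Variables (R : realType) (p : nat) (K : fieldType) (nrm : K -> R) (pi0 : K).

(* the power series sum_i (pi0 t)^(p^i) / p^i *)
Definition AH_log : nat -> K :=
  fun n => \sum_(i < n.+1 | (p ^ i == n)%N) pi0 ^+ (p ^ i) / (p ^ i)%:R.

Definition theta : nat -> K := ps_exp AH_log.

(* prod_(j >= 0) theta(t^(p^j)); since theta(0) = 1 and p^j > n for j > n, the
   factors with j > n do not contribute to t^n *)
Definition theta_hat : nat -> K :=
  fun n => (\big[@ps_mul K/@ps_one K]_(j < n.+1) ps_subst theta (p ^ j)) n.

(* theta_hat(t) / exp(pi0 t) *)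
Definition theta_hat1 : nat -> K :=
  ps_div theta_hat (ps_exp (fun n => pi0 * (n == 1%N)%:R)).

(* theta_hat1(t) = sum_i theta_hat1_coef i * (pi0 t)^i / i! *)
Definition theta_hat1_coef (i : nat) : K := theta_hat1 i * i`!%:R / pi0 ^+ i.

(* exp(pi0 t - pi0 t^p) *)
Definition sigma : nat -> K :=
  ps_exp (fun n => pi0 * (n == 1%N)%:R - pi0 * (n == p)%:R).

Definition poch (z : K) (l : nat) : K := \prod_(i < l) (z + i%:R).

Definition H (z : K) : K :=
  series_sum nrm (fun l => (-1) ^+ l * poch z l * sigma (p * l) / pi0 ^+ l).

(* [z]_l; note that Negz m is the integer -(m+1).  The value 0 obtained when
   l > 0 and z is one of -1, ..., -l is a dummy. *)
Definition brk (z : K) (l : int) : K :=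
  match l with
  | Posz m => (\prod_(i < m) (z + i.+1%:R))^-1
  | Negz m => \prod_(i < m.+1) (z - i%:R)
  end.

Definition g (z : K) (l : int) : K :=
  series_sum nrm (fun i => brk z (l - i%:Z) * theta_hat1_coef i / i`!%:R).

End Dwork.

(* pi0^r for r in (1/d)Z, where rho is the chosen d-th root of pi0 *)
Definition pi0pow (K : fieldType) (rho : K) (d : nat) (r : rat) : K :=
  rho ^ numq (d%:R * r).

(* value at u of the linear form with coefficients w *)
Definition wform (n : nat) (w u : 'rV[rat]_n) : rat :=
  \sum_(i < n) w 0 i * u 0 i.

Section Cone.
Variables (R : realType) (N n : nat).

Definition affine_hull (S : set 'rV[R]_n) : set 'rV[R]_n :=
  [set z | exists m (s : 'I_m -> 'rV[R]_n) (t : 'I_m -> R),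
     [/\ forall i, S (s i), \sum_i t i = 1 & z = \sum_i t i *: s i]].

Definition relint (S : set 'rV[R]_n) : set 'rV[R]_n :=
  [set y | S y /\ \forall z \near y, affine_hull S z -> S z].

(* The vectors a_1, ..., a_N are the rows of A. *)
Variable A : 'M[int]_(N, n).

Definition cone : set 'rV[R]_n :=
  [set y | exists2 t : 'rV[R]_N,
     (forall j, 0 <= t 0 j) & y = t *m map_mx intr A].

Definition coset_ZA (Q : 'rV[rat]_n) : set 'rV[rat]_n :=
  [set u | exists m : 'rV[int]_N, u = Q + map_mx intr (m *m A)].

Definition Mset (Q : 'rV[rat]_n) : set 'rV[rat]_n :=
  coset_ZA Q `&`
  [set u | relint [set - y | y in cone] (map_mx (ratr : rat -> R) u)].

End Cone.

(* A formal series in Lambda_1, ..., Lambda_N, x_1, ..., x_n with rational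
   exponents is given by its coefficients: (mu, u) stands for the monomial
   Lambda^mu x^u. *)
Section FormalSeries.
Variables (R : realType) (p : nat) (K : fieldType) (nrm : K -> R).
Variables (pi0 rho : K) (d : nat).
Variables (N n : nat) (A : 'M[int]_(N, n)) (w : 'rV[rat]_n).

Definition expo : Type := ('rV[rat]_N * 'rV[rat]_n)%type.
Definition fseries : Type := expo -> K.

Implicit Types (v : 'rV[rat]_N) (l : 'rV[int]_N) (F : fseries).

Definition wt v : 'rV[rat]_n := v *m map_mx intr A.

(* exponent of Lambda^(v+l) x^(sum_j (v_j + l_j) a_j) *)
Definition mon v l : expo := (v + map_mx intr l, wt (v + map_mx intr l)).

Definition Eset v : set 'rV[int]_N :=
  [set l : 'rV[int]_N | forall j, (v 0 j = -1 -> l 0 j <= 0) /\ (v 0 j = 0 -> 0 <= l 0 j)].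

Definition Eplus v : set 'rV[int]_N :=
  [set l : 'rV[int]_N | forall j, v 0 j = 0 -> 0 <= l 0 j].

(* the series sum_(l in S) c_l Lambda^(v+l) x^(sum_j (v_j + l_j) a_j) *)
Definition mono_series v (S : set 'rV[int]_N) (c : 'rV[int]_N -> K) : fseries :=
  fun e => \sum_(l \in [set l | S l /\ mon v l = e]) c l.

(* Lambda^v x^(sum_j v_j a_j) C_S{Lambda_1 x^(a_1), ..., Lambda_N x^(a_N)} *)
Definition Cspace v (S : set 'rV[int]_N) : set fseries :=
  [set F | exists2 c : 'rV[int]_N -> K, F = mono_series v S c &
     forall delta eps : R, 0 < delta -> delta < 1 -> 0 < eps ->
       finite_set [set l | S l /\
         eps <= nrm (c l) * delta ^+ (\sum_(j < N) absz (l 0%R j))%N]].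

Definition fs_scale (c : K) F : fseries := fun e => c * F e.

Definition fs_mul F1 F2 : fseries :=
  fun e => fam_sum nrm (fun e1 : expo => F1 e1 * F2 (e - e1)).

(* G_u, a series in Lambda alone, for the parameter v and the support set E *)
Definition G v (E : set 'rV[int]_N) (u : 'rV[rat]_n) : 'rV[rat]_N -> K :=
  fun mu => \sum_(l \in [set l | [/\ E l, wt (v + map_mx intr l) = u
                                   & v + map_mx intr l = mu]])
              \prod_(j < N) g p nrm pi0 (ratr (v 0 j)) (l 0 j).

(* sum_(u in M) G_u(Lambda) pi0^(w(u)) x^u *)
Definition GM v (E : set 'rV[int]_N) (M : set 'rV[rat]_n) : fseries :=
  fun e => if e.2 \in M then G v E e.2 e.1 * pi0pow rho d (wform w e.2) else 0.

(* theta(Lambda, x) = prod_j theta(Lambda_j x^(a_j))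
   = sum_(l >= 0) (prod_j theta_(l_j)) Lambda^l x^(sum_j l_j a_j) *)
Definition theta_Lx : fseries :=
  mono_series 0 [set l : 'rV[int]_N | forall j, 0 <= l 0 j]
    (fun l => \prod_(j < N) theta p pi0 (absz (l 0 j))).

Definition Phi_star F : fseries :=
  fun e => F (p%:R^-1 *: e.1, p%:R^-1 *: e.2).

Definition gamma v (M : set 'rV[rat]_n) F : fseries :=
  fun e => if e \in [set mon v l | l in [set l | Eplus v l /\ M (mon v l).2]]
           then F e else 0.

(* The map defined on Lambda^v x^beta C_E{...}; it is given the dummy value 0
   outside this domain. *)
Definition alpha_star v v' (M' : set 'rV[rat]_n) F : fseries :=
  if F \in Cspace v (Eset v)
  then gamma v' M' (fs_mul theta_Lx (Phi_star F))
  else fun=> 0.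

End FormalSeries.

(* Main.v *)
Require Import Defs.
From HB Require Import structures.
From mathcomp Require Import all_boot all_order all_algebra finmap.
From mathcomp Require Import all_classical all_reals all_analysis.
From mathcomp Require Import zify ring lra.

Set Implicit Arguments.
Unset Strict Implicit.
Unset Printing Implicit Defensive.

Import Order.TTheory GRing.Theory Num.Theory.
Import numFieldNormedType.Exports.

Local Open Scope classical_set_scope.
Local Open Scope ring_scope.

(* For z in Z_p let F_z(t) = sum_l pi0^l [z]_l t^(z+l), a formal solution of
   t F' = pi0 t F; then sum_l pi0^l g(z,l) t^(z+l) = theta_hat1(t) F_z(t).  Since
   theta(t) theta_hat1(t^p) = exp(pi0 t - pi0 t^p) theta_hat1(t), the operator
   "substitute t^p, then multiply by theta" maps theta_hat1 F_v to theta_hat1 times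
   exp(pi0 t - pi0 t^p) F_v(t^p).  The coefficients of the latter satisfy the same
   first order recurrence as those of F_v', so both series are proportional, and
   the constant is found from the coefficient of t^(pv), which is H(-v).  For
   v = -1 the recurrence only holds for exponents l <= 0; when w(beta') is maximal
   on M', the projection to M' keeps no other exponents.  Summability rests on
   Dwork's estimates, which follow from the integrality of the Artin-Hasse series. *)

(** * Formal power series *)

(** The theorem splits into N one-variable identities: each coefficient of the product with
    [theta_Lx] is a sum over all of Z^N of products of one-variable terms. For this the supports
    must fit together. With k_j = v'_j - p v_j, theta contributes the exponents l + k - p l2, which
    are nonnegative; then wt (v + l2) is 1/p times a point of M' plus an element of the negative
    cone, hence lies in M, so cutting the series down to M discards nothing that reaches M'. The
    sign conditions of E come for free, since the one-variable terms vanish where they fail. On the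
    analytic side, pi0^l [z]_l grows at most linearly in |l| for the parameters at hand, while
    theta, sigma and theta_hat1 have geometrically decaying coefficients, so every rearrangement
    concerns a family tending to zero. The equation defining pi0 enters in the decay of theta_hat1:
    the partial sums of sum_i pi0^(p^i)/p^i are minus small tails. The power of pi0 in the result
    comes from the factors pi0^(k_j), whose product is pi0^(w(beta') - p w(beta)). *)

Section FormalPowerSeries.
Variable K : fieldType.

(* A copy of nat -> K carrying the Cauchy product: on nat -> K itself the
   notations 1 and * denote the pointwise operations, hence the type casts to
   fps below. *)
Definition fps : Type := nat -> K.

HB.instance Definition _ := GRing.Zmodule.copy fps (nat -> K).

Implicit Types f g h : fps.

(** Coefficients up to degree n of a product only see the factors up to degree n; the ring axioms
    are thus inherited from [{poly K}] through truncations. *)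
Lemma ps_mul_poly (P Q : {poly K}) f g n :
  (forall i, (i <= n)%N -> P`_i = f i) -> (forall i, (i <= n)%N -> Q`_i = g i) ->
  ps_mul f g n = (P * Q)`_n.
Proof.
move=> fP gQ; rewrite coefM; apply: eq_bigr => i _.
by rewrite fP ?gQ ?leq_subr// -ltnS.
Qed.

Let trunc n f : {poly K} := \poly_(i < n.+1) f i.

Let coef_trunc n f i : (i <= n)%N -> (trunc n f)`_i = f i.
Proof. by rewrite coef_poly ltnS => ->. Qed.

Lemma ps_mulA : associative (@ps_mul K).
Proof.
move=> f g h; apply/funext => n.
rewrite (@ps_mul_poly (trunc n f) (trunc n g * trunc n h)); last 2 first.
- exact: coef_trunc.
- move=> i ni; symmetry; apply: ps_mul_poly => j ji;
    by rewrite coef_trunc// (leq_trans ji).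
rewrite mulrA; symmetry; apply: ps_mul_poly; last exact: coef_trunc.
move=> i ni; symmetry; apply: ps_mul_poly => j ji;
  by rewrite coef_trunc// (leq_trans ji).
Qed.

Lemma ps_mulC : commutative (@ps_mul K).
Proof.
move=> f g; apply/funext => n.
rewrite (@ps_mul_poly (trunc n f) (trunc n g)); [|exact: coef_trunc..].
by rewrite mulrC; symmetry; apply: ps_mul_poly; exact: coef_trunc.
Qed.

Lemma ps_mul1 : left_id (@ps_one K) (@ps_mul K).
Proof.
move=> f; apply/funext => n.
rewrite (@ps_mul_poly 1 (trunc n f)); last exact: coef_trunc.
- by rewrite mul1r coef_trunc.
- by move=> i _; rewrite coef1.
Qed.

Lemma ps_mulDl : left_distributive (@ps_mul K) (fun f g => (f + g : fps)).
Proof.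
move=> f g h; apply/funext => n; rewrite /ps_mul -[RHS]big_split/=.
by apply: eq_bigr => i _; rewrite -mulrDl.
Qed.

HB.instance Definition _ := GRing.Zmodule_isComPzRing.Build fps
  ps_mulA ps_mulC ps_mul1 ps_mulDl.

Lemma fps_mulE f g n : (f * g) n = \sum_(i < n.+1) f i * g (n - i)%N.
Proof. by []. Qed.

Lemma fps_addE f g n : (f + g) n = f n + g n. Proof. by []. Qed.
Lemma fps_oppE f n : (- f) n = - f n. Proof. by []. Qed.
Lemma fps_1E n : (1 : fps) n = (n == 0)%N%:R. Proof. by []. Qed.

Lemma fps_sumE (I : Type) (r : seq I) (P : pred I) (F : I -> fps) n :
  (\sum_(i <- r | P i) F i) n = \sum_(i <- r | P i) F i n.
Proof. by elim/big_rec2 : _ => // i y1 y2 _ <-. Qed.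

Lemma fps_mulrnE f k n : (f *+ k) n = f n *+ k.
Proof. by elim: k => [|k IH]; rewrite ?mulr0n// !mulrSr fps_addE IH. Qed.

Lemma fps_expr_poly (P : {poly K}) f n k : (forall i, (i <= n)%N -> P`_i = f i) ->
  forall i, (i <= n)%N -> (P ^+ k)`_i = (f ^+ k) i.
Proof.
move=> Pf; elim: k => [|k IH] i ni; first by rewrite coef1.
by rewrite !exprS; symmetry; apply: ps_mul_poly => j ji; [exact/Pf/(leq_trans ji)|exact/IH/(leq_trans ji)].
Qed.

Lemma ps_exp_nE f k : ps_exp_n f k = f ^+ k.
Proof. by elim: k => // k IH; rewrite exprS -IH. Qed.

Lemma fps_mul0 f g : (f * g) 0%N = f 0%N * g 0%N.
Proof. by rewrite fps_mulE big_ord_recl big_ord0 addr0. Qed.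

Lemma fps_mul_rec f g n :
  (f * g) n.+1 = f 0%N * g n.+1 + \sum_(i < n.+1) f i.+1 * g (n - i)%N.
Proof. by rewrite fps_mulE big_ord_recl. Qed.

Lemma fps_exprn_eq0 f k n : f 0%N = 0 -> (n < k)%N -> (f ^+ k) n = 0.
Proof.
move=> f0; elim: k n => // k IH [|n] nk; first by rewrite exprS fps_mul0 f0 mul0r.
rewrite exprS fps_mul_rec f0 mul0r add0r big1// => i _.
by rewrite IH ?mulr0// (leq_ltn_trans (leq_subr _ _)).
Qed.

Lemma fps_mulI f g h : f 0%N != 0 -> f * g = f * h -> g = h.
Proof.
move=> f0 /(congr1 (fun x => x - f * h)); rewrite subrr -mulrBr => fgh.
apply/eqP; rewrite -subr_eq0; apply/eqP/funext => n.
rewrite -/((g - h) n); elim/ltn_ind: n => n IH.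
have := congr1 (fun x : fps => x n) fgh.
case: n IH => [|n] IH; first by rewrite fps_mul0 => /eqP; rewrite mulf_eq0 (negPf f0) => /eqP.
rewrite fps_mul_rec big1 => [|i _].
  by rewrite addr0 => /eqP; rewrite mulf_eq0 (negPf f0) => /eqP.
by rewrite IH ?mulr0// ltnS leq_subr.
Qed.

Lemma ps_invE g : g 0%N = 1 -> (g : fps) * ps_inv g = 1.
Proof.
move=> g0; apply/funext => n; set h : fps := 1 - g.
have h0 : h 0%N = 0 by rewrite /h fps_addE fps_oppE g0 fps_1E subrr.
(* Truncated geometric series of ratio h = 1 - g; the remainder h^(n+1) has no term of degree at
   most n. *)
have geo : g * \sum_(k < n.+1) h ^+ k = 1 - h ^+ n.+1.
  by rewrite -[RHS]opprB subrX1 -mulNr; congr (_ * _); rewrite /h; ring.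
transitivity ((g * \sum_(k < n.+1) h ^+ k) n); last first.
  by rewrite geo fps_addE fps_oppE fps_exprn_eq0// subr0.
rewrite !fps_mulE; apply: eq_bigr => i _; congr (_ * _).
rewrite fps_sumE /ps_inv; have := leq_subr i n; move: (n - i)%N => j jn.
rewrite -(subnKC jn) -addSn big_split_ord/= [X in _ + X]big1 ?addr0//.
  by apply: eq_bigr => k _; rewrite ps_exp_nE.
by move=> k _; rewrite fps_exprn_eq0// ltn_addr.
Qed.

(* The derivation t d/dt. *)
Definition fps_theta f : fps := fun n => n%:R * f n.

Lemma fps_thetaM f g : fps_theta (f * g) = fps_theta f * g + f * fps_theta g.
Proof.
apply/funext => n; rewrite fps_addE !fps_mulE /fps_theta fps_mulE mulr_sumr.
rewrite -big_split/=; apply: eq_bigr => i _.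
have -> : n%:R = i%:R + (n - i)%:R :> K by rewrite -natrD subnKC// -ltnS.
by ring.
Qed.

Lemma fps_theta0 f : fps_theta f 0%N = 0. Proof. exact: mul0r. Qed.

Lemma fps_thetaD f g : fps_theta (f + g) = fps_theta f + fps_theta g.
Proof. by apply/funext => n; rewrite /fps_theta !fps_addE mulrDr. Qed.

Lemma fps_thetaX f k : fps_theta (f ^+ k.+1) = f ^+ k * fps_theta f *+ k.+1.
Proof.
elim: k => [|k IH]; first by rewrite expr1 expr0 mul1r.
by rewrite exprS fps_thetaM IH exprS; ring.
Qed.

Section Substitution.
Variables (m : nat) (m_gt0 : (0 < m)%N).

Lemma ps_subst_poly (P : {poly K}) f n : (forall i, (i <= n)%N -> P`_i = f i) ->
  ps_subst f m n = (P \Po 'X^m)`_n.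
Proof.
move=> fP; rewrite coef_comp_poly_Xn// /ps_subst; case: ifP => // _.
by rewrite fP// leq_div.
Qed.

Lemma ps_substM f g :
  ps_subst (f * g) m = (ps_subst f m : fps) * (ps_subst g m : fps).
Proof.
apply/funext => n.
rewrite (@ps_subst_poly (trunc n f * trunc n g)) => [|i ni]; last first.
  by symmetry; apply: ps_mul_poly => j ji; rewrite coef_trunc// (leq_trans ji).
rewrite comp_polyM; symmetry; apply: ps_mul_poly => i ni; symmetry;
  by apply: ps_subst_poly => j ji; rewrite coef_trunc// (leq_trans ji).
Qed.

Lemma ps_subst1 : ps_subst (1 : fps) m = (1 : fps).
Proof.
apply/funext => n; rewrite (@ps_subst_poly 1) => [|i _]; last by rewrite coef1.
by rewrite comp_polyC coefC; case: n.
Qed.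

Lemma ps_substX f k : ps_subst (f ^+ k) m = (ps_subst f m : fps) ^+ k.
Proof.
elim: k => [|k IH]; first exact: ps_subst1.
by rewrite !exprS ps_substM IH.
Qed.

Lemma ps_subst0 f : ps_subst f m 0%N = f 0%N.
Proof. by rewrite /ps_subst dvdn0 div0n. Qed.

End Substitution.

Lemma ps_subst_comp f m k : (0 < m)%N -> (0 < k)%N ->
  ps_subst (ps_subst f m) k = ps_subst f (k * m)%N.
Proof.
move=> m0 k0; apply/funext => n; rewrite /ps_subst.
have [/dvdnP[q ->]|kn] := boolP (k %| n)%N.
  by rewrite mulnK// [(q * k)%N]mulnC dvdn_pmul2l// divnMl.
by case: ifP => // /(dvdn_trans (dvdn_mulr m (dvdnn k))); rewrite (negPf kn).
Qed.

Lemma ps_exp_trunc f n M : f 0%N = 0 -> (n <= M)%N ->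
  ps_exp f n = \sum_(k < M.+1) (f ^+ k) n / k`!%:R.
Proof.
move=> f0 nM; rewrite -(subnKC nM) -addSn big_split_ord/= [X in _ + X]big1 ?addr0.
  by apply: eq_bigr => k _; rewrite ps_exp_nE.
by move=> k _; rewrite fps_exprn_eq0 ?mul0r// ltn_addr.
Qed.

Lemma ps_exp0 f : ps_exp f 0%N = 1.
Proof. by rewrite /ps_exp big_ord_recl big_ord0 addr0 fact0 divr1. Qed.

Lemma ps_exp_0 : ps_exp (0 : fps) = (1 : fps).
Proof.
apply/funext => n; rewrite (@ps_exp_trunc 0 n n)// big_ord_recl big1 => [|i _].
  by rewrite addr0 fact0 divr1.
by rewrite lift0 expr0n/= mul0r.
Qed.

Lemma ps_exp_subst f m : f 0%N = 0 -> (0 < m)%N ->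
  ps_exp (ps_subst f m) = ps_subst (ps_exp f) m.
Proof.
move=> f0 m0; apply/funext => n.
rewrite (@ps_exp_trunc _ n n) ?ps_subst0// {2}/ps_subst; case: ifP => mn.
  rewrite (@ps_exp_trunc _ (n %/ m) n) ?leq_div//.
  by apply: eq_bigr => k _; rewrite -ps_substX// /ps_subst mn.
by apply: big1 => k _; rewrite -ps_substX// /ps_subst mn mul0r.
Qed.

Section Exponential.
Hypothesis char0 : forall n : nat, (n.+1%:R : K) != 0.

Lemma fps_theta_exp f : f 0%N = 0 ->
  fps_theta (ps_exp f) = fps_theta f * (ps_exp f : fps).
Proof.
move=> f0; apply/funext => n; rewrite {1}/fps_theta (ps_exp_trunc f0 (leqnn n)).
case: n => [|n]; first by rewrite fps_mul0 /fps_theta !mul0r.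
rewrite mulr_sumr big_ord_recl expr0 fps_1E mul0r mulr0 add0r.
transitivity (\sum_(k < n.+1) (f ^+ k * fps_theta f) n.+1 / k`!%:R).
  apply: eq_bigr => k _; rewrite lift0 mulrA -/(fps_theta (f ^+ k.+1) n.+1).
  rewrite fps_thetaX fps_mulrnE -[_ *+ _]mulr_natr factS natrM.
  by rewrite invfM mulrA mulfK.
rewrite fps_mul_rec fps_theta0 mul0r add0r.
transitivity (\sum_(k < n.+1) \sum_(i < n.+1)
    fps_theta f i.+1 * (f ^+ k) (n - i)%N / k`!%:R).
  apply: eq_bigr => k _; have -> : f ^+ k * fps_theta f = fps_theta f * f ^+ k by rewrite mulrC.
  by rewrite fps_mul_rec fps_theta0 mul0r add0r mulr_suml.
rewrite exchange_big/=; apply: eq_bigr => i _.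
rewrite (ps_exp_trunc f0 (leq_subr i n)) mulr_sumr; apply: eq_bigr => k _.
by ring.
Qed.

(** As f has no constant term, coefficient n+1 of f g only involves g up to degree n, and n+1 is
    invertible, so the equation is a recursion. *)
Lemma fps_ode_uniq f g h : f 0%N = 0 -> fps_theta g = f * g -> fps_theta h = f * h ->
  g 0%N = h 0%N -> g = h.
Proof.
move=> f0 Dg Dh gh0; apply/funext => n; elim/ltn_ind: n => -[//|n] IH.
apply: (mulfI (char0 n)).
rewrite -[LHS]/(fps_theta g n.+1) -[RHS]/(fps_theta h n.+1) Dg Dh !fps_mul_rec f0 !mul0r.
by congr (_ + _); apply: eq_bigr => i _; rewrite IH// ltnS leq_subr.
Qed.

Lemma ps_expD f g : f 0%N = 0 -> g 0%N = 0 ->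
  ps_exp (f + g : fps) = (ps_exp f : fps) * (ps_exp g : fps).
Proof.
move=> f0 g0; have fg0 : (f + g) 0%N = 0 by rewrite fps_addE f0 g0 addr0.
apply: (@fps_ode_uniq (fps_theta (f + g))).
- by rewrite /fps_theta mul0r.
- exact: fps_theta_exp.
- by rewrite fps_thetaM !fps_theta_exp// fps_thetaD; ring.
- by rewrite fps_mul0 !ps_exp0 mulr1.
Qed.

Lemma ps_expN f : f 0%N = 0 -> (ps_exp f : fps) * ps_exp (- f : fps) = 1.
Proof.
move=> f0; rewrite -ps_expD// ?fps_oppE ?f0 ?oppr0// subrr.
exact: ps_exp_0.
Qed.

Lemma ps_expMn f k : f 0%N = 0 -> ps_exp (f *+ k) = (ps_exp f : fps) ^+ k.
Proof.
move=> f0; elim: k => [|k IH]; first exact: ps_exp_0.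
rewrite mulrS ps_expD// ?IH ?exprS//.
by rewrite fps_mulrnE f0 mul0rn.
Qed.

Lemma ps_exp_X (x : K) n : ps_exp (fun i => x * (i == 1)%N%:R) n = x ^+ n / n`!%:R.
Proof.
set f : fps := fun i => _; have f0 : f 0%N = 0 by rewrite /f mulr0.
suff -> : ps_exp f = fun n => x ^+ n / n`!%:R by [].
apply: (@fps_ode_uniq f) => //.
- rewrite fps_theta_exp//; congr (_ * _); apply/funext => -[|[|i]]; rewrite /fps_theta /f.
  + by rewrite mul0r mulr0.
  + by rewrite mul1r.
  + by rewrite !mulr0.
- apply/funext => -[|i]; first by rewrite fps_theta0 fps_mul0 f0 mul0r.
  rewrite fps_mul_rec f0 mul0r add0r big_ord_recl big1 => [|j _].
    rewrite /f mulr1 addr0 subn0 /fps_theta factS natrM exprS.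
    by rewrite -mulf_div mulrA [i.+1%:R * _]mulrC mulfVK.
  by rewrite /f mulr0 mul0r.
- by rewrite ps_exp0 expr0 fact0 divr1.
Qed.

End Exponential.

Definition ps_dilate (x : K) f : fps := fun i => x ^+ i * f i.

Lemma ps_dilateX x f k : ps_dilate x f ^+ k = ps_dilate x (f ^+ k).
Proof.
elim: k => [|k IH].
  by apply/funext => -[|j]; rewrite /ps_dilate !expr0 !fps_1E ?mulr0// mul1r.
rewrite exprS IH; apply/funext => j.
rewrite /ps_dilate [in RHS]exprS !fps_mulE mulr_sumr.
apply: eq_bigr => a _; rewrite mulrACA -exprD subnKC//.
by rewrite -ltnS.
Qed.

Lemma ps_exp_dilate f x n : ps_exp (ps_dilate x f) n = x ^+ n * ps_exp f n.
Proof.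
rewrite /ps_exp mulr_sumr; apply: eq_bigr => k _.
by rewrite !ps_exp_nE ps_dilateX mulrA.
Qed.

End FormalPowerSeries.

(** * The absolute value of C_p *)

Section LognFact.
Variables (p : nat) (p_prime : prime p).
Let p_gt1 : (1 < p)%N := prime_gt1 p_prime.

Lemma logn_fact_rec m : logn p m`! = (m %/ p + logn p (m %/ p)`!)%N.
Proof.
rewrite !logn_fact//; case: m => [|m]; first by rewrite div0n !big_geq.
rewrite big_nat_recl// expn1; congr (_ + _)%N.
have mp : ((m.+1 %/ p).+1 <= m.+1)%N by rewrite ltn_Pdiv.
rewrite (big_cat_nat (n := (m.+1 %/ p).+1))//=.
rewrite [X in (_ + X)%N]big_nat_cond [X in (_ + X)%N]big1 ?addn0.
  by apply: eq_big_nat => i _; rewrite -divnMA -expnS.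
move=> i /andP[/andP[mi _] _]; rewrite expnS divnMA divn_small//.
by rewrite (leq_trans mi)// ltnW// ltn_expl.
Qed.

(** Strictness is what leaves a factor p in p^i / i! for i > 0. *)
Lemma logn_fact_lt m : (0 < m)%N -> (logn p m`! < m)%N.
Proof.
elim/ltn_ind: m => m IH m0; rewrite logn_fact_rec.
have := ltn_Pdiv p_gt1 m0; case: (posnP (m %/ p)) => [->|q0] qm.
  by rewrite fact0 logn1 addn0.
have := IH _ qm q0; have := leq_divM m p.
by move: p_gt1 => p1; nia.
Qed.

End LognFact.

Section ValuedField.
Variables (R : realType) (p : nat) (K : fieldType) (nrm : K -> R).
Hypotheses (p_prime : prime p) (K_Cp : is_Cp p nrm).

Let p_gt0 : (0 < p)%N := prime_gt0 p_prime.
Let p_gt1 : (1 < p)%N := prime_gt1 p_prime.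
Let pR_gt0 : 0 < p%:R :> R. Proof. by rewrite ltr0n. Qed.

Lemma nrm_ge0 x : 0 <= nrm x. Proof. exact: (Cp_norm_ge0 K_Cp). Qed.
Lemma nrmM x y : nrm (x * y) = nrm x * nrm y. Proof. exact: (Cp_normM K_Cp). Qed.
Lemma nrm0 : nrm 0 = 0. Proof. by apply/(Cp_norm_eq0 K_Cp). Qed.

Lemma nrm_eq0 x : (nrm x == 0) = (x == 0).
Proof. by apply/eqP/eqP => /(Cp_norm_eq0 K_Cp). Qed.

Lemma nrm_gt0 x : (0 < nrm x) = (x != 0).
Proof. by rewrite lt_neqAle nrm_ge0 andbT eq_sym nrm_eq0. Qed.

Lemma nrm1 : nrm 1 = 1.
Proof.
have : nrm 1 * nrm 1 = nrm 1 * 1 by rewrite -nrmM !mulr1.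
by apply: mulfI; rewrite nrm_eq0 oner_eq0.
Qed.

Lemma nrmN x : nrm (- x) = nrm x.
Proof.
suff n1 : nrm (- 1) = 1 by rewrite -mulN1r nrmM n1 mul1r.
have /eqP : nrm (- 1) ^+ 2 = 1 by rewrite expr2 -nrmM mulrNN mulr1 nrm1.
rewrite sqrf_eq1 => /orP[/eqP//|/eqP n1].
by have := nrm_ge0 (- 1); rewrite n1 oppr_ge0 ler10.
Qed.

Lemma nrm_subC x y : nrm (x - y) = nrm (y - x).
Proof. by rewrite -nrmN opprB. Qed.

Lemma nrmX x k : nrm (x ^+ k) = nrm x ^+ k.
Proof. by elim: k => [|k IH]; rewrite ?nrm1// !exprS nrmM IH. Qed.

Lemma nrmV x : nrm x^-1 = (nrm x)^-1.
Proof.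
have [->|x0] := eqVneq x 0; first by rewrite invr0 nrm0 invr0.
by apply: (@mulfI _ (nrm x)); rewrite ?nrm_eq0// -nrmM !mulfV ?nrm_eq0// nrm1.
Qed.

Lemma nrm_prod (I : Type) (r : seq I) (P : pred I) (F : I -> K) :
  nrm (\prod_(i <- r | P i) F i) = \prod_(i <- r | P i) nrm (F i).
Proof. exact: (big_morph _ nrmM nrm1). Qed.

Lemma nrmD_le x y B : nrm x <= B -> nrm y <= B -> nrm (x + y) <= B.
Proof.
by move=> xB yB; rewrite (le_trans (Cp_normD K_Cp x y))// ge_max xB yB.
Qed.

Lemma nrmD_lt x y B : nrm x < B -> nrm y < B -> nrm (x + y) < B.
Proof.
by move=> xB yB; rewrite (le_lt_trans (Cp_normD K_Cp x y))// gt_max xB yB.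
Qed.

Lemma nrmB_le x y B : nrm x <= B -> nrm y <= B -> nrm (x - y) <= B.
Proof. by move=> xB yB; rewrite nrmD_le// nrmN. Qed.

Lemma nrmB_lt x y B : nrm x < B -> nrm y < B -> nrm (x - y) < B.
Proof. by move=> xB yB; rewrite nrmD_lt// nrmN. Qed.

Lemma nrm_sum_le (I : Type) (r : seq I) (P : pred I) (F : I -> K) B : 0 <= B ->
  (forall i, P i -> nrm (F i) <= B) -> nrm (\sum_(i <- r | P i) F i) <= B.
Proof.
move=> B0 FB; apply: (big_ind (fun x => nrm x <= B)) => //.
  by rewrite nrm0.
by move=> x y; exact: nrmD_le.
Qed.

Lemma nrm_sum_lt (I : eqType) (r : seq I) (P : pred I) (F : I -> K) B : 0 < B ->
  (forall i, i \in r -> P i -> nrm (F i) < B) -> nrm (\sum_(i <- r | P i) F i) < B.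
Proof.
move=> B0 FB; rewrite big_seq_cond.
apply: (big_ind (fun x => nrm x < B)) => //.
- by rewrite nrm0.
- by move=> x y; exact: nrmD_lt.
- by move=> i /andP[]; exact: FB.
Qed.

Lemma nrm_nat_le1 n : nrm n%:R <= 1.
Proof.
by elim: n => [|n IH]; rewrite ?nrm0// -natr1 nrmD_le ?nrm1.
Qed.

Lemma nrm_int_le1 (m : int) : nrm m%:~R <= 1.
Proof. by case: m => n; rewrite ?NegzE ?mulrNz ?nrmN nrm_nat_le1. Qed.

Lemma nrm_coprime n : coprime p n -> nrm n%:R = 1.
Proof.
move=> pn; apply/eqP; rewrite eq_le nrm_nat_le1/= leNgt; apply/negP => n1.
have [u [w uw]] := Bezoutz (Posz p) (Posz n).
have {}uw : u * p%:Z + w * n%:Z = 1 by rewrite uw /gcdz/=; move/eqP: pn => ->.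
have : nrm (u%:~R * p%:R + w%:~R * n%:R) < 1.
  apply: nrmD_lt; rewrite nrmM.
  - rewrite (Cp_norm_p K_Cp) (@le_lt_trans _ _ (1 * p%:R^-1))//.
      by rewrite ler_wpM2r ?nrm_int_le1.
    by rewrite mul1r invf_lt1// ltr1n.
  - by rewrite (@le_lt_trans _ _ (1 * nrm n%:R)) ?mul1r// ler_piMl ?nrm_ge0 ?nrm_int_le1.
have -> : u%:~R * p%:R + w%:~R * n%:R = (u * p%:Z + w * n%:Z)%:~R :> K.
  by rewrite intrD !intrM.
by rewrite uw nrm1 ltxx.
Qed.

Lemma nrm_nat n : (0 < n)%N -> nrm n%:R = p%:R ^- logn p n.
Proof.
move=> n0; have [m pm nE] := pfactor_coprime p_prime n0.
by rewrite {1}nE natrM natrX nrmM nrm_coprime// mul1r nrmX (Cp_norm_p K_Cp) exprVn.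
Qed.

Lemma nrm_absz (m : int) : nrm m%:~R = nrm (absz m)%:R.
Proof. by case: m => n; rewrite ?NegzE ?mulrNz ?nrmN. Qed.

Lemma Cp_char0 n : n.+1%:R != 0 :> K.
Proof. by rewrite -nrm_gt0 nrm_nat// invr_gt0 exprn_gt0. Qed.

Lemma Cp_natr_neq0 n : (0 < n)%N -> n%:R != 0 :> K.
Proof. by case: n => // n _; exact: Cp_char0. Qed.

Lemma Cp_fact_neq0 n : n`!%:R != 0 :> K.
Proof. by rewrite Cp_natr_neq0 ?fact_gt0. Qed.

Lemma Cp_intr_eq0 (m : int) : (m%:~R == 0 :> K) = (m == 0).
Proof.
apply/eqP/eqP => [|->//]; case: m => [[|n]|n]//; first by move/eqP; rewrite (negPf (Cp_char0 n)).
by rewrite NegzE mulrNz => /eqP; rewrite oppr_eq0 (negPf (Cp_char0 n)).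
Qed.

Lemma nrm_natV_le n : (0 < n)%N -> (nrm n%:R)^-1 <= n%:R.
Proof.
move=> n0; rewrite nrm_nat// invrK -natrX ler_nat dvdn_leq//.
exact: pfactor_dvdnn.
Qed.

Lemma nrm_intV_le (m : int) : m != 0 -> (nrm m%:~R)^-1 <= (absz m)%:R.
Proof.
case: m => n n0; first by rewrite nrm_natV_le// lt0n.
by rewrite NegzE mulrNz nrmN nrm_natV_le.
Qed.

(** Integers embed in K, so [ratr] does not depend on the fraction chosen; its additivity and
    multiplicativity follow from this. *)
Lemma ratr_frac (a b : int) : b != 0 -> ratr (a%:~R / b%:~R) = a%:~R / b%:~R :> K.
Proof.
move=> b0; rewrite /ratr; set q := (_ / _ : rat).
have /eqP : q = (numq q)%:~R / (denq q)%:~R by rewrite divq_num_den.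
rewrite /q eqr_div ?intr_eq0 ?denq_neq0// -!intrM eqr_int -/q => /eqP E.
by apply/eqP; rewrite eqr_div ?Cp_intr_eq0 ?denq_neq0// -!intrM E.
Qed.

Lemma ratr_num_den (q : rat) : ratr q = (numq q)%:~R / (denq q)%:~R :> K.
Proof. by []. Qed.

Lemma Cp_ratrD x y : ratr (x + y) = ratr x + ratr y :> K.
Proof.
have dx : ((denq x)%:~R != 0 :> K) by rewrite Cp_intr_eq0 denq_neq0.
have dy : ((denq y)%:~R != 0 :> K) by rewrite Cp_intr_eq0 denq_neq0.
rewrite -[in LHS](divq_num_den x) -[in LHS](divq_num_den y).
rewrite addf_div ?intr_eq0 ?denq_neq0// -!intrM -intrD ratr_frac ?mulf_neq0 ?denq_neq0//.
by rewrite !ratr_num_den addf_div// intrD !intrM.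
Qed.

Lemma Cp_ratrM x y : ratr (x * y) = ratr x * ratr y :> K.
Proof.
rewrite -[in LHS](divq_num_den x) -[in LHS](divq_num_den y).
rewrite mulf_div -!intrM ratr_frac ?mulf_neq0 ?denq_neq0//.
by rewrite !ratr_num_den mulf_div !intrM.
Qed.

Lemma Cp_ratrN x : ratr (- x) = - ratr x :> K.
Proof.
apply/eqP; rewrite -subr_eq0 opprK -Cp_ratrD addNr.
by rewrite (_ : 0 = 0%:~R)// ratr_int.
Qed.

Lemma Cp_ratr_eq0 x : (ratr x == 0 :> K) = (x == 0).
Proof.
by rewrite ratr_num_den mulf_eq0 invr_eq0 !Cp_intr_eq0 (negPf (denq_neq0 x)) orbF numq_eq0.
Qed.

(** This is Z_p inside K, as the closure of the natural numbers rather than of the integers, so that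
    approximants can be fed to factorials, binomial coefficients and Fermat's little theorem. *)
Definition padic_int : set K :=
  [set x | forall e : nat, exists n : nat, nrm (x - n%:R) <= p%:R ^- e].

Lemma frac_in_Zp (a b : int) : coprimez p%:Z b -> padic_int (a%:~R / b%:~R).
Proof.
move=> pb e; have b1 : nrm b%:~R = 1.
  have pb' : coprime p (absz b) by rewrite /coprime -eqz_nat -[(gcdn _ _)%:Z]/(gcdz p b).
  have := nrm_coprime pb'; case: (b) => n//=.
  by rewrite NegzE mulrNz nrmN.
have [u [w uw]] := Bezoutz (p%:Z ^+ e) b.
have {}uw : u * p%:Z ^+ e + w * b = 1.
  rewrite uw; apply/eqP; have : coprimez (p%:Z ^+ e) b by rewrite coprimezXl.
  by rewrite /coprimez.
have pe0 : p%:Z ^+ e != 0 by rewrite expf_neq0//; case: (p) p_gt0.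
(* Here w inverts b modulo p^e, and the approximant is the residue of a w. *)
exists (absz ((a * w) %% (p%:Z ^+ e))%Z).
have -> : (absz ((a * w) %% (p%:Z ^+ e))%Z)%:R = ((a * w) %% (p%:Z ^+ e))%Z%:~R :> K.
  rewrite -[LHS]/((absz _)%:Z%:~R); congr (_%:~R).
  by rewrite abszE ger0_norm// modz_ge0.
have b0 : b%:~R != 0 :> K by rewrite -nrm_gt0 b1.
have -> : a%:~R / b%:~R - ((a * w) %% (p%:Z ^+ e))%Z%:~R
   = p%:R ^+ e * ((a * u)%:~R / b%:~R + (a * w %/ p%:Z ^+ e)%Z%:~R) :> K.
  have -> : ((a * w) %% (p%:Z ^+ e))%Z = a * w - (a * w %/ p%:Z ^+ e)%Z * p%:Z ^+ e.
    by rewrite {2}(divz_eq (a * w) (p%:Z ^+ e)); ring.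
  have -> : (p%:R ^+ e : K) = (p%:Z ^+ e)%:~R by rewrite rmorphXn.
  have := congr1 (fun z : int => z%:~R : K) uw; rewrite intrD !intrM => uwK.
  rewrite intrB !intrM.
  move: uwK; set P := (_ ^+ e)%:~R; set q := (_ %/ _)%Z%:~R => uwK.
  have -> : a%:~R / b%:~R = a%:~R * (u%:~R * P + w%:~R * b%:~R) / b%:~R :> K by rewrite uwK mulr1.
  by field.
rewrite nrmM nrmX (Cp_norm_p K_Cp) exprVn ler_piMr//.
apply: nrmD_le; last exact: nrm_int_le1.
by rewrite nrmM nrmV b1 invr1 mulr1 nrm_int_le1.
Qed.

Lemma Zp_nrm_le1 x : padic_int x -> nrm x <= 1.
Proof.
move=> /(_ 0%N)[n]; rewrite expr0 invr1 => xn.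
by rewrite -(subrK n%:R x) nrmD_le// nrm_nat_le1.
Qed.

Lemma Zp_ratr q : ~~ (p %| absz (denq q))%N -> padic_int (ratr q).
Proof. by rewrite -prime_coprime// => pq; exact: frac_in_Zp. Qed.

Lemma Zp_Fermat x : padic_int x -> nrm (x ^+ p - x) <= p%:R^-1.
Proof.
move=> Zx; have [n] := Zx 1%N; rewrite expr1 => xn.
have -> : x ^+ p - x = (x ^+ p - n%:R ^+ p) + (n%:R ^+ p - n%:R) - (x - n%:R) by ring.
apply: nrmB_le => //; apply: nrmD_le.
  rewrite subrXX nrmM; apply: le_trans xn; rewrite ler_piMr ?nrm_ge0//.
  apply: nrm_sum_le => // i _; rewrite nrmM !nrmX mulr_ile1 ?exprn_ge0 ?nrm_ge0//.
    by rewrite exprn_ile1 ?nrm_ge0// Zp_nrm_le1.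
  by rewrite exprn_ile1 ?nrm_ge0// nrm_nat_le1.
have nn : (n <= n ^ p)%N by case: (n) => // m; rewrite -{1}(expn1 m.+1) leq_pexp2l.
rewrite -natrX -natrB//; have /dvdnP[c ->] : (p %| n ^ p - n)%N.
  by rewrite -eqn_mod_dvd//; apply/eqP; exact: fermat_little.
by rewrite natrM nrmM (Cp_norm_p K_Cp) ler_piMl ?nrm_nat_le1// invr_ge0.
Qed.

Section Uniformizer.
Variable pi0 : K.
Hypothesis pi0_pow : nrm pi0 ^+ p.-1 = p%:R^-1.

Let pi0_powp : nrm pi0 ^+ p = nrm pi0 * p%:R^-1.
Proof. by rewrite -pi0_pow -exprS prednK. Qed.

Lemma nrm_pi0_gt0 : 0 < nrm pi0.
Proof.
rewrite lt_neqAle nrm_ge0 andbT eq_sym; apply/eqP => n0.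
move: pi0_pow; rewrite n0 expr0n; case: eqP => [|_ /eqP].
  by move: p_gt1 => + H; lia.
by rewrite eq_sym invr_eq0 pnatr_eq0; case: eqP p_gt0 => // ->.
Qed.

Lemma nrm_pi0_lt1 : nrm pi0 < 1.
Proof.
rewrite ltNge; apply/negP => /(exprn_ege1 p.-1); rewrite pi0_pow.
by rewrite leNgt invf_lt1// ltr1n p_gt1.
Qed.

Lemma pi0_neq0 : pi0 != 0.
Proof. by rewrite -nrm_gt0 nrm_pi0_gt0. Qed.

Let pi0_ge0 := ltW nrm_pi0_gt0.
Let pi0_le1 := ltW nrm_pi0_lt1.

Lemma nrm_fact_rec m :
  nrm m`!%:R = p%:R ^- (m %/ p) * nrm (m %/ p)`!%:R.
Proof.
rewrite !nrm_nat ?fact_gt0// -invfM -exprD; congr (_ ^- _).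
exact: (logn_fact_rec p_prime).
Qed.

(** The counterpart for |pi0|^m of Legendre's recursion for |m!|: both acquire p^-(m %/ p), so they
    can be compared by induction along m %/ p. *)
Let pi0_divn m :
  nrm pi0 ^+ m = p%:R ^- (m %/ p) * nrm pi0 ^+ (m %/ p) * nrm pi0 ^+ (m %% p).
Proof.
rewrite {1}(divn_eq m p) exprD mulnC exprM pi0_powp exprMn exprVn.
by rewrite [nrm pi0 ^+ _ * _]mulrC.
Qed.

Lemma nrm_fact_ge m : nrm pi0 ^+ m <= nrm m`!%:R.
Proof.
elim/ltn_ind: m => m IH; have [->|m0] := posnP m; first by rewrite expr0 nrm1.
rewrite nrm_fact_rec pi0_divn -mulrA ler_wpM2l//.
apply: le_trans (IH _ (ltn_Pdiv p_gt1 m0)).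
by rewrite ler_piMr ?exprn_ge0// exprn_ile1.
Qed.

(** The quotient |m!| / |pi0|^m is p^(s/(p-1)) with s the sum of the base-p digits of m. Each digit
    costs at most a factor p, and m > 0 has at most 1 + log_p m digits. *)
Lemma nrm_fact_le m : nrm m`!%:R <= p%:R * m.+1%:R * nrm pi0 ^+ m.
Proof.
have small s : (s < p)%N -> 1 <= p%:R * nrm pi0 ^+ s.
  move=> sp; have : nrm pi0 ^+ p.-1 <= nrm pi0 ^+ s.
    by apply: ler_wiXn2l => //; rewrite -ltnS prednK.
  by rewrite pi0_pow => H; rewrite -[leLHS](@mulfV _ (p%:R : R)) ?gt_eqF// ler_wpM2l.
suff H : (0 < m)%N -> nrm m`!%:R <= p%:R * m%:R * nrm pi0 ^+ m.
  have [->|m0] := posnP m.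
    by rewrite fact0 nrm1 expr0 !mulr1 ler1n.
  apply: le_trans (H m0) _; rewrite ler_wpM2r ?exprn_ge0//.
  by rewrite ler_wpM2l ?ler0n// ler_nat.
elim/ltn_ind: m => m IH m0; rewrite nrm_fact_rec pi0_divn.
have := ltn_Pdiv p_gt1 m0; have := small (m %% p)%N (ltn_pmod _ p_gt0).
move: (leq_divM m p).
case: (posnP (m %/ p)) => [->|q0] qpm ps qm.
  rewrite fact0 nrm1 !expr0 invr1 !mul1r mulrAC mulrC.
  by rewrite mulr_ege1// ler1n.
apply: (@le_trans _ _ (p%:R ^- (m %/ p) * nrm pi0 ^+ (m %/ p) * (p%:R * (m %/ p)%:R))).
  by rewrite -mulrA ler_wpM2l// mulrC IH.
rewrite [leRHS]mulrCA ler_wpM2l ?mulr_ge0 ?exprn_ge0//.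
rewrite mulrAC (@le_trans _ _ m%:R)//; first by rewrite -natrM ler_nat mulnC.
by rewrite ler_peMl.
Qed.

End Uniformizer.

End ValuedField.

(** * Uniqueness of sums of series *)

Section Series.
Variables (R : realType) (p : nat) (K : fieldType) (nrm : K -> R).
Hypotheses (p_prime : prime p) (K_Cp : is_Cp p nrm).

Lemma nrm_cvg0P (u : nat -> K) : (fun n => nrm (u n)) @ \oo --> (0 : R) <->
  forall eps : R, 0 < eps -> exists n0, forall n, (n0 <= n)%N -> nrm (u n) < eps.
Proof.
split=> [/cvgr0Pnorm_lt u0 eps e0|u0].
  have [n0 _ H] := u0 _ e0; exists n0 => n /H.
  by rewrite ger0_norm// (nrm_ge0 K_Cp).
apply/cvgr0Pnorm_lt => eps e0; have [n0 H] := u0 _ e0.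
by exists n0 => // n /H /=; rewrite ger0_norm// (nrm_ge0 K_Cp).
Qed.

Lemma has_seriesP (c : nat -> K) s : has_series nrm c s <->
  forall eps : R, 0 < eps ->
    exists n0, forall n, (n0 <= n)%N -> nrm (\sum_(i < n) c i - s) < eps.
Proof. exact: nrm_cvg0P. Qed.

Lemma nrm_lt_all x : (forall eps : R, 0 < eps -> nrm x < eps) -> x = 0.
Proof.
move=> H; apply/(Cp_norm_eq0 K_Cp)/eqP; rewrite eq_le (nrm_ge0 K_Cp) andbT.
by apply/ler_addgt0Pr => e /H /ltW; rewrite add0r.
Qed.

Lemma has_series_uniq (c : nat -> K) s t :
  has_series nrm c s -> has_series nrm c t -> s = t.
Proof.
move=> /has_seriesP cs /has_seriesP ct; apply/eqP; rewrite -subr_eq0; apply/eqP.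
apply: nrm_lt_all => e e0; have [n1 H1] := cs _ e0; have [n2 H2] := ct _ e0.
have -> : s - t = (\sum_(i < maxn n1 n2) c i - t) - (\sum_(i < maxn n1 n2) c i - s) by ring.
by apply: (nrmB_lt K_Cp); [apply: H2|apply: H1]; rewrite ?leq_maxl ?leq_maxr.
Qed.

Lemma series_sumE (c : nat -> K) s : has_series nrm c s -> series_sum nrm c = s.
Proof.
by move=> cs; apply: (has_series_uniq _ cs); exact: (xgetPex (P := has_series nrm c) 0 (ex_intro _ s cs)).
Qed.

End Series.

(** * Lacunary series with exponents the powers of p *)

Section Lacunary.
Variables (K : fieldType) (p : nat).
Hypothesis p_gt1 : (1 < p)%N.
Implicit Type c : nat -> K.

(** The series sum_i c_i t^(p^i), in the shape of [AH_log] so that the two are convertible; the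
    bound i <= n loses nothing because i < p^i. *)
Definition lacunary c : fps K := fun n => \sum_(i < n.+1 | (p ^ i == n)%N) c i.

Lemma lacunary_pow c i : lacunary c (p ^ i)%N = c i.
Proof.
rewrite /lacunary; have ip : (i < (p ^ i).+1)%N by rewrite ltnS ltnW// ltn_expl.
by rewrite (big_pred1 (Ordinal ip))// => j; rewrite eqn_exp2l.
Qed.

Lemma lacunary_eq0 c n : (forall i, (p ^ i)%N != n) -> lacunary c n = 0.
Proof. by move=> H; rewrite /lacunary big1// => j /eqP; move: (H j) => /eqP. Qed.

Lemma lacunary_case (P : nat -> Prop) : (forall i, P (p ^ i)%N) ->
  (forall n, (forall i, (p ^ i)%N != n) -> P n) -> forall n, P n.
Proof.
move=> Pp Pn n; have [[i /eqP <-//]|H] := pselect (exists i, p ^ i == n)%N.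
by apply: Pn => i; apply/negP => /eqP pin; apply: H; exists i; rewrite pin.
Qed.

Lemma lacunaryD c c' : lacunary (fun i => c i + c' i) = lacunary c + lacunary c'.
Proof. by apply/funext => n; rewrite fps_addE /lacunary big_split. Qed.

Lemma lacunary0 c : lacunary c 0%N = 0.
Proof. by rewrite lacunary_eq0// => i; rewrite -lt0n expn_gt0 ltnW. Qed.

Lemma lacunary_X x : lacunary (fun i => if i is 0 then x else 0) =
  (fun n => x * (n == 1)%N%:R).
Proof.
apply/funext; elim/lacunary_case => [[|i]|n H]; rewrite ?lacunary_pow ?expn0 ?mulr1//.
  by rewrite eqn_leq leqNgt (ltn_exp2l 0) ?mulr0.
by rewrite lacunary_eq0// -(expn0 p) eq_sym (negPf (H _)) mulr0.
Qed.

Lemma lacunary_subst c :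
  ps_subst (lacunary c) p = lacunary (fun i => if i is j.+1 then c j else 0).
Proof.
apply/funext; elim/lacunary_case => [[|i]|n H]; rewrite /ps_subst ?lacunary_pow.
- by rewrite expn0 dvdn1 eqn_leq leqNgt p_gt1.
- by rewrite expnS dvdn_mulr// mulKn ?lacunary_pow// ltnW.
- rewrite [RHS]lacunary_eq0//; case: ifP => // pn.
  apply: lacunary_eq0 => i; apply/eqP => qE.
  by have := H i.+1; rewrite expnS qE mulnC divnK ?eqxx.
Qed.

End Lacunary.

(** * Gauss norms and the Frobenius congruence for polynomials *)

Section DworkSeries.
Variables (R : realType) (p : nat) (K : fieldType) (nrm : K -> R).
Hypotheses (p_prime : prime p) (K_Cp : is_Cp p nrm).

Let p_gt0 : (0 < p)%N := prime_gt0 p_prime.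
Let p_gt1 : (1 < p)%N := prime_gt1 p_prime.
Let char0 := Cp_char0 p_prime K_Cp.
Let pR_gt0 : 0 < p%:R :> R. Proof. by rewrite ltr0n. Qed.
Let n_ge0 := nrm_ge0 K_Cp.

(** For r > 0 this bounds by c the Gauss norm of f on the disc of radius 1/r; a value r < 1 means
    convergence beyond the unit disc. *)
Definition gauss_le (c r : R) (f : nat -> K) := forall n, nrm (f n) <= c * r ^+ n.

Section GaussNorm.
Variables (r : R) (r_ge0 : 0 <= r).

Lemma gauss_leM c c' f g : 0 <= c -> 0 <= c' -> gauss_le c r f -> gauss_le c' r g ->
  gauss_le (c * c') r (ps_mul f g).
Proof.
move=> c0 c0' fc gc n; apply: (nrm_sum_le K_Cp); first by rewrite !mulr_ge0 ?exprn_ge0.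
move=> i _; have -> : r ^+ n = r ^+ i * r ^+ (n - i)%N.
  by rewrite -exprD subnKC// -ltnS.
by rewrite (nrmM K_Cp) mulrACA ler_pM.
Qed.

Lemma gauss_le1 : gauss_le 1 r (@ps_one K).
Proof. by case=> [|n]; rewrite /ps_one/= ?(nrm1 K_Cp) ?(nrm0 K_Cp)// ?mulr1// mul1r exprn_ge0. Qed.

Lemma gauss_leX c f k : 0 <= c -> gauss_le c r f -> gauss_le (c ^+ k) r ((f : fps K) ^+ k).
Proof.
move=> c0 fc; elim: k => [|k IH]; first exact: gauss_le1.
by rewrite !exprS; apply: gauss_leM; rewrite ?exprn_ge0.
Qed.

Lemma gauss_leN c (f : fps K) : gauss_le c r f -> gauss_le c r (- f).
Proof. by move=> fc n; rewrite fps_oppE (nrmN K_Cp). Qed.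

Lemma gauss_le_lacunary C (c : nat -> K) : 0 <= C ->
  (forall i, nrm (c i) <= C * r ^+ (p ^ i)) -> gauss_le C r (lacunary p c).
Proof.
move=> C0 cC; elim/(lacunary_case (p := p)) => [i|n H].
  by rewrite lacunary_pow.
by rewrite lacunary_eq0// (nrm0 K_Cp) mulr_ge0// exprn_ge0.
Qed.

End GaussNorm.

Lemma gauss_le_weak c r r' f : 0 <= c -> 0 <= r -> r <= r' -> gauss_le c r f ->
  gauss_le c r' f.
Proof.
by move=> c0 r0 rr' fc n; rewrite (le_trans (fc n))// ler_wpM2l// lerXn2r// nnegrE// (le_trans r0).
Qed.

Lemma gauss_le_subst c r f m : (0 < m)%N -> 0 <= c -> 0 <= r ->
  gauss_le c (r ^+ m) f -> gauss_le c r (ps_subst f m).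
Proof.
move=> m0 c0 r0 fc n; rewrite /ps_subst; case: ifP => [/dvdnP[q ->]|_].
  by rewrite mulnK// mulnC exprM.
by rewrite (nrm0 K_Cp) mulr_ge0 ?exprn_ge0.
Qed.

Let integral (P : {poly K}) := forall i, nrm P`_i <= 1.

Let integralX (P : {poly K}) k : integral P -> integral (P ^+ k).
Proof.
move=> Pi; have H i : nrm (nth 0 (P ^+ k) i) <= 1 ^+ k * 1 ^+ i.
  elim: k i => [|k IH] i; first by rewrite expr0 coef1 expr1n mul1r expr1n (nrm_nat_le1 K_Cp).
  rewrite exprS coefM; apply: (nrm_sum_le K_Cp) => [|j _]; rewrite !expr1n mul1r//.
  by rewrite (nrmM K_Cp) mulr_ile1 ?n_ge0//; have := IH (i - j)%N; rewrite !expr1n mul1r.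
by move=> i; have := H i; rewrite !expr1n mul1r.
Qed.

(** Horner induction: in (P X + c)^p the inner binomial coefficients are divisible by p, P^p is the
    induction hypothesis, and c^p is congruent to c by Fermat. The last point is why coefficients in
    Z_p are required, and not merely of norm at most 1. *)
Lemma poly_Frobenius (P : {poly K}) n : (forall i, padic_int p nrm P`_i) ->
  nrm (P ^+ p - (P \Po 'X^p))`_n <= p%:R^-1.
Proof.
elim/poly_ind: P n => [|P c IH] n ZP.
  have -> : 0 \Po 'X^p = 0 :> {poly K} by rewrite comp_polyE size_poly0 big_ord0.
  by rewrite expr0n gtn_eqF// subr0 coef0 (nrm0 K_Cp) invr_ge0 ltW.
have ZP' i : padic_int p nrm P`_i by have := ZP i.+1; rewrite coefD coefMX coefC addr0.
have Zc : padic_int p nrm c by have := ZP 0%N; rewrite coefD coefMX coefC add0r.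
have iP : integral P by move=> i; exact: (Zp_nrm_le1 K_Cp).
have -> : (P * 'X + c%:P) ^+ p - ((P * 'X + c%:P) \Po 'X^p) =
  ((P * 'X + c%:P) ^+ p - (P * 'X) ^+ p - c%:P ^+ p) +
    (P ^+ p - (P \Po 'X^p)) * 'X^p + (c ^+ p - c)%:P.
  rewrite comp_polyD comp_polyM comp_polyX comp_polyC exprMn rmorphB rmorphXn/=.
  by ring.
rewrite coefD; apply: (nrmD_le K_Cp); first (rewrite coefD; apply: (nrmD_le K_Cp)).
- rewrite exprDn (bigD1 ord0)//= (bigD1 ord_max)/=; last by rewrite -val_eqE/= -lt0n.
  rewrite subn0 subnn bin0 binn !expr0 mulr1 mul1r !mulr1n.
  set S := \sum_(i < _ | _) _.
  have -> : (P * 'X) ^+ p + (c%:P ^+ p + S) - (P * 'X) ^+ p - c%:P ^+ p = S by ring.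
  rewrite coef_sum; apply: (nrm_sum_le K_Cp) => [|i /andP[i0 ip]]; first by rewrite invr_ge0 ltW.
  rewrite coefMn -[_ *+ 'C(p, i)]mulr_natl (nrmM K_Cp) -[leRHS]mulr1 ler_pM ?n_ge0//.
    have /dvdnP[q ->] : (p %| 'C(p, i))%N.
      by rewrite prime_dvd_bin// lt0n i0/= ltn_neqAle ip -ltnS ltn_ord.
    by rewrite natrM (nrmM K_Cp) (Cp_norm_p K_Cp) ler_piMl ?(nrm_nat_le1 K_Cp)// invr_ge0 ltW.
  rewrite -polyC_exp coefMC (nrmM K_Cp) mulr_ile1 ?n_ge0//.
    by apply: integralX => j; rewrite coefMX; case: eqP => // _; rewrite (nrm0 K_Cp).
  by rewrite (nrmX K_Cp) exprn_ile1 ?n_ge0// (Zp_nrm_le1 K_Cp).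
- rewrite coefMXn; case: ifP => _; last exact: IH.
  by rewrite (nrm0 K_Cp) invr_ge0 ltW.
- rewrite coefC; case: eqP => _; first exact: (Zp_Fermat p_prime K_Cp).
  by rewrite (nrm0 K_Cp) invr_ge0 ltW.
Qed.

End DworkSeries.

(** * The Artin-Hasse exponential *)

Section ArtinHasse.
Variables (R : realType) (p : nat) (K : fieldType) (nrm : K -> R).
Hypotheses (p_prime : prime p) (K_Cp : is_Cp p nrm).

Let p_gt0 : (0 < p)%N := prime_gt0 p_prime.
Let p_gt1 : (1 < p)%N := prime_gt1 p_prime.
Let char0 := Cp_char0 p_prime K_Cp.
Let pR_gt0 : 0 < p%:R :> R. Proof. by rewrite ltr0n. Qed.
Let pV_ge0 : 0 <= p%:R^-1 :> R. Proof. by rewrite invr_ge0 ltW. Qed.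
Let pV_le1 : p%:R^-1 <= 1 :> R. Proof. by rewrite invf_le1// ler1n. Qed.
Let n_ge0 := nrm_ge0 K_Cp.

(** Rationality of the Artin-Hasse coefficients is tracked because norm at most 1 does not by itself
    place an element of K in Z_p. *)
Definition is_frac (x : K) := exists (a : int) (b : nat),
  (0 < b)%N /\ x = a%:~R / b%:R.

Let bn0 b : (0 < b)%N -> (b%:R : K) != 0.
Proof. exact: (Cp_natr_neq0 p_prime K_Cp). Qed.

Lemma is_frac_int (a : int) : is_frac a%:~R.
Proof. by exists a, 1%N; rewrite divr1. Qed.

Lemma is_fracD x y : is_frac x -> is_frac y -> is_frac (x + y).
Proof.
move=> [a [b [b0 ->]]] [c [d [d0 ->]]]; exists (a * d + c * b), (b * d)%N.
by rewrite muln_gt0 b0 d0 addf_div ?bn0// natrM intrD !intrM.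
Qed.

Lemma is_fracM x y : is_frac x -> is_frac y -> is_frac (x * y).
Proof.
move=> [a [b [b0 ->]]] [c [d [d0 ->]]]; exists (a * c), (b * d)%N.
by rewrite muln_gt0 b0 d0 mulf_div natrM intrM.
Qed.

Lemma is_frac_natV n : is_frac n%:R^-1.
Proof.
case: n => [|n]; first by rewrite invr0; exact: (is_frac_int 0).
by exists 1, n.+1; rewrite mul1r.
Qed.

Lemma is_frac_sum (I : Type) (r : seq I) (P : pred I) F :
  (forall i, P i -> is_frac (F i)) -> is_frac (\sum_(i <- r | P i) F i).
Proof. by move=> H; apply: big_ind => //; [exact: (is_frac_int 0)|exact: is_fracD]. Qed.

Lemma is_frac_Zp x : is_frac x -> nrm x <= 1 -> padic_int p nrm x.
Proof.
move=> [a [b [b0 xE]]] x1; pose q : rat := a%:~R / (Posz b)%:~R.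
have bz : Posz b != 0 by rewrite eqz_nat -lt0n.
have qx : ratr q = x by rewrite xE (ratr_frac p_prime K_Cp).
rewrite -qx; apply: (Zp_ratr p_prime K_Cp); apply/negP => pd.
have pn : coprime p (absz (numq q)).
  rewrite prime_coprime//; apply/negP => pn.
  have : (p %| gcdn (absz (numq q)) (absz (denq q)))%N by rewrite dvdn_gcd pn pd.
  by rewrite (eqP (coprime_num_den q)) dvdn1 gtn_eqF.
have d0 : (0 < absz (denq q))%N by rewrite absz_gt0 denq_neq0.
have := x1; rewrite -qx ratr_num_den (nrmM K_Cp) (nrmV K_Cp) !(nrm_absz K_Cp).
rewrite (nrm_coprime p_prime K_Cp)// mul1r (nrm_nat p_prime K_Cp)// invrK.
have l0 : logn p (absz (denq q)) != 0%N by rewrite -lt0n logn_gt0 mem_primes p_prime d0.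
by rewrite leNgt exprn_egt1 ?ltr1n// l0.
Qed.

Definition artin_hasse : fps K := ps_exp (lacunary p (fun i => (p ^ i)%:R^-1)).

Lemma is_frac_artin_hasse n : is_frac (artin_hasse n).
Proof.
have frac0 := is_frac_int 0; have frac1 := is_frac_int 1.
apply: is_frac_sum => k _; apply: is_fracM; last exact: is_frac_natV.
rewrite ps_exp_nE; set L := lacunary _ _.
suff fracX j m : is_frac ((L ^+ j) m) by exact: fracX.
elim: j m => [|j IH] m; first by rewrite expr0 fps_1E; case: eqP.
rewrite exprS fps_mulE; apply: is_frac_sum => i _; apply: is_fracM => //.
by apply: is_frac_sum => h _; exact: is_frac_natV.
Qed.

(* p log F(t) = log F(t^p) + p t *)
Lemma artin_hasse_expr :
  artin_hasse ^+ p = (ps_subst artin_hasse p : fps K) *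
    (ps_exp (fun i => p%:R * (i == 1)%N%:R) : fps K).
Proof.
have L0 c : lacunary p c 0%N = 0 :> K by rewrite lacunary0.
rewrite /artin_hasse -ps_expMn//.
rewrite -ps_exp_subst ?lacunary0// -ps_expD ?ps_subst0 ?mulr0//.
congr ps_exp; rewrite lacunary_subst// -(lacunary_X p_gt1).
rewrite -lacunaryD; apply/funext => n; rewrite fps_mulrnE /lacunary -sumrMnl.
apply: eq_bigr => -[[|i] _] _ /=; first by rewrite expn0 invr1 add0r.
by rewrite addr0 expnS natrM invfM -mulrnAl -[_^-1 *+ p]mulr_natr mulVf ?mul1r ?bn0.
Qed.

Lemma nrm_pexp_fact i : (0 < i)%N -> nrm (p%:R ^+ i / i`!%:R) <= p%:R^-1.
Proof.
move=> i0; rewrite (nrmM K_Cp) (nrmV K_Cp) (nrmX K_Cp) (Cp_norm_p K_Cp).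
rewrite (nrm_nat p_prime K_Cp) ?fact_gt0// invrK exprVn.
have := logn_fact_lt p_prime i0; move: (logn p i`!) => v vi.
have -> : p%:R ^+ i = p%:R ^+ v * (p%:R * p%:R ^+ (i - v.+1)%N) :> R.
  by rewrite -exprS -exprD addnS -addSn subnKC.
have pv0 : p%:R ^+ v != 0 :> R by rewrite expf_neq0 ?gt_eqF.
rewrite invfM mulrAC mulVf// mul1r invfM ler_piMr//.
by rewrite invf_le1 ?exprn_gt0// exprn_ege1// ler1n.
Qed.

(* Dwork's lemma: comparing the coefficients of t^n in F(t)^p = F(t^p) exp(p t),
   the congruence P(t)^p = P(t^p) mod p for the truncation P of F at degree n
   shows that p divides p F_n. *)
Lemma artin_hasse_integral n : nrm (artin_hasse n) <= 1.
Proof.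
elim/ltn_ind: n => -[|n] IH; first by rewrite /artin_hasse ps_exp0 (nrm1 K_Cp).
set F := artin_hasse; pose P : {poly K} := \poly_(i < n.+1) F i.
pose Q := P + F n.+1 *: 'X^(n.+1).
have P0 : P`_0 = 1 by rewrite coef_poly /F /artin_hasse ps_exp0.
have Q0 : Q`_0 = 1 by rewrite coefD coefZ coefXn P0 mulr0 addr0.
have QF i : (i <= n.+1)%N -> Q`_i = F i.
  rewrite leq_eqVlt => /predU1P[->|ilt]; rewrite coefD coefZ coefXn coef_poly.
    by rewrite ltnn eqxx mulr1 add0r.
  by rewrite ilt ltn_eqF// mulr0 addr0.
have ZP i : padic_int p nrm P`_i.
  rewrite coef_poly; case: ifP => iN.
    by apply: is_frac_Zp; [exact: is_frac_artin_hasse|exact: IH].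
  by apply: is_frac_Zp; [exact: (is_frac_int 0)|rewrite (nrm0 K_Cp)].
have X0 (S : {poly K}) k : S`_0 = 1 -> (S ^+ k)`_0 = 1.
  by move=> S0; elim: k => [|k IHk]; rewrite ?coef1// exprS coef0M S0 IHk mulr1.
(* Q^p - P^p is F_(n+1) X^(n+1) times a sum of p products, each with constant term 1; this isolates
   p F_(n+1). *)
have E1 : (F ^+ p) n.+1 = (P ^+ p)`_n.+1 + p%:R * F n.+1.
  rewrite -(fps_expr_poly p QF)// -[Q ^+ p](subrK (P ^+ p)) coefD addrC.
  congr (_ + _); rewrite subrXX [Q - P]addrC addKr -scalerAl coefZ coefXnM ltnn subnn.
  rewrite coef_sum (eq_bigr (fun=> 1)) => [|i _]; last by rewrite coef0M !X0// mulr1.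
  by rewrite sumr_const card_ord mulrC.
have E2 : (F ^+ p) n.+1 = (P \Po 'X^p)`_n.+1 +
    \sum_(i < n.+1) ps_subst F p (n - i)%N * (p%:R ^+ i.+1 / i.+1`!%:R).
  rewrite artin_hasse_expr mulrC fps_mul_rec ps_exp0 mul1r; congr (_ + _).
    rewrite coef_comp_poly_Xn// /ps_subst; case: ifP => // _.
    by rewrite coef_poly ltn_Pdiv.
  by apply: eq_bigr => i _; rewrite (ps_exp_X char0) mulrC.
have : nrm (p%:R * F n.+1) <= p%:R^-1.
  have -> : p%:R * F n.+1 = (F ^+ p) n.+1 - (P \Po 'X^p)`_n.+1
      - (P ^+ p - (P \Po 'X^p))`_n.+1.
    by rewrite E1 coefB; ring.
  apply: (nrmB_le K_Cp); last exact: (poly_Frobenius p_prime K_Cp).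
  rewrite E2 [X in X - _]addrC addrK; apply: (nrm_sum_le K_Cp) => // i _.
  rewrite (nrmM K_Cp) -[leRHS]mul1r ler_pM ?n_ge0 ?nrm_pexp_fact//.
  rewrite /ps_subst; case: ifP => _; last by rewrite (nrm0 K_Cp).
  by rewrite IH// ltnS (leq_trans (leq_div _ _))// leq_subr.
by rewrite (nrmM K_Cp) (Cp_norm_p K_Cp) ger_pMr// invr_gt0.
Qed.

End ArtinHasse.

(** * The series theta, theta_hat1 and sigma *)

Section SubstFixpoint.
Variables (K : fieldType) (p : nat) (p_gt1 : (1 < p)%N).

(** Coefficient n+1 of g(t^p) involves g only at (n+1)/p, which is at most n, so the equation
    determines g from its constant term. *)
Lemma ps_subst_fixpoint (f g h : fps K) :
  g = f * (ps_subst g p : fps K) -> h = f * (ps_subst h p : fps K) ->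
  g 0%N = h 0%N -> g = h.
Proof.
move=> gE hE gh0; apply/funext; elim/ltn_ind => -[//|n] IH.
have S m : (m %/ p <= n)%N -> ps_subst g p m = ps_subst h p m.
  by move=> mn; rewrite /ps_subst; case: ifP => // _; rewrite IH.
rewrite gE hE !fps_mul_rec S; last by rewrite -ltnS ltn_Pdiv.
congr (_ + _); apply: eq_bigr => i _; rewrite S//.
by rewrite (leq_trans (leq_div _ _))// leq_subr.
Qed.

End SubstFixpoint.

Section Splitting.
Variables (R : realType) (p : nat) (K : fieldType) (nrm : K -> R).
Hypotheses (p_prime : prime p) (K_Cp : is_Cp p nrm).
Variable pi0 : K.

Let p_gt0 : (0 < p)%N := prime_gt0 p_prime.
Let p_gt1 : (1 < p)%N := prime_gt1 p_prime.
Let char0 := Cp_char0 p_prime K_Cp.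

Let c i : K := pi0 ^+ (p ^ i) / (p ^ i)%:R.
(** The coefficient of t^(p^j) in log theta_hat. The c_i sum to 0 by the choice of pi0, so gam_j is
    minus a tail of their series. Below, h is log theta_hat1. *)
Let gam j : K := \sum_(i < j.+1) c i.
Let theta : fps K := theta p pi0.
Let theta_hat : fps K := theta_hat p pi0.
Let tau : fps K := theta_hat1 p pi0.
Let sigma : fps K := sigma p pi0.
Let lin : fps K := fun n => pi0 * (n == 1)%N%:R.
Let h : fps K := lacunary p (fun j => if j is 0 then 0 else gam j).

Let lin0 : lin 0%N = 0. Proof. exact: mulr0. Qed.
Let h0 : h 0%N = 0. Proof. exact: lacunary0. Qed.

Lemma theta_dilate n : Defs.theta p pi0 n = pi0 ^+ n * artin_hasse p K n.
Proof.
rewrite -ps_exp_dilate; congr (ps_exp _ n); apply/funext.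
elim/(lacunary_case (p := p)) => [i|m H]; rewrite /ps_dilate.
  by rewrite -[LHS]/(lacunary p c _) !lacunary_pow.
by rewrite -[LHS]/(lacunary p c _) !lacunary_eq0// mulr0.
Qed.

Let theta0 : theta 0%N = 1. Proof. exact: ps_exp0. Qed.

Let theta_hat_trunc n M : (n < M)%N ->
  theta_hat n = (\prod_(j < M) (ps_subst theta (p ^ j) : fps K)) n.
Proof.
elim: M => // M IH; rewrite ltnS leq_eqVlt => /predU1P[-> //|nM].
rewrite IH// big_ord_recr/=; set P := \prod_(i < M) _.
rewrite [RHS]fps_mulE big_ord_recr/= subnn ps_subst0 theta0 mulr1.
rewrite big1 ?add0r// => i _; rewrite /ps_subst; case: ifP => [|_]; last exact: mulr0.
rewrite gtnNdvd ?subn_gt0//.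
by rewrite (leq_ltn_trans (leq_subr _ _))// (leq_trans nM)// ltnW// ltn_expl.
Qed.

Lemma theta_hat_rec : theta_hat = theta * (ps_subst theta_hat p : fps K).
Proof.
apply/funext => n; rewrite (@theta_hat_trunc n n.+2)// big_ord_recl expn0.
have -> : ps_subst theta 1 = theta.
  by apply/funext => i; rewrite /ps_subst dvd1n divn1.
rewrite !fps_mulE; apply: eq_bigr => i _; congr (_ * _).
have -> : \prod_(j < n.+1) (ps_subst theta (p ^ lift ord0 j) : fps K) =
    ps_subst (\prod_(j < n.+1) (ps_subst theta (p ^ j) : fps K)) p :> fps K.
  elim: n.+1 => [|m IH]; first by rewrite !big_ord0 ps_subst1.
  rewrite !big_ord_recr/= IH ps_substM//; congr (_ * _).
  by rewrite ps_subst_comp ?expn_gt0 ?p_gt0// -expnS.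
rewrite /ps_subst; case: ifP => // _; symmetry; apply: theta_hat_trunc.
by rewrite ltnS (leq_trans (leq_div _ _))// leq_subr.
Qed.

(** Both sides solve g = theta g(t^p): under this equation the coefficients of log g are the running
    sums of those of log theta. *)
Let theta_hat_exp : theta_hat = ps_exp (lacunary p gam).
Proof.
apply: (ps_subst_fixpoint p_gt1) theta_hat_rec _ _; last first.
  by rewrite ps_exp0 (@theta_hat_trunc 0 1)// big_ord1 ps_subst0 theta0.
have L0 : AH_log p pi0 0%N = 0 := lacunary0 p_gt1 c.
rewrite -ps_exp_subst ?lacunary0// -(ps_expD char0) ?ps_subst0 ?lacunary0//.
congr ps_exp; rewrite lacunary_subst// -[AH_log _ _]/(lacunary p c).
rewrite -lacunaryD; congr lacunary; apply/funext => -[|j].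
  by rewrite addr0 /gam big_ord1.
by rewrite /gam big_ord_recr/= addrC.
Qed.

Let gam_lin : lacunary p gam = h + lin.
Proof.
rewrite -[lin](lacunary_X p_gt1) -lacunaryD; congr lacunary; apply/funext => -[|j].
  by rewrite add0r /gam big_ord1 /c expn0 expr1 divr1.
by rewrite addr0.
Qed.

Let explin_tau : (ps_exp lin : fps K) * tau = theta_hat.
Proof. by rewrite [LHS]mulrCA ps_invE ?mulr1// ps_exp0. Qed.

Lemma theta_hat1_exp : tau = ps_exp h.
Proof.
apply: (@fps_mulI _ (ps_exp lin : fps K)); first by rewrite ps_exp0 oner_eq0.
by rewrite explin_tau theta_hat_exp gam_lin (ps_expD char0)// mulrC.
Qed.

Lemma sigma_exp : sigma * (ps_exp (ps_subst lin p) : fps K) = ps_exp lin.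
Proof.
have lin_p : (fun n => pi0 * (n == p)%:R) = ps_subst lin p.
  apply/funext => n; rewrite /ps_subst /lin; case: ifP => [/dvdnP[q ->]|].
    by rewrite mulnK// -{2}(mul1n p) eqn_pmul2r.
  by case: eqP => [->|]; rewrite ?dvdnn// mulr0.
have linp0 : ps_subst lin p 0 = 0 by rewrite ps_subst0 lin0.
rewrite -[in RHS](subrK (ps_subst lin p : fps K) lin) (ps_expD char0)//; last first.
  by rewrite fps_addE fps_oppE linp0 lin0 subr0.
by rewrite -lin_p.
Qed.

(** After multiplication by exp(pi0 t^p) both sides become theta_hat(t), using theta_hat(t) =
    theta(t) theta_hat(t^p). *)
Lemma theta_theta_hat1 : theta * (ps_subst tau p : fps K) = sigma * tau.
Proof.
apply: (@fps_mulI _ (ps_exp (ps_subst lin p) : fps K)).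
  by rewrite ps_exp0 oner_eq0.
rewrite mulrCA ps_exp_subst// -ps_substM// explin_tau -theta_hat_rec.
by rewrite -ps_exp_subst// mulrA [_ * sigma]mulrC sigma_exp explin_tau.
Qed.

Hypothesis pi0_pow : nrm pi0 ^+ p.-1 = p%:R^-1.
Hypothesis pi0_root : has_series nrm c 0.

Let n_ge0 := nrm_ge0 K_Cp.
Let pi0_ge0 : 0 <= nrm pi0 := n_ge0 pi0.
Let pR_gt0 : 0 < p%:R :> R. Proof. by rewrite ltr0n. Qed.
Let pV_ge0 : 0 <= p%:R^-1 :> R. Proof. by rewrite invr_ge0 ltW. Qed.
Let pV_le1 : p%:R^-1 <= 1 :> R. Proof. by rewrite invf_le1// ler1n. Qed.

(** From |pi0|^(p-1) = 1/p. Thus c_0 and c_1 both have norm |pi0|, and the decay only starts at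
    c_2. *)
Let nrm_cS i : nrm (c i.+1) = nrm (c i) * p%:R^-1 ^+ (p ^ i).-1.
Proof.
have nrm_c k : nrm (c k) = nrm pi0 ^+ (p ^ k) * p%:R ^+ k.
  by rewrite /c (nrmM K_Cp) (nrmV K_Cp) !natrX !(nrmX K_Cp) (Cp_norm_p K_Cp) -exprVn invrK.
rewrite !nrm_c; have -> : (p ^ i.+1 = p ^ i + p.-1 * p ^ i)%N by rewrite expnS -{1}(prednK p_gt0) mulSn.
rewrite exprD exprM pi0_pow exprS.
have -> : p%:R^-1 ^+ (p ^ i) = p%:R^-1 * p%:R^-1 ^+ (p ^ i).-1 :> R.
  by rewrite -exprS prednK// expn_gt0 p_gt0.
have p0 : p%:R != 0 :> R by rewrite gt_eqF.
by field.
Qed.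

Let nrm_c1 : nrm (c 1) = nrm pi0.
Proof.
by rewrite nrm_cS expn0 expr0 mulr1 /c expn0 divr1 expr1.
Qed.

Let nrm_cSS i : nrm (c i.+2) <= nrm pi0 * p%:R^-1 ^+ (p ^ i).
Proof.
have cle : forall k, nrm (c k.+1) <= nrm pi0.
  elim=> [|k IH]; first by rewrite nrm_c1.
  by rewrite nrm_cS (le_trans _ IH)// ler_piMr// exprn_ile1.
rewrite nrm_cS ler_pM ?exprn_ge0//; apply: ler_wiXn2l => //.
have : (p ^ i < p ^ i.+1)%N by rewrite ltn_exp2l.
by case: (p ^ i.+1)%N.
Qed.

(** Add enough further terms to bring the partial sum below the bound; the terms added start at
    c_(j+2) and obey [nrm_cSS]. *)
Let nrm_gam j : nrm (gam j.+1) <= nrm pi0 * p%:R^-1 ^+ (p ^ j).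
Proof.
have B0 : 0 < nrm pi0 * p%:R^-1 ^+ (p ^ j).
  by rewrite mulr_gt0 ?exprn_gt0 ?invr_gt0// (nrm_pi0_gt0 p_prime K_Cp pi0_pow).
have [m Hm] := (has_seriesP K_Cp c 0).1 pi0_root _ B0.
have {Hm} := Hm (m + j.+2)%N (leq_addr _ _); rewrite subr0 addnC big_split_ord/= => Hm.
rewrite -[gam _](addrK (\sum_(i < m) c (j.+2 + i)%N)).
apply: (nrmB_le K_Cp); first exact: ltW.
apply: (nrm_sum_le K_Cp); first exact: ltW.
move=> i _; rewrite addSn addSn (le_trans (nrm_cSS _))// ler_wpM2l//.
by rewrite ler_wiXn2l// leq_pexp2l// leq_addr.
Qed.

Section Estimates.
(** A common decay rate. The bound |pi0| p^-(p^j) on the coefficient of t^(p^(j+1)) in h is at most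
    |pi0| (r0^p)^(p^(j+1)) exactly because 1/p <= r0^(p p). So theta_hat1 has rate r0^p, hence
    theta_hat1(t^p) has rate r0, and theta has rate |pi0| <= r0. *)
Variable r0 : R.
Hypotheses (r0_ge0 : 0 <= r0) (r0_le1 : r0 <= 1).
Hypotheses (pi0_r0 : nrm pi0 <= r0) (p_r0 : p%:R^-1 <= r0 ^+ (p * p)).

(** The k-th term is at most |pi0|^k r^n / |k!|, and |pi0|^k <= |k!|. *)
Lemma gauss_le_exp (r : R) (f : fps K) : 0 <= r -> f 0%N = 0 ->
  gauss_le nrm (nrm pi0) r f -> gauss_le nrm 1 r (ps_exp f).
Proof.
move=> r0' f0 fr n; rewrite mul1r; apply: (nrm_sum_le K_Cp) => [|k _].
  by rewrite exprn_ge0.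
rewrite ps_exp_nE (nrmM K_Cp) (nrmV K_Cp) ler_pdivrMr; last first.
  by rewrite (nrm_gt0 K_Cp) (Cp_fact_neq0 p_prime K_Cp).
rewrite (le_trans (gauss_leX K_Cp r0' k pi0_ge0 fr n))// mulrC ler_wpM2l ?exprn_ge0//.
exact: (nrm_fact_ge p_prime K_Cp pi0_pow).
Qed.

Let h_le : gauss_le nrm (nrm pi0) (r0 ^+ p) h.
Proof.
apply: (gauss_le_lacunary p_prime K_Cp) => //; first by rewrite exprn_ge0.
case=> [|j]; first by rewrite (nrm0 K_Cp) mulr_ge0 ?exprn_ge0.
rewrite (le_trans (nrm_gam j))// ler_wpM2l// -exprM -expnS expnS expnS mulnA exprM.
by rewrite lerXn2r// nnegrE// exprn_ge0.
Qed.

Lemma theta_le : gauss_le nrm 1 (nrm pi0) theta.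
Proof.
move=> n; rewrite /theta theta_dilate mul1r (nrmM K_Cp) (nrmX K_Cp).
by rewrite ler_piMr ?exprn_ge0// (artin_hasse_integral p_prime K_Cp).
Qed.

Lemma theta_hat1_le : gauss_le nrm 1 (r0 ^+ p) tau.
Proof. by rewrite theta_hat1_exp; apply: gauss_le_exp; rewrite ?exprn_ge0. Qed.

(** Bounding the exponential factors exp(pi0 t) and exp(-pi0 t^p) separately gives no decay. The
    factorization theta(t) theta_hat1(t^p) / theta_hat1(t) does, each factor having rate at most
    r0. *)
Lemma sigma_le : gauss_le nrm 1 r0 sigma.
Proof.
have -> : sigma = theta * (ps_subst tau p : fps K) * (ps_exp (- h) : fps K).
  by rewrite theta_theta_hat1 -mulrA theta_hat1_exp (ps_expN char0)// mulr1.
rewrite -(mulr1 1) -{1}(mulr1 1); apply: (gauss_leM K_Cp) => //.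
  apply: (gauss_leM K_Cp) => //.
    exact: gauss_le_weak theta_le.
  by apply: (gauss_le_subst K_Cp) => //; exact: theta_hat1_le.
apply: (@gauss_le_weak _ _ _ _ (r0 ^+ p)); rewrite ?exprn_ge0//.
  by rewrite -[leRHS]expr1 ler_wiXn2l.
apply: gauss_le_exp; rewrite ?exprn_ge0//; first by rewrite fps_oppE h0 oppr0.
exact: (gauss_leN K_Cp).
Qed.

End Estimates.
End Splitting.

(** * Ultrametric summable families *)

Section Families.
Variables (R : realType) (p : nat) (K : fieldType) (nrm : K -> R).
Hypotheses (K_Cp : is_Cp p nrm).

Let n_ge0 := nrm_ge0 K_Cp.

Lemma fset_sum_sub (I : choiceType) (c : I -> K) (F F' : {fset I}) : (F `<=` F')%fset ->
  \sum_(i <- F') c i - \sum_(i <- F) c i = \sum_(i <- F' | i \notin F) c i.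
Proof.
move=> FF'; rewrite (bigID (fun i => i \in F))/= addrAC.
suff -> : \sum_(i <- F' | i \in F) c i = \sum_(i <- F) c i by rewrite subrr add0r.
rewrite -big_filter; apply: perm_big; apply: uniq_perm.
- by rewrite filter_uniq// fset_uniq.
- exact: fset_uniq.
- move=> i; rewrite mem_filter; case: (boolP (i \in F)) => //= iF.
  exact: (fsubsetP FF').
Qed.

(** Ultrametric tail estimate: the error of a finite partial sum is controlled by the largest
    omitted term, not by the number of omitted terms. *)
Lemma has_fam_sum_approx (I : choiceType) (c : I -> K) s (F : {fset I}) eps :
  0 < eps -> has_fam_sum nrm c s -> (forall i, i \notin F -> nrm (c i) < eps) ->
  nrm (\sum_(i <- F) c i - s) < eps.
Proof.
move=> e0 /(_ _ e0)[F0 HF0] Fc.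
have := HF0 (F0 `|` F)%fset (fsubsetUl _ _) => H.
rewrite -(subrK (\sum_(i <- (F0 `|` F)%fset) c i) (\sum_(i <- F) c i)) -addrA.
apply: (nrmD_lt K_Cp) => //; rewrite (nrm_subC K_Cp) fset_sum_sub ?fsubsetUr//.
by apply: (nrm_sum_lt K_Cp) => // i _; exact: Fc.
Qed.

Lemma has_fam_sum_crit (I : choiceType) (c : I -> K) s :
  (forall eps : R, 0 < eps -> exists F : {fset I},
     (forall i, i \notin F -> nrm (c i) < eps) /\ nrm (\sum_(i <- F) c i - s) < eps) ->
  has_fam_sum nrm c s.
Proof.
move=> H eps e0; have [F [Fc Fs]] := H _ e0; exists F => F' FF'.
rewrite -(subrK (\sum_(i <- F) c i) (\sum_(i <- F') c i)) -addrA.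
by apply: (nrmD_lt K_Cp) => //; rewrite fset_sum_sub//; apply: (nrm_sum_lt K_Cp) => // i _; exact: Fc.
Qed.

Lemma has_fam_sum_tail (I : choiceType) (c : I -> K) s : has_fam_sum nrm c s ->
  forall eps : R, 0 < eps ->
    exists F : {fset I}, forall i, i \notin F -> nrm (c i) < eps.
Proof.
move=> cs eps e0; have [F HF] := cs _ e0; exists F => i iF.
have -> : c i = (\sum_(j <- (i |` F)%fset) c j - s) - (\sum_(j <- F) c j - s).
  by rewrite big_fsetU1//=; ring.
by apply: (nrmB_lt K_Cp); apply: HF => //; exact: fsubsetUr.
Qed.

Lemma has_fam_sum_uniq (I : choiceType) (c : I -> K) s t :
  has_fam_sum nrm c s -> has_fam_sum nrm c t -> s = t.
Proof.
move=> cs ct; apply/eqP; rewrite -subr_eq0; apply/eqP; apply: (nrm_lt_all K_Cp) => e e0.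
have [F Fc] := has_fam_sum_tail cs e0.
have -> : s - t = (\sum_(i <- F) c i - t) - (\sum_(i <- F) c i - s) by ring.
by apply: (nrmB_lt K_Cp); exact: has_fam_sum_approx.
Qed.

Lemma fam_sumE (I : choiceType) (c : I -> K) s :
  has_fam_sum nrm c s -> fam_sum nrm c = s.
Proof.
move=> cs; apply: (has_fam_sum_uniq _ cs).
exact: (xgetPex (P := has_fam_sum nrm c) 0 (ex_intro _ s cs)).
Qed.

(** Convergence to 0 along the cofinite filter, which over K is equivalent to summability. *)
Definition vanishing (I : Type) (c : I -> K) :=
  forall eps : R, 0 < eps -> finite_set [set i | eps <= nrm (c i)].

Lemma vanishing_fset (I : choiceType) (c : I -> K) : vanishing c ->
  forall eps : R, 0 < eps ->
    exists F : {fset I}, forall i, i \notin F -> nrm (c i) < eps.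
Proof.
move=> cv eps e0; exists (fset_set [set i | eps <= nrm (c i)]) => i.
rewrite in_fset_set; last exact: cv.
by rewrite ltNge => /negP H; apply/negP => ei; apply: H; rewrite inE.
Qed.

(** The sums over finite sets F_n outside which all terms are below 1/(n+1) form a Cauchy sequence
    by the tail estimate. *)
Lemma vanishing_has_sum (I : choiceType) (c : I -> K) : vanishing c ->
  exists s, has_fam_sum nrm c s.
Proof.
move=> cv; have e_gt0 n : 0 < n.+1%:R^-1 :> R by rewrite invr_gt0.
pose F n : {fset I} := projT1 (cid (vanishing_fset cv (e_gt0 n))).
have FP n i : i \notin F n -> nrm (c i) < n.+1%:R^-1.
  exact: (projT2 (cid (vanishing_fset cv (e_gt0 n)))).
pose u n := \sum_(i <- F n) c i.
have small eps : 0 < eps -> exists n, forall m, (n <= m)%N -> m.+1%:R^-1 < eps :> R.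
  move=> e0; exists (Num.truncn eps^-1) => m nm.
  rewrite invf_plt ?posrE//; apply: lt_le_trans (truncnS_gt _) _.
  by rewrite ler_nat ltnS.
have step eps m n : 0 < eps -> m.+1%:R^-1 < eps -> n.+1%:R^-1 < eps -> nrm (u m - u n) < eps.
  move=> e0 me ne; pose F' := (F m `|` F n)%fset.
  have -> : u m - u n = (\sum_(i <- F') c i - u n) - (\sum_(i <- F') c i - u m) by ring.
  apply: (nrmB_lt K_Cp); rewrite fset_sum_sub ?fsubsetUr ?fsubsetUl//.
    by apply: (nrm_sum_lt K_Cp) => // i _ /FP; move/lt_trans; apply.
  by apply: (nrm_sum_lt K_Cp) => // i _ /FP; move/lt_trans; apply.
have [eps e0|s] := Cp_complete K_Cp (u := u).
  have [n0 Hn] := small _ e0; exists n0 => m n nm nn.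
  by apply: step => //; exact: Hn.
move=> /(nrm_cvg0P K_Cp) us; exists s; apply: has_fam_sum_crit => eps e0.
have [n1 H1] := us _ e0; have [n2 H2] := small _ e0.
exists (F (maxn n1 n2)); split; last by apply: H1; exact: leq_maxl.
by move=> i /FP /lt_trans; apply; apply: H2; exact: leq_maxr.
Qed.

Lemma has_fam_sum_vanishing (I : choiceType) (c : I -> K) s :
  has_fam_sum nrm c s -> vanishing c.
Proof.
move=> cs eps e0; have [F Fc] := has_fam_sum_tail cs e0.
apply: (sub_finite_set _ (finite_fset F)) => i /= ei.
by apply: contraTT ei => /Fc; rewrite ltNge.
Qed.

Lemma has_fam_sum_le (I : choiceType) (c : I -> K) s B :
  0 <= B -> has_fam_sum nrm c s -> (forall i, nrm (c i) <= B) -> nrm s <= B.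
Proof.
move=> B0 cs cB; apply/ler_addgt0Pr => e e0.
have := has_fam_sum_approx (F := fset0) (ltr_pwDr e0 B0) cs.
rewrite big_seq_fset0 add0r (nrmN K_Cp) => H; apply/ltW/H => i _.
by rewrite (le_lt_trans (cB i))// ltrDl.
Qed.

Lemma eq_has_fam_sum (I : choiceType) (c c' : I -> K) s :
  c =1 c' -> has_fam_sum nrm c s -> has_fam_sum nrm c' s.
Proof. by move=> /funext ->. Qed.

Lemma has_fam_sumZ (I : choiceType) (c : I -> K) s x :
  has_fam_sum nrm c s -> has_fam_sum nrm (fun i => x * c i) (x * s).
Proof.
move=> cs eps e0; have x1 : 0 < nrm x + 1 by rewrite ltr_wpDl.
have [F HF] := cs _ (divr_gt0 e0 x1); exists F => F' /HF H.
rewrite -mulr_sumr -mulrBr (nrmM K_Cp).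
have [x0|x0] := eqVneq (nrm x) 0; first by rewrite x0 mul0r.
rewrite (@lt_trans _ _ (nrm x * (eps / (nrm x + 1))))//.
  by rewrite ltr_pM2l// lt_neqAle eq_sym x0 n_ge0.
by rewrite mulrCA gtr_pMr// ltr_pdivrMr// mul1r ltrDl.
Qed.

Lemma has_fam_sumD (I : choiceType) (c c' : I -> K) s s' :
  has_fam_sum nrm c s -> has_fam_sum nrm c' s' ->
  has_fam_sum nrm (fun i => c i + c' i) (s + s').
Proof.
move=> cs cs' eps e0; have [F HF] := cs _ e0; have [F' HF'] := cs' _ e0.
exists (F `|` F')%fset => G; rewrite fsubUset => /andP[/HF FG /HF' FG'].
by rewrite big_split/= opprD addrACA (nrmD_lt K_Cp).
Qed.

Lemma has_fam_sum_reindex (I J : choiceType) (h : J -> I) (c : I -> K) s :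
  injective h -> (forall i, (forall j, h j != i) -> c i = 0) ->
  has_fam_sum nrm (c \o h) s -> has_fam_sum nrm c s.
Proof.
move=> h_inj c0 cs; apply: has_fam_sum_crit => eps e0.
have [F HF] := has_fam_sum_tail cs e0; exists [fset h j | j in F]%fset; split=> [i|].
  move=> iF; have [[j hj]|nj] := pselect (exists j, h j = i).
    rewrite -hj; apply: HF; apply: contraNN iF => jF.
    by apply/imfsetP; exists j.
  by rewrite c0 ?(nrm0 K_Cp)// => j; apply/eqP => hj; apply: nj; exists j.
rewrite big_imfset/=; last by move=> x y _ _; exact: h_inj.
exact: has_fam_sum_approx.
Qed.

Lemma has_fam_sum_bij (I J : choiceType) (h : J -> I) (g : I -> J) (c : I -> K) s :
  cancel h g -> cancel g h -> has_fam_sum nrm c s -> has_fam_sum nrm (c \o h) s.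
Proof.
move=> hK gK cs; apply: (has_fam_sum_reindex (h := g)); first exact: can_inj gK.
  by move=> j /(_ (h j)); rewrite hK eqxx.
by apply: eq_has_fam_sum cs => i /=; rewrite gK.
Qed.

Let sum_fset_iota (c : nat -> K) n :
  \sum_(i <- [fset i in iota 0 n]%fset) c i = \sum_(i < n) c i.
Proof.
rewrite -(big_mkord xpredT) /index_iota subn0; apply: perm_big.
apply: uniq_perm; rewrite ?fset_uniq ?iota_uniq// => i.
by rewrite !inE.
Qed.

Lemma has_fam_sum_series (c : nat -> K) s : has_fam_sum nrm c s -> has_series nrm c s.
Proof.
move=> cs; apply/(has_seriesP K_Cp) => eps e0; have [F HF] := has_fam_sum_tail cs e0.
exists (\max_(i <- F) i)%N.+1 => n Fn; rewrite -sum_fset_iota.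
apply: has_fam_sum_approx => // i iN; apply: HF; apply: contraNN iN => iF.
rewrite !inE mem_iota/= add0n (leq_trans _ Fn)// ltnS.
exact: (leq_bigmax_seq (F := id)).
Qed.

Lemma has_fam_sum_fin (c : nat -> K) n : (forall i, (n <= i)%N -> c i = 0) ->
  has_fam_sum nrm c (\sum_(i < n) c i).
Proof.
move=> c0; apply: has_fam_sum_crit => eps e0.
exists [fset i in iota 0 n]%fset; split=> [i|]; last by rewrite sum_fset_iota subrr (nrm0 K_Cp).
by rewrite !inE mem_iota/= add0n -leqNgt => /c0 ->; rewrite (nrm0 K_Cp).
Qed.

(** Outside a finite set E all terms are small, so each row sum is close to the sum over its section
    of E; these errors do not accumulate, however many rows are added. *)
Lemma has_fam_sum_Fubini (I J : choiceType) (c : I * J -> K) s (row : I -> K) :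
  has_fam_sum nrm c s -> (forall i, has_fam_sum nrm (fun j => c (i, j)) (row i)) ->
  has_fam_sum nrm row s.
Proof.
move=> cs crow eps e0; have [E HE] := has_fam_sum_tail cs e0.
pose E1 := [fset ij.1 | ij in E]%fset; pose E2 := [fset ij.2 | ij in E]%fset.
pose Er i := [fset j in E2 | (i, j) \in E]%fset.
exists E1 => G EG.
have sumE : \sum_(i <- G) \sum_(j <- Er i) c (i, j) = \sum_(ij <- E) c ij.
  rewrite -(big_allpairs_dep (h := pair)); apply: perm_big; apply: uniq_perm.
  - apply: allpairs_uniq_dep => //.
    by move=> [x1 x2] [y1 y2] _ _ [-> ->].
  - exact: fset_uniq.
  - move=> [i j]; apply/allpairsPdep/idP => [[i' [j' [_ + [-> ->]]]]|ijE].
      by rewrite !inE => /andP[].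
    exists i, j; split=> //; last rewrite !inE ijE andbT.
      by apply: (fsubsetP EG); apply/imfsetP; exists (i, j).
    by apply/imfsetP; exists (i, j).
rewrite -(subrK (\sum_(ij <- E) c ij) (\sum_(i <- G) row i)) -addrA.
apply: (nrmD_lt K_Cp); last exact: has_fam_sum_approx.
rewrite -sumE -sumrB; apply: (nrm_sum_lt K_Cp) => // i _ _.
rewrite (nrm_subC K_Cp); apply: has_fam_sum_approx => // j; rewrite !inE => jE.
apply: HE; apply: contraNN jE => ijE; rewrite ijE andbT.
by apply/imfsetP; exists (i, j).
Qed.

End Families.

(** * Decay criteria and products of summable families *)

Section FamilyProduct.
Variables (R : realType) (p : nat) (K : fieldType) (nrm : K -> R).
Hypotheses (K_Cp : is_Cp p nrm).

Let n_ge0 := nrm_ge0 K_Cp.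

Lemma geometric_small (rho D eps : R) : 0 <= rho -> rho < 1 -> 0 < eps ->
  exists n, forall m, (n <= m)%N -> D * rho ^+ m < eps.
Proof.
move=> r0 r1 e0; have rn : `|rho| < 1 by rewrite ger0_norm.
have /cvgr0Pnorm_lt/(_ _ e0)[n _ Hn] := cvg_geometric D rn.
by exists n => m /Hn; exact: le_lt_trans (ler_norm _).
Qed.

Lemma vanishing_decay (I : Type) (c : I -> K) (size : I -> nat) (D rho : R) :
  0 <= rho -> rho < 1 -> (forall n, finite_set [set i | (size i <= n)%N]) ->
  (forall i, nrm (c i) <= D * rho ^+ size i) -> vanishing nrm c.
Proof.
move=> r0 r1 fin cD eps e0; have [n Hn] := geometric_small D r0 r1 e0.
apply: (sub_finite_set _ (fin n)) => i /= ei; rewrite leqNgt; apply/negP => /ltnW/Hn.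
by rewrite ltNge (le_trans ei).
Qed.

Lemma vanishing_comp (I J : Type) (h : J -> I) (c : I -> K) : injective h ->
  vanishing nrm c -> vanishing nrm (c \o h).
Proof.
move=> h_inj cv eps /cv fin; apply: (finite_preimage (f := h)) fin.
by move=> x y _ _; exact: h_inj.
Qed.

Lemma has_fam_sum_bounded (I : choiceType) (c : I -> K) s : has_fam_sum nrm c s ->
  exists B, forall i, nrm (c i) <= B.
Proof.
move=> /(has_fam_sum_tail K_Cp)/(_ 1 ltr01)[F HF].
exists (1 + \sum_(i <- F) nrm (c i)) => i; case: (boolP (i \in F)) => iF.
  rewrite (big_fsetD1 i)//= addrCA lerDl addr_ge0// sumr_ge0// => j _; exact: n_ge0.
rewrite (le_trans (ltW (HF _ iF)))// lerDl sumr_ge0// => j _; exact: n_ge0.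
Qed.

Lemma nrm_prod_le (I : Type) (r : seq I) (f : I -> K) (B : R) :
  0 <= B -> (forall j, nrm (f j) <= B) -> nrm (\prod_(j <- r) f j) <= B ^+ size r.
Proof.
move=> B0 fB; elim: r => [|j r IH]; first by rewrite big_nil (nrm1 K_Cp).
by rewrite big_cons (nrmM K_Cp) exprS ler_pM.
Qed.

Lemma nrm_prod_sub (I : Type) (r : seq I) (f g : I -> K) (B e : R) :
  0 <= e -> 1 <= B -> (forall j, nrm (f j) <= B) -> (forall j, nrm (g j) <= B) ->
  (forall j, nrm (f j - g j) <= e) ->
  nrm (\prod_(j <- r) f j - \prod_(j <- r) g j) <= e * B ^+ size r.
Proof.
move=> e0 B1 fB gB fg; have B0 : 0 <= B by rewrite (le_trans ler01).
elim: r => [|j r IH]; first by rewrite !big_nil subrr (nrm0 K_Cp) mulr1.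
rewrite !big_cons; set P := \prod_(i <- r) f i; set Q := \prod_(i <- r) g i.
have -> : f j * P - g j * Q = f j * (P - Q) + (f j - g j) * Q by ring.
apply: (nrmD_le K_Cp); rewrite (nrmM K_Cp).
  by rewrite exprS mulrCA ler_pM.
rewrite (@le_trans _ _ (e * B ^+ size r))//; first by rewrite ler_pM// nrm_prod_le.
by rewrite ler_wpM2l//= exprS ler_peMl// exprn_ge0.
Qed.

(** Use the box F^N with F finite. Off the box one factor is small and the others are at most B;
    over the box the sum is the product of the partial sums, compared with the product of the sums
    by telescoping. *)
Lemma has_fam_sum_prod (I : choiceType) (N : nat) (f : 'I_N -> I -> K) (s : 'I_N -> K) :
  (forall j, has_fam_sum nrm (f j) (s j)) ->
  has_fam_sum nrm (fun l : 'rV[I]_N => \prod_j f j (l 0 j)) (\prod_j s j).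
Proof.
move=> fs.
have [B [B1 fB sB]] : exists B, [/\ 1 <= B, forall j i, nrm (f j i) <= B & forall j, nrm (s j) <= B].
  have [b bP] : exists b : 'I_N -> R, forall j i, nrm (f j i) <= b j.
    exists (fun j => projT1 (cid (has_fam_sum_bounded (fs j)))) => j.
    exact: (projT2 (cid (has_fam_sum_bounded (fs j)))).
  pose B := 1 + \sum_j `|b j|; have bB j : `|b j| <= B.
    rewrite /B (bigD1 j)//= addrCA lerDl addr_ge0// sumr_ge0// => i _; exact: normr_ge0.
  have B1 : 1 <= B by rewrite lerDl sumr_ge0.
  have fB j i : nrm (f j i) <= B.
    by rewrite (le_trans (bP j i))// (le_trans (ler_norm _)).
  exists B; split=> // j; apply: (has_fam_sum_le K_Cp _ (fs j)) => //.
  by rewrite (le_trans _ B1).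
have B0 : 0 <= B by rewrite (le_trans ler01).
apply: (has_fam_sum_crit K_Cp) => eps e0.
have BN0 : 0 < B ^+ N by rewrite exprn_gt0// (lt_le_trans ltr01).
pose e := eps / B ^+ N / 2; have e'0 : 0 < e by rewrite !divr_gt0.
have eB : e * B ^+ N < eps.
  by rewrite /e mulrAC mulfVK ?gt_eqF// ltr_pdivrMr// ltr_pMr// ltr1n.
pose Fj j := projT1 (cid (has_fam_sum_tail K_Cp (fs j) e'0)).
have FjP j i : i \notin Fj j -> nrm (f j i) < e.
  exact: (projT2 (cid (has_fam_sum_tail K_Cp (fs j) e'0))).
pose F := \big[@fsetU I/fset0]_(j < N) Fj j.
have FP j i : i \notin F -> nrm (f j i) < e.
  move=> iF; apply: FjP; apply: contraNN iF => iF; apply/bigfcupP.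
  by exists j => //; rewrite mem_index_enum.
pose row_of (x : {ffun 'I_N -> F}) : 'rV[I]_N := \row_j val (x j).
have row_inj : injective row_of.
  move=> x y /matrixP xy; apply/ffunP => j; apply: val_inj.
  by have := xy 0 j; rewrite !mxE.
exists [fset row_of x | x in {ffun 'I_N -> F}]%fset; split.
  move=> l lF; have [j lj] : exists j, l 0 j \notin F.
    apply: contrapT => H; move/negP: lF; apply.
    have H' j : l 0 j \in F by apply: contrapT => /negP nF; apply: H; exists j.
    apply/imfsetP; exists [ffun j => FSetSub (H' j)] => //.
    by apply/rowP => j; rewrite mxE ffunE.
  apply: le_lt_trans eB; rewrite (nrm_prod K_Cp) (bigD1 j)//= ler_pM//.
  - by rewrite prodr_ge0.
  - by rewrite ltW// FP.
  - apply: (@le_trans _ _ (\prod_(i < N | i != j) B)).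
      by apply: ler_prod => i _; rewrite n_ge0 fB.
    rewrite prodr_const; apply: ler_weXn2l => //.
    by rewrite (leq_trans (max_card _))// card_ord.
rewrite big_imfset/=; last by move=> x y _ _; exact: row_inj.
have -> : \sum_(x <- enum_finmem (mem {ffun 'I_N -> F})) \prod_j f j (row_of x 0 j) =
    \prod_j \sum_(i <- F) f j i.
  under [RHS]eq_bigr => j _ do rewrite big_seq_fsetE.
  rewrite bigA_distr_bigA/= big_enum/=; apply: eq_big => // x _.
  by apply: eq_bigr => j _; rewrite mxE.
apply: le_lt_trans eB.
have -> : B ^+ N = B ^+ size (index_enum 'I_N).
  by rewrite -[index_enum _]/(Finite.enum _) -enumT size_enum_ord.
have size_sum j : nrm (\sum_(i <- F) f j i) <= B.
  by apply: (nrm_sum_le K_Cp).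
apply: nrm_prod_sub => // [|j]; apply: ltW => //.
by apply: (has_fam_sum_approx K_Cp) => // i; exact: FP.
Qed.

End FamilyProduct.

(** * Growth of the brackets [z]_l *)

Section Brackets.
Variables (R : realType) (p : nat) (K : fieldType) (nrm : K -> R).
Hypotheses (p_prime : prime p) (K_Cp : is_Cp p nrm).

Let n_ge0 := nrm_ge0 K_Cp.
Let char0 := Cp_char0 p_prime K_Cp.

(** The proviso excludes the poles, where the convention 0^-1 = 0 breaks the recurrence; for l <= 0
    a vanishing factor is harmless. *)
Lemma brk_rec (z : K) (l : int) : ((0 < l) -> z + l%:~R != 0) ->
  (z + l%:~R) * brk z l = brk z (l - 1).
Proof.
case: l => [[|m]|m] zl.
- have -> : Posz 0 - 1 = Negz 0 by [].
  by rewrite /brk big_ord0 big_ord1 invr1 mulr1 addr0 subr0.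
- have -> : Posz m.+1 - 1 = Posz m by rewrite -addn1 PoszD addrK.
  by rewrite /brk big_ord_recr/= invfM mulrCA mulfV ?mulr1// zl.
- have -> : Negz m - 1 = Negz m.+1 by rewrite !NegzE; lia.
  by rewrite /brk [in RHS]big_ord_recr/= mulrC NegzE mulrNz.
Qed.

Lemma brk_opp (z : K) (l : nat) : brk z (- l%:Z) = (-1) ^+ l * poch (- z) l.
Proof.
case: l => [|l]; first by rewrite /brk /poch /= !big_ord0 invr1 mulr1.
rewrite -NegzE /brk /poch -[X in (-1) ^+ X](card_ord l.+1) -prodr_const -big_split/=.
by apply: eq_bigr => i _; rewrite mulN1r opprD opprK.
Qed.

Lemma prod_sub_nat_ffact (n m : nat) :
  \prod_(i < m) (n%:R - i%:R) = (n ^_ m)%:R :> K.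
Proof.
elim: m => [|m IH]; first by rewrite big_ord0.
rewrite big_ord_recr/= IH ffactnSr natrM; have [mn|nm] := leqP m n.
  by rewrite natrB.
by rewrite ffact_small// !mul0r.
Qed.

(** Integrality of the binomial coefficients of a p-adic integer: z is within |m!| of some natural
    number n, for which the product is m! times a binomial coefficient. *)
Lemma nrm_falling_le (z : K) m : padic_int p nrm z ->
  nrm (\prod_(i < m) (z - i%:R)) <= nrm m`!%:R.
Proof.
move=> Zz; have [n] := Zz (logn p m`!).
rewrite -(nrm_nat p_prime K_Cp (fact_gt0 m)) => zn.
rewrite -(subrK (\prod_(i < m) (n%:R - i%:R)) (\prod_(i < m) (z - i%:R))).
apply: (nrmD_le K_Cp); last first.
  by rewrite prod_sub_nat_ffact -bin_ffact natrM (nrmM K_Cp) ler_piMl// (nrm_nat_le1 K_Cp).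
have := @nrm_prod_sub R p K nrm K_Cp _ (index_enum 'I_m)
  (fun i => z - i%:R) (fun i => n%:R - i%:R) 1 (nrm m`!%:R).
rewrite expr1n mulr1; apply=> // j.
- by apply: (nrmB_le K_Cp); [exact: Zp_nrm_le1 Zz|exact: (nrm_nat_le1 K_Cp)].
- by apply: (nrmB_le K_Cp); exact: (nrm_nat_le1 K_Cp).
- by rewrite opprB addrA subrK.
Qed.

(* 1/((z+1)...(z+m+2)) is the difference of the two shorter products with one
   extreme factor dropped, divided by m+1. *)
Lemma nrm_rising_inv_le (z : K) (B : R) m :
  (forall i, (i <= m)%N -> z + i.+1%:R != 0 /\ (nrm (z + i.+1%:R))^-1 <= B) ->
  nrm (\prod_(i < m.+1) (z + i.+1%:R))^-1 <= B / nrm m`!%:R.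
Proof.
elim: m z => [|m IH] z zB.
  by rewrite big_ord1 fact0 (nrm1 K_Cp) divr1 (nrmV K_Cp); have [] := zB 0%N.
set P := \prod_(i < m.+1) (z + i.+1%:R); set Q := \prod_(i < m.+1) (z + 1 + i.+1%:R).
have shift i : z + 1 + i.+1%:R = z + i.+2%:R by rewrite -addrA nat1r.
have EP : \prod_(i < m.+2) (z + i.+1%:R) = P * (z + m.+2%:R) by rewrite big_ord_recr.
have EQ : \prod_(i < m.+2) (z + i.+1%:R) = (z + 1) * Q.
  by rewrite big_ord_recl/=; congr (_ * _); apply: eq_bigr => i _; rewrite shift.
have [z1 _] := zB 0%N isT; have [zm _] := zB m.+1 (leqnn _).
have X0 : \prod_(i < m.+2) (z + i.+1%:R) != 0.
  by apply/prodf_neq0 => i _; have [] := zB i (ltn_ord i).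
have -> : (\prod_(i < m.+2) (z + i.+1%:R))^-1 = (P^-1 - Q^-1) / m.+1%:R.
  have P0 : P != 0 by move: X0; rewrite EP mulf_eq0 negb_or => /andP[].
  have Q0 : Q != 0 by move: X0; rewrite EQ mulf_eq0 negb_or => /andP[].
  have -> : P^-1 = (z + m.+2%:R) / (P * (z + m.+2%:R)) by rewrite invfM mulrCA mulfV ?mulr1.
  have -> : Q^-1 = (z + 1) / ((z + 1) * Q) by rewrite invfM mulrA mulfV ?mul1r.
  rewrite -EQ -EP -mulrBl opprD addrACA subrr add0r mulrAC.
  have -> : m.+2%:R - 1 = m.+1%:R :> K by rewrite -[m.+2]addn1 natrD addrK.
  by rewrite mulfV ?mul1r// char0.
have m1 : 0 < nrm m.+1%:R by rewrite (nrm_gt0 K_Cp) char0.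
rewrite factS natrM (nrmM K_Cp) [nrm (_ * _)](nrmM K_Cp) (nrmV K_Cp) invfM mulrCA mulrC.
rewrite ler_wpM2l ?invr_ge0//; apply: (nrmB_le K_Cp).
  by apply: IH => i im; apply: zB; rewrite ltnW.
by apply: IH => i im; rewrite shift; apply: (zB i.+1).
Qed.

Section Growth.
Variable pi0 : K.
Hypothesis pi0_pow : nrm pi0 ^+ p.-1 = p%:R^-1.

(* The coefficients of the formal solution of t F' = pi0 t F with exponents in
   z + Z. The dummy value brk (-1) l = 0 for l > 0 makes it one-sided for
   z = -1, and brk 0 l = 0 for l < 0 for z = 0. *)
Definition nbrk (z : K) (l : int) : K := pi0 ^ l * brk z l.

Let pi0_gt0 := nrm_pi0_gt0 p_prime K_Cp pi0_pow.
Let pi0_lt1 := nrm_pi0_lt1 p_prime pi0_pow.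
Let pi0_neq0 : pi0 != 0 := pi0_neq0 p_prime K_Cp pi0_pow.

Lemma nbrk_rec (z : K) (l : int) : ((0 < l) -> z + l%:~R != 0) ->
  (z + l%:~R) * nbrk z l = pi0 * nbrk z (l - 1).
Proof.
move=> zl; rewrite /nbrk mulrCA brk_rec// mulrA; congr (_ * _).
by rewrite -{2}(expr1z pi0) -expfzDr// addrC subrK.
Qed.

(** A rational z cannot come too close to -i: z + i is a nonzero integer of size at most a + b i
    divided by b, so 1/|z + i| is at most linear in i. The factorials left over on either side are
    absorbed by the power of pi0. *)
Lemma nbrk_linear_growth (v : rat) : -1 <= v <= 0 -> ~~ (p %| absz (denq v))%N ->
  exists2 D : R, 0 <= D & forall l, nrm (nbrk (ratr v) l) <= D * (absz l).+1%:R.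
Proof.
move=> /andP[v1 v0] pv; set a := absz (numq v); set b := absz (denq v).
have Zz := Zp_ratr p_prime K_Cp pv.
have bE : (denq v)%:~R = b%:R :> K.
  by rewrite -[RHS]/((Posz b)%:~R) /b gez0_abs// ltW// denq_gt0.
have d0 : (denq v)%:~R != 0 :> K by rewrite (Cp_intr_eq0 p_prime K_Cp) denq_neq0.
(* The summand p comes from [nrm_fact_le] for l < 0, a + b from the denominators for l > 0, and 1
   makes the constant at least 1, as l = 0 requires. *)
exists (p%:R + 1 + (a + b)%:R); first by rewrite !addr_ge0.
have D1 : 1 <= p%:R + 1 + (a + b)%:R :> R by rewrite addrAC lerDr addr_ge0.
case=> [[|m]|m].
- by rewrite /nbrk/brk/= expr0z big_ord0 invr1 mulr1 (nrm1 K_Cp) mulr1.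
- have [vN1|vN1] := eqVneq v (-1).
    rewrite /nbrk/brk big_ord_recl vN1 (Cp_ratrN p_prime K_Cp).
    have -> : ratr 1 = 1 :> K by rewrite (ratr_nat _ 1).
    by rewrite addNr mul0r invr0 mulr0 (nrm0 K_Cp) mulr_ge0// (le_trans ler01).
  have znz i : ratr v + i.+1%:R != 0 :> K.
    rewrite -(ratr_nat _ i.+1) -(Cp_ratrD p_prime K_Cp) (Cp_ratr_eq0 p_prime K_Cp).
    have : -1 < v by rewrite lt_neqAle eq_sym vN1.
    have : 1 <= i.+1%:R :> rat by rewrite ler1n.
    by move=> ? ?; apply/eqP; lra.
  have zB i : (i <= m)%N -> (nrm (ratr v + i.+1%:R))^-1 <= (a + b)%:R * m.+2%:R.
    move=> im; have E : ratr v + i.+1%:R = (numq v + denq v * i.+1%:Z)%:~R / (denq v)%:~R :> K.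
      by rewrite ratr_num_den intrD intrM mulrDl; congr (_ + _); rewrite mulrAC mulfV ?mul1r.
    have nz : numq v + denq v * i.+1%:Z != 0.
      by apply/eqP => nz; have := znz i; rewrite E nz mul0r eqxx.
    rewrite E (nrmM K_Cp) (nrmV K_Cp) invfM invrK.
    rewrite (@le_trans _ _ (absz (numq v + denq v * i.+1%:Z))%:R)//.
      rewrite -[leRHS]mulr1 ler_pM ?invr_ge0//; last exact: (nrm_int_le1 K_Cp).
      exact: (nrm_intV_le p_prime K_Cp).
    rewrite -natrM ler_nat mulnDl.
    have -> : denq v = Posz b by rewrite /b gez0_abs// ltW// denq_gt0.
    have : (absz (numq v + Posz b * i.+1%:Z)%R <= a + b * i.+1)%N by rewrite /a; lia.
    by move/leq_trans; apply; nia.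
  have znz' i : (i <= m)%N -> ratr v + i.+1%:R != 0 :> K /\
      (nrm (ratr v + i.+1%:R))^-1 <= (a + b)%:R * m.+2%:R by move=> im; split; [exact: znz|exact: zB].
  rewrite /nbrk (nrmM K_Cp) -exprnP (nrmX K_Cp).
  rewrite (@le_trans _ _ (nrm pi0 ^+ m.+1 * ((a + b)%:R * m.+2%:R / nrm m`!%:R)))//.
    by rewrite ler_wpM2l ?exprn_ge0// nrm_rising_inv_le.
  have f0 : 0 < nrm m`!%:R by rewrite (nrm_gt0 K_Cp) (Cp_fact_neq0 p_prime K_Cp).
  rewrite mulrCA -[leRHS]mulr1 ler_pM ?mulr_ge0 ?exprn_ge0 ?invr_ge0//.
    by rewrite ler_wpM2r// lerDr addr_ge0.
  rewrite ler_pdivrMr// mul1r exprS.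
  apply: le_trans (nrm_fact_ge p_prime K_Cp pi0_pow m).
  by rewrite ler_piMl ?exprn_ge0// ltW.
- rewrite /nbrk (nrmM K_Cp) /brk NegzE -exprnN (nrmV K_Cp) (nrmX K_Cp).
  rewrite mulrC ler_pdivrMr ?exprn_gt0//.
  apply: le_trans (nrm_falling_le _ Zz) _.
  apply: le_trans (nrm_fact_le p_prime K_Cp pi0_pow _) _.
  rewrite ler_wpM2r ?exprn_ge0// abszN ler_wpM2r//.
  by rewrite -addrA lerDl addr_ge0.
Qed.

Lemma linear_le_geometric (k : R) : 1 < k ->
  exists2 D : R, 0 <= D & forall m, m.+1%:R <= D * k ^+ m.
Proof.
move=> k1; have x0 : 0 < k - 1 by rewrite subr_gt0.
exists (1 + (k - 1)^-1); first by rewrite addr_ge0// invr_ge0 ltW.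
elim=> [|m IH]; first by rewrite mulr1 lerDl invr_ge0 ltW.
rewrite -natr1 exprSr mulrA -[X in _ * X](subrK 1 k) mulrDr mulr1 addrC lerD//.
have km : 1 <= k ^+ m by rewrite exprn_ege1// ltW.
rewrite mulrAC mulrDl mul1r mulVf ?gt_eqF// mulr_ege1//.
by rewrite lerDr ltW.
Qed.

Lemma nbrk_growth (v : rat) (k : R) : -1 <= v <= 0 -> ~~ (p %| absz (denq v))%N ->
  1 < k -> exists2 D : R, 0 <= D & forall l, nrm (nbrk (ratr v) l) <= D * k ^+ absz l.
Proof.
move=> v01 pv k1; have [D D0 HD] := nbrk_linear_growth v01 pv.
have [D' D'0 HD'] := linear_le_geometric k1.
exists (D * D'); first by rewrite mulr_ge0.
by move=> l; rewrite (le_trans (HD l))// -mulrA ler_wpM2l.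
Qed.

End Growth.
End Brackets.

(** * The Frobenius relation in one variable *)

Section IntegerCoefficients.
Variables (R : realType) (p : nat) (K : fieldType) (nrm : K -> R).
Hypotheses (K_Cp : is_Cp p nrm).

Definition coefz (f : nat -> K) (l : int) : K := if l is Posz n then f n else 0.

Lemma coefz_lt0 f l : l < 0 -> coefz f l = 0.
Proof. by case: l. Qed.

Lemma coefz_le f r l : 0 <= r -> gauss_le nrm 1 r f -> nrm (coefz f l) <= r ^+ absz l.
Proof.
case: l => n r0 fr /=; first by rewrite -[leRHS]mul1r; exact: fr.
by rewrite (nrm0 K_Cp) exprn_ge0.
Qed.

Lemma coefz_monomial (c : K) (k : nat) (f : fps K) n :
  (((fun i => c * (i == k)%:R) : fps K) * f) n = c * coefz f (n%:Z - k%:Z).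
Proof.
rewrite fps_mulE; have [kn|nk] := leqP k n.
  rewrite (bigD1 (Ordinal (kn : (k < n.+1)%N)))//= eqxx mulr1 big1 ?addr0 ?subzn//.
  by move=> i; rewrite -val_eqE/= => /negPf ->; rewrite mulr0 mul0r.
rewrite coefz_lt0 ?subr_lt0// mulr0 big1// => i _.
by rewrite ltn_eqF ?mulr0 ?mul0r// (leq_ltn_trans _ nk)// -ltnS.
Qed.

Lemma coefz_conv (f g : fps K) (n : int) :
  has_fam_sum nrm (fun i : nat => coefz f (n - i%:Z) * g i) (coefz (f * g) n).
Proof.
case: n => [a|a].
  have -> : coefz (f * g) (Posz a) = \sum_(i < a.+1) coefz f (Posz a - Posz i) * g i.
    rewrite mulrC /= fps_mulE; apply: eq_bigr => i _.
    by rewrite mulrC subzn// -ltnS.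
  apply: (has_fam_sum_fin K_Cp) => i ai.
  by rewrite coefz_lt0 ?mul0r// subr_lt0.
have -> : coefz (f * g) (Negz a) = \sum_(i < 0) coefz f (Negz a - i%:Z) * g i by rewrite big_ord0.
by apply: (has_fam_sum_fin K_Cp) => i _; rewrite coefz_lt0 ?mul0r//; lia.
Qed.

Lemma coefz_conv_subst (f g : fps K) m (n : int) : (0 < m)%N ->
  has_fam_sum nrm (fun i : nat => coefz f (n - (m * i)%N%:Z) * g i)
    (coefz (f * (ps_subst g m : fps K)) n).
Proof.
move=> m0; have m_inj : injective (muln m).
  by move=> x y /eqP; rewrite eqn_pmul2l// => /eqP.
have full := coefz_conv f (ps_subst g m) n.
have [t part] : exists t, has_fam_sum nrm (fun i : nat => coefz f (n - (m * i)%N%:Z) * g i) t.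
  apply: (vanishing_has_sum K_Cp).
  have := vanishing_comp m_inj (has_fam_sum_vanishing K_Cp full).
  congr vanishing; apply/funext => i /=.
  by rewrite /ps_subst dvdn_mulr// mulKn.
suff <- : t = coefz (f * (ps_subst g m : fps K)) n by [].
apply: (has_fam_sum_uniq K_Cp) full; apply: (has_fam_sum_reindex K_Cp m_inj).
  move=> j mj; rewrite /ps_subst; case: ifP => [/dvdnP[q jE]|_]; last by rewrite mulr0.
  by have := mj q; rewrite jE mulnC eqxx.
apply: eq_has_fam_sum part => i /=.
by rewrite /ps_subst dvdn_mulr// mulKn.
Qed.

Lemma finite_absz n : finite_set [set s : int | (absz s <= n)%N].
Proof.
apply: (@sub_finite_set _ _ ((Posz @` `I_n.+1) `|` (Negz @` `I_n.+1))).
  by case=> m /= mn; [left; exists m|right; exists m] => //=; rewrite ltnS// ltnW.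
by rewrite finite_setU; split; apply: finite_image; exact: finite_II.
Qed.

End IntegerCoefficients.

Section OneVariable.
Variables (R : realType) (p : nat) (K : fieldType) (nrm : K -> R).
Hypotheses (p_prime : prime p) (K_Cp : is_Cp p nrm).
Variable pi0 : K.
Hypothesis pi0_pow : nrm pi0 ^+ p.-1 = p%:R^-1.
Hypothesis pi0_root : has_series nrm (fun i => pi0 ^+ (p ^ i) / (p ^ i)%:R) 0.

Let p_gt0 : (0 < p)%N := prime_gt0 p_prime.
Let p_gt1 : (1 < p)%N := prime_gt1 p_prime.
Let char0 := Cp_char0 p_prime K_Cp.
Let n_ge0 := nrm_ge0 K_Cp.
Let pi0_gt0 := nrm_pi0_gt0 p_prime K_Cp pi0_pow.
Let pi0_lt1 := nrm_pi0_lt1 p_prime pi0_pow.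
Let pi0_neq0 : pi0 != 0 := pi0_neq0 p_prime K_Cp pi0_pow.
Let theta : fps K := theta p pi0.
Let tau : fps K := theta_hat1 p pi0.
Let sigma : fps K := sigma p pi0.
Let b := nbrk pi0.

Lemma radius_ex : exists r : R, [/\ 0 < r, r < 1, nrm pi0 <= r & p%:R^-1 <= r ^+ (p * p)].
Proof.
have pR : 0 < p%:R :> R by rewrite ltr0n.
(* exp(y) is p^(-1/p^2), the least r with 1/p <= r^(p p). *)
pose y : R := - ln p%:R / (p * p)%:R; have pp : 0 < (p * p)%:R :> R by rewrite ltr0n muln_gt0 p_gt0.
have y0 : y < 0 by rewrite /y mulNr oppr_lt0 divr_gt0// ln_gt0// ltr1n.
exists (Num.max (expR y) (nrm pi0)); split.
- by rewrite lt_max expR_gt0.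
- by rewrite gt_max pi0_lt1 expR_lt1 y0.
- by rewrite le_max lexx orbT.
- apply: (@le_trans _ _ (expR y ^+ (p * p))); last first.
    by rewrite lerXn2r ?nnegrE ?le_max ?expR_ge0// lexx.
  rewrite -expRM_natr /y mulfVK ?gt_eqF// expRN lnK//.
Qed.

(** The factor pi0^l is the share of one coordinate in pi0^(w(u)). *)
Definition ghat (z : K) (l : int) : K := pi0 ^ l * g p nrm pi0 z l.

Lemma ghatE z l s : has_fam_sum nrm (fun i : nat => b z (l - i%:Z) * tau i) s ->
  ghat z l = s.
Proof.
move=> bs; have lz : pi0 ^ l != 0 by rewrite expfz_neq0.
rewrite /ghat; suff -> : g p nrm pi0 z l = (pi0 ^ l)^-1 * s by rewrite mulrA mulfV ?mul1r.
apply: (series_sumE K_Cp); apply: (has_fam_sum_series K_Cp).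
apply: eq_has_fam_sum (has_fam_sumZ K_Cp _ bs) => i.
rewrite /b /nbrk /theta_hat1_coef expfzDr// -exprnN /tau.
have i0 : i`!%:R != 0 :> K := Cp_fact_neq0 p_prime K_Cp i.
have p0 : pi0 ^+ i != 0 by rewrite expf_neq0.
by field; rewrite i0 p0 lz.
Qed.

Lemma sigma_ode (n : int) : n%:~R * coefz sigma n =
  pi0 * coefz sigma (n - 1) - p%:R * pi0 * coefz sigma (n - p%:Z).
Proof.
pose f : fps K := fun n => pi0 * (n == 1)%N%:R - pi0 * (n == p)%:R.
have f0 : f 0%N = 0 by rewrite /f /= (ltn_eqF p_gt0) !mulr0 subr0.
case: n => [[|m]|m]; last 1 first.
- by rewrite !coefz_lt0 ?mulr0 ?subr0//; lia.
- by rewrite mul0r !coefz_lt0 ?mulr0 ?subr0//; lia.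
rewrite -[LHS]/(fps_theta sigma m.+1) /sigma (fps_theta_exp char0 f0).
have -> : fps_theta f = (fun i => pi0 * (i == 1)%N%:R) - ((fun i => p%:R * pi0 * (i == p)%:R) : fps K) :> fps K.
  apply/funext => i; rewrite fps_addE fps_oppE /fps_theta /f mulrBr; congr (_ - _).
    by case: eqP => [->|]; rewrite ?mul1r// !mulr0.
  by case: eqP => [->|]; rewrite ?mulrA// !mulr0.
by rewrite mulrBl fps_addE fps_oppE !coefz_monomial.
Qed.

Section Relation.
Variables (v v' : rat) (k0 : nat).
Hypotheses (v_range : -1 <= v <= 0) (v'_range : -1 <= v' <= 0).
Hypotheses (v_pint : ~~ (p %| absz (denq v))%N).
Hypotheses (k0_lt : (k0 <= p.-1)%N) (v'_v : p%:R * v - v' = - k0%:R).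

Let z : K := ratr v.
Let z' : K := ratr v'.
Let top := v == -1.

Let ratrK := Cp_ratr_eq0 p_prime K_Cp.

Lemma zz'E : p%:R * z + k0%:R = z'.
Proof.
rewrite /z'; have -> : v' = p%:R * v + k0%:R by move: v'_v; lra.
by rewrite /z (Cp_ratrD p_prime K_Cp) (Cp_ratrM p_prime K_Cp) !ratr_nat.
Qed.

Lemma ratr_addz (x : rat) (l : int) : ((ratr x : K) + l%:~R == 0) = (x + l%:~R == 0).
Proof. by rewrite -(ratr_int K l) -(Cp_ratrD p_prime K_Cp) ratrK. Qed.

Lemma vN1_v' : v = -1 -> v' = -1 /\ k0 = p.-1.
Proof.
move=> vE; have k0p : k0%:R <= p.-1%:R :> rat by rewrite ler_nat.
have pE : p%:R = p.-1%:R + 1 :> rat by rewrite natr1 prednK.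
have v'E : v' = -1 by move: v'_v v'_range k0p; rewrite vE pE => ? /andP[? ?] ?; lra.
split=> //; apply/eqP; rewrite -(eqr_nat rat); apply/eqP.
by move: v'_v; rewrite vE v'E pE; lra.
Qed.

(** Otherwise v = -k/p would have norm p, against p-integrality. *)
Let v_not_frac k : (0 < k < p)%N -> p%:R * v != - k%:R.
Proof.
move=> /andP[kpos kp]; apply/eqP => vp.
have := Zp_nrm_le1 K_Cp (Zp_ratr p_prime K_Cp v_pint).
have : nrm (p%:R * z) = nrm k%:R.
  rewrite /z -(ratr_nat K p) -(Cp_ratrM p_prime K_Cp) vp (Cp_ratrN p_prime K_Cp).
  by rewrite (nrmN K_Cp) ratr_nat.
rewrite mulrC (nrmM K_Cp) (Cp_norm_p K_Cp) (nrm_coprime p_prime K_Cp) => [E|].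
  rewrite leNgt => /negP; apply.
  have pR : 0 < p%:R :> R by rewrite ltr0n.
  have -> : nrm z = p%:R by rewrite -[LHS](@mulfVK _ p%:R) ?gt_eqF// E mul1r.
  by rewrite ltr1n.
rewrite prime_coprime//; apply/negP => /(dvdn_leq kpos).
by rewrite leqNgt kp.
Qed.

Lemma v'0_v : v' = 0 -> v = 0 /\ k0 = 0%N.
Proof.
move=> v'0; move: v'_v; rewrite v'0 subr0 => pv; have [k00|kpos] := posnP k0.
  split=> //; move/eqP: pv; rewrite k00 oppr0.
  by rewrite mulf_eq0 pnatr_eq0 gtn_eqF//= => /eqP.
by have := @v_not_frac k0; rewrite kpos -(prednK p_gt0) ltnS k0_lt prednK// pv eqxx => /(_ isT).
Qed.

Lemma v'N1_v : v' = -1 -> v = -1.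
Proof.
move=> v'N; have pv : p%:R * v = - (k0.+1)%:R by move: v'_v; rewrite v'N -natr1; lra.
have [k0p|k0p] := eqVneq k0 p.-1; last first.
  have := @v_not_frac k0.+1; rewrite pv eqxx ltnS -(ltn_predRL) ltn_neqAle k0p k0_lt.
  by move=> /(_ isT).
have p0 : p%:R != 0 :> rat by rewrite pnatr_eq0 gtn_eqF.
by apply: (mulfI p0); rewrite pv k0p prednK// mulrN1.
Qed.

Let z_add_neq0 (l : int) : 0 < l -> ~~ top -> z + l%:~R != 0.
Proof.
move=> l0 ntop; rewrite ratr_addz; apply/eqP => vl; move: ntop; rewrite /top.
have : 1 <= l%:~R :> rat by rewrite ler1z.
by move: v_range => /andP[v1 _] l1 /eqP; apply; lra.
Qed.

(** If v' + l = 0, then v' is 0 or -1. The value 0 forces k0 = 0 and l = 0, excluded by -k0 < l; the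
    value -1 forces v = -1 and l = 1, excluded by the condition on [top]. *)
Let z'_add_neq0 (l : int) : - k0%:Z < l -> (top -> l <= 0) -> z' + l%:~R != 0.
Proof.
move=> l0 ltop; rewrite ratr_addz; apply/eqP => v'l.
have v'E : v' = (- l)%:~R by rewrite mulrNz; move/eqP: v'l; rewrite addr_eq0 => /eqP.
move: v'_range; rewrite v'E -[0]/(0%:~R) -[-1]/((- 1)%:~R) !ler_int => l1.
have [lE|lE] : l = 0 \/ l = 1 by clear -l1; lia.
  have [_ k00] : v = 0 /\ k0 = 0%N by apply: v'0_v; rewrite v'E lE.
  by move: l0; rewrite k00 lE.
have vN1 : v = -1 by apply: v'N1_v; rewrite v'E lE.
by have := ltop; rewrite /top vN1 lE => /(_ (eqxx _)).
Qed.

Let nbrk'_neq0 : brk z' (- k0%:Z) != 0.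
Proof.
case: k0 k0_lt z'_add_neq0 v'0_v => [|k] _ z'n v'0_v.
  have -> : - 0%:Z = Posz 0 by [].
  by rewrite /brk big_ord0 invr1 oner_eq0.
rewrite -NegzE /brk; apply/prodf_neq0 => -[i /= ik] _.
have [v'0|v'0] := eqVneq v' 0; first by case: (v'0_v v'0).
rewrite -(ratr_nat K i) -(Cp_ratrN p_prime K_Cp) -(Cp_ratrD p_prime K_Cp) ratrK.
have : v' < 0 by move: v'_range v'0; rewrite lt_neqAle => /andP[_ ->] ->.
by have := ler0n rat i; move=> ? ?; apply/eqP; lra.
Qed.

Variable r0 : R.
Hypotheses (r0_gt0 : 0 < r0) (r0_lt1 : r0 < 1).
Hypotheses (pi0_r0 : nrm pi0 <= r0) (p_r0 : p%:R^-1 <= r0 ^+ (p * p)).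

Let r0_ge0 := ltW r0_gt0.
Let r0_le1 := ltW r0_lt1.

Let theta_bd l : nrm (coefz theta l) <= r0 ^+ absz l.
Proof.
apply: (coefz_le K_Cp) => //; apply: gauss_le_weak pi0_r0 _ => //.
exact: theta_le.
Qed.

Let sigma_bd l : nrm (coefz sigma l) <= r0 ^+ absz l.
Proof. by apply: (coefz_le K_Cp) => //; exact: (sigma_le p_prime K_Cp). Qed.

Let tau_bd n : nrm (tau n) <= (r0 ^+ p) ^+ n.
Proof. by rewrite -[leRHS]mul1r; apply: (theta_hat1_le p_prime K_Cp). Qed.

(** The midpoint of 1 and 1/r0: growth at rate [kap] covers the brackets, and rho = kap r0 = (1 +
    r0)/2 remains below 1. *)
Let kap : R := (1 + r0^-1) / 2.
Let rho := kap * r0.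

Let kap_gt1 : 1 < kap.
Proof.
have : 1 < r0^-1 by rewrite invf_gt1.
by rewrite /kap => ?; lra.
Qed.

Let rho_lt1 : rho < 1.
Proof.
have -> : rho = (r0 + 1) / 2 by rewrite /rho /kap mulrAC mulrDl mul1r mulVf ?gt_eqF.
by move: r0_lt1; lra.
Qed.

Let rho_ge0 : 0 <= rho.
Proof. by rewrite mulr_ge0// ltW// (lt_trans ltr01). Qed.

(** The terms making up the coefficient of t^(pz+n) in F_z(t^p) f(t) theta_hat1(t^m). It is used for
    f = theta, m = p and for f = sigma, m = 1. *)
Let dbl (f : nat -> K) (m : nat) (n : int) (si : int * nat) : K :=
  b z si.1 * coefz f (n - p%:Z * si.1 - (m * si.2)%N%:Z) * tau si.2.

Let absz_le_shift (s n : int) (i : nat) :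
  (absz s <= absz (n - p%:Z * s - i%:Z)%R + absz n + i)%N.
Proof.
apply: (@leq_trans (absz (p%:Z * s)%R)); first by rewrite abszM leq_pmull.
by clear; move: (_ * s) => t; lia.
Qed.

(** The index s is bounded by |n - p s - m i| + |n| + m i, so the bracket costs kap^(m i) in the
    variable i; the rate r0^p of theta_hat1 compensates this because m <= p. *)
Let dbl_vanishing f m n : (forall l, nrm (coefz f l) <= r0 ^+ absz l) ->
  (m <= p)%N -> vanishing nrm (dbl f m n).
Proof.
move=> fb mp; have [D D0 HD] := nbrk_growth p_prime K_Cp pi0_pow v_range v_pint kap_gt1.
pose q (si : int * nat) := absz (n - p%:Z * si.1 - (m * si.2)%N%:Z)%R.
apply: (@vanishing_decay _ _ _ _ _ (fun si => q si + si.2)%N (D * kap ^+ absz n) rho) => // [N|[s i]].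
  apply: (@sub_finite_set _ _ ([set s : int | (absz s <= N + absz n + p * N)%N] `*` `I_N.+1)).
    move=> [s i] /= qN; rewrite /q /= in qN.
    have iN : (i <= N)%N := leq_trans (leq_addl _ _) qN.
    split=> //=; apply: leq_trans (absz_le_shift s n (m * i)) _.
    rewrite leq_add//; last by rewrite leq_mul.
    by rewrite leq_add2r (leq_trans (leq_addr _ _) qN).
  by apply: finite_setX; [exact: finite_absz|exact: finite_II].
rewrite /dbl /= (nrmM K_Cp (_ * _)) (nrmM K_Cp (b _ _)).
have k0' : 0 <= kap by rewrite ltW// (lt_trans ltr01).
have bs : nrm (b z s) <= D * (kap ^+ absz n * kap ^+ q (s, i) * (kap ^+ p) ^+ i).
  rewrite (le_trans (HD s))// ler_wpM2l// -exprM -!exprD ler_weXn2l ?ltW//.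
  rewrite (leq_trans (absz_le_shift s n (m * i)))// -/(q (s, i)) addnAC [X in (X <= _)%N]addnAC.
  by rewrite [(q _ + _)%N]addnC leq_add2l leq_mul.
apply: (@le_trans _ _ (D * (kap ^+ absz n * kap ^+ q (s, i) * (kap ^+ p) ^+ i) *
    r0 ^+ q (s, i) * (r0 ^+ p) ^+ i)).
  exact: (ler_pM (mulr_ge0 (n_ge0 _) (n_ge0 _)) (n_ge0 _)
    (ler_pM (n_ge0 _) (n_ge0 _) bs (fb _)) (tau_bd i)).
have -> : D * (kap ^+ absz n * kap ^+ q (s, i) * (kap ^+ p) ^+ i) * r0 ^+ q (s, i) * (r0 ^+ p) ^+ i
   = D * kap ^+ absz n * (rho ^+ q (s, i) * (rho ^+ p) ^+ i).
  by rewrite /rho !exprMn; ring.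
rewrite ler_wpM2l ?mulr_ge0 ?exprn_ge0// exprD ler_wpM2l ?exprn_ge0//.
rewrite -exprM; apply: ler_wiXn2l => //; first exact: ltW.
by rewrite leq_pmull.
Qed.

Let dbl_row f m n s : (0 < m)%N ->
  has_fam_sum nrm (fun i => dbl f m n (s, i))
    (b z s * coefz ((f : fps K) * (ps_subst tau m : fps K)) (n - p%:Z * s)).
Proof.
move=> m0; apply: eq_has_fam_sum (has_fam_sumZ K_Cp (b z s) (coefz_conv_subst K_Cp f tau (n - p%:Z * s) m0)) => i.
by rewrite mulrA.
Qed.

Let tau0 : tau 0%N = 1.
Proof. by rewrite /tau (theta_hat1_exp p_prime K_Cp) ps_exp0. Qed.

(* The coefficients of exp(pi0 t - pi0 t^p) F_z(t^p). *)
Let Cseq (n : int) : K := fam_sum nrm (fun s : int => coefz sigma (n - p%:Z * s) * b z s).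

Let Cseq_sum n : has_fam_sum nrm (fun s : int => coefz sigma (n - p%:Z * s) * b z s) (Cseq n).
Proof.
have [t ft] : exists t, has_fam_sum nrm (fun s : int => coefz sigma (n - p%:Z * s) * b z s) t.
  apply: (vanishing_has_sum K_Cp).
  have inj0 : injective (fun s : int => (s, 0%N)) by move=> x y [].
  have := vanishing_comp inj0 (dbl_vanishing n sigma_bd p_gt0).
  congr vanishing; apply/funext => s /=.
  by rewrite /dbl /= tau0 mulr1 muln0 subr0 mulrC.
by rewrite /Cseq (fam_sumE K_Cp ft).
Qed.

Let Cseq_rec (n : int) : (top -> n <= p.-1%:Z) ->
  (p%:R * z + n%:~R) * Cseq n = pi0 * Cseq (n - 1).
Proof.
move=> ntop; apply: (has_fam_sum_uniq K_Cp (has_fam_sumZ K_Cp _ (Cseq_sum n))).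
pose B (s : int) := coefz sigma (n - p%:Z - p%:Z * s) * b z s.
(* The sum containing -p pi0 sigma_(l-p) from the equation of sigma and the sum containing p pi0
   b(z,s-1) from the bracket recurrence agree after the shift of s, and cancel. *)
have shB : has_fam_sum nrm (fun s => B (s - 1)) (Cseq (n - p%:Z)).
  by apply: (has_fam_sum_bij K_Cp (g := fun s => s + 1) _ _ (Cseq_sum (n - p%:Z))) => s;
    rewrite ?subrK ?addrK.
have := has_fam_sumD K_Cp (has_fam_sumZ K_Cp pi0 (Cseq_sum (n - 1)))
  (has_fam_sumD K_Cp (has_fam_sumZ K_Cp (- (p%:R * pi0)) (Cseq_sum (n - p%:Z)))
    (has_fam_sumZ K_Cp (p%:R * pi0) shB)).
rewrite mulNr addNr addr0; apply: eq_has_fam_sum => s; rewrite /B.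
have -> : n - p%:Z - p%:Z * (s - 1) = n - p%:Z * s by ring.
have -> : n - p%:Z - p%:Z * s = n - p%:Z * s - p%:Z by ring.
have -> : n - 1 - p%:Z * s = n - p%:Z * s - 1 by ring.
set l := n - p%:Z * s; have ode := sigma_ode l.
have rec : coefz sigma l * ((z + s%:~R) * b z s) = coefz sigma l * (pi0 * b z (s - 1)).
  have [s_top|s_top] := boolP (top && (0 < s)); last first.
    by congr (_ * _); apply: (nbrk_rec p_prime K_Cp pi0_pow) => s0; apply: z_add_neq0 => //; move: s_top; rewrite s0 andbT.
  (* For z = -1 and s > 0 the bracket recurrence fails at s = 1, but n <= p - 1 < p s makes the
     sigma coefficient vanish. *)
  move: s_top => /andP[tt s0]; rewrite coefz_lt0 ?mul0r// /l.
  have := ntop tt; rewrite -{2}(prednK p_gt0); move: s0; clear; nia.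
have nE : n%:~R = l%:~R + p%:R * s%:~R :> K.
  by rewrite -[p%:R]/(p%:Z%:~R) -intrM -intrD; congr (_%:~R); rewrite /l; ring.
have -> : (p%:R * z + n%:~R) * (coefz sigma l * b z s) =
    l%:~R * coefz sigma l * b z s + p%:R * (coefz sigma l * ((z + s%:~R) * b z s)).
  by rewrite nE; ring.
by rewrite rec ode; ring.
Qed.

(** Only s = -l with l >= 0 contributes, and b(z,-l) = pi0^-l (-1)^l (-z)_l turns the sum into the
    defining series of H. *)
Let Cseq0 : Cseq 0 = H p nrm pi0 (- z).
Proof.
symmetry; apply: (series_sumE K_Cp); apply: (has_fam_sum_series K_Cp).
have opp_inj : injective (fun l : nat => - l%:Z) by move=> x y /oppr_inj[].
have [t ft] : exists t, has_fam_sum nrm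
    ((fun s : int => coefz sigma (0 - p%:Z * s) * b z s) \o (fun l : nat => - l%:Z)) t.
  by apply: (vanishing_has_sum K_Cp); apply: vanishing_comp => //; apply: (has_fam_sum_vanishing K_Cp (Cseq_sum 0)).
have <- : t = Cseq 0.
  apply: (has_fam_sum_uniq K_Cp) (Cseq_sum 0); apply: (has_fam_sum_reindex K_Cp opp_inj) ft.
  case=> l nl; last by have := nl l.+1; rewrite NegzE eqxx.
  case: l nl => [/(_ 0%N)//|l _]; rewrite coefz_lt0 ?mul0r// sub0r oppr_lt0 mulr_gt0//.
apply: eq_has_fam_sum ft => l /=.
rewrite sub0r mulrN opprK -PoszM /= /b /nbrk.
rewrite -exprnN brk_opp -/sigma.
by ring.
Qed.

Let cst : K := H p nrm pi0 (- z) / nbrk pi0 z' (- k0%:Z).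

(** Both sides agree at l = -k0, the exponent z' - k0 = pz. The recurrence propagates this upwards
    since z' + m is nonzero there, and downwards since pi0 is nonzero. *)
Let Cseq_nbrk (l : int) : (top -> l <= 0) -> Cseq (l + k0%:Z) = cst * nbrk pi0 z' l.
Proof.
pose Y l := Cseq (l + k0%:Z) - cst * nbrk pi0 z' l.
move=> ltop; apply/eqP; rewrite -subr_eq0 -/(Y l); apply/eqP.
have Y0 : Y (- k0%:Z) = 0.
  rewrite /Y addNr Cseq0 /cst divfK ?subrr// /nbrk mulf_neq0// expfz_neq0//.
have Yrec m : (top -> m <= 0) -> (z' + m%:~R) * Y m = pi0 * Y (m - 1).
  move=> mtop.
  have h1 : (z' + m%:~R) * Cseq (m + k0%:Z) = pi0 * Cseq (m - 1 + k0%:Z).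
    have -> : m - 1 + k0%:Z = m + k0%:Z - 1 by ring.
    have -> : z' + m%:~R = p%:R * z + (m + k0%:Z)%:~R.
      by rewrite -zz'E intrD -[k0%:Z%:~R]/(k0%:R); ring.
    by apply: Cseq_rec => /mtop m0; move: k0_lt; clear -m0; lia.
  have h2 : (z' + m%:~R) * nbrk pi0 z' m = pi0 * nbrk pi0 z' (m - 1).
    apply: (nbrk_rec p_prime K_Cp pi0_pow) => m0; apply: z'_add_neq0 => //.
    by apply: le_lt_trans m0; rewrite oppr_le0.
  by rewrite /Y mulrBr h1 mulrCA h2; ring.
have Yup (m : nat) : (top -> - k0%:Z + m%:Z <= 0) -> Y (- k0%:Z + m%:Z) = 0.
  elim: m => [|m IH] mtop; first by rewrite addr0.
  have := Yrec _ mtop; have -> : - k0%:Z + m.+1%:Z - 1 = - k0%:Z + m%:Z by clear; lia.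
  rewrite IH ?mulr0 => [/eqP|/mtop m0]; last by clear -m0; lia.
  rewrite mulf_eq0 => /orP[|/eqP//]; rewrite (negPf (z'_add_neq0 _ _))//.
  by rewrite ltrDl.
have Ydown (m : nat) : Y (- k0%:Z - m%:Z) = 0.
  elim: m => [|m IH]; first by rewrite subr0.
  have := Yrec (- k0%:Z - m%:Z); rewrite IH mulr0.
  have -> : - k0%:Z - m%:Z - 1 = - k0%:Z - m.+1%:Z by clear; lia.
  have le0 : - k0%:Z - m%:Z <= 0 by clear; lia.
  move=> /(_ (fun _ => le0))/esym/eqP; rewrite mulf_eq0 (negPf pi0_neq0) => /eqP//.
have [lk|lk] := leP (- k0%:Z) l.
  have lE : l = - k0%:Z + (absz (l + k0%:Z)%R)%:Z by clear -lk; lia.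
  by rewrite lE; apply: Yup; rewrite -lE.
have lE : l = - k0%:Z - (absz (l + k0%:Z)%R)%:Z by clear -lk; lia.
by rewrite lE; exact: Ydown.
Qed.

Lemma ghat_growth (k : R) : 1 < k -> k * r0 < 1 ->
  exists2 D : R, 0 <= D & forall l,
    has_fam_sum nrm (fun i : nat => b z (l - i%:Z) * tau i) (ghat z l) /\
    nrm (ghat z l) <= D * k ^+ absz l.
Proof.
move=> k1 kr; have [D D0 HD] := nbrk_growth p_prime K_Cp pi0_pow v_range v_pint k1.
have k0' : 0 <= k by rewrite ltW// (lt_trans ltr01).
have kr0 : 0 <= k * r0 by rewrite mulr_ge0.
exists D => // l.
have term i : nrm (b z (l - i%:Z) * tau i) <= D * k ^+ absz l * (k * r0) ^+ i.
  rewrite (nrmM K_Cp (b _ _)) exprMn -mulrA mulrA -[leRHS]mulrA.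
  rewrite (_ : D * (k ^+ absz l * (k ^+ i * r0 ^+ i)) = D * (k ^+ absz l * k ^+ i) * r0 ^+ i); last by ring.
  apply: ler_pM => //.
    rewrite (le_trans (HD _))// ler_wpM2l// -exprD ler_weXn2l ?ltW//.
    by clear; lia.
  apply: le_trans (tau_bd i) _; rewrite -exprM ler_wiXn2l//.
  by rewrite leq_pmull.
have [t ft] : exists t, has_fam_sum nrm (fun i : nat => b z (l - i%:Z) * tau i) t.
  apply: (vanishing_has_sum K_Cp).
  apply: (@vanishing_decay _ _ _ _ _ id (D * k ^+ absz l) (k * r0)) => // n.
  by apply: sub_finite_set (finite_II n.+1) => i /=.
rewrite (ghatE ft); split=> //.
apply: (has_fam_sum_le K_Cp _ ft) => [|i]; first by rewrite mulr_ge0 ?exprn_ge0.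
by rewrite (le_trans (term i))// ler_piMr ?mulr_ge0 ?exprn_ge0// exprn_ile1// ltW.
Qed.

(* The family b(z,s) tau_i summed over s + i = m gives ghat z m; multiplying by
   theta and using theta(t) tau(t^p) = sigma(t) tau(t) turns it into the family
   tau_i b(z,s) sigma, whose sums over s are the coefficients Cseq. *)
Lemma ghat_Frobenius (l : int) : (v = -1 -> l <= 0) ->
  has_fam_sum nrm (fun m : int => coefz theta (l + k0%:Z - p%:Z * m) * ghat z m)
    (pi0 ^+ k0 * (H p nrm pi0 (- z) / brk z' (- k0%:Z)) * ghat z' l).
Proof.
move=> ltop; set n := l + k0%:Z.
have [D D0 gsum] := ghat_growth kap_gt1 rho_lt1.
have [S sumS] := vanishing_has_sum K_Cp (dbl_vanishing n theta_bd (leqnn p)).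
have [S' sumS'] := vanishing_has_sum K_Cp (dbl_vanishing n sigma_bd p_gt0).
have rowS := has_fam_sum_Fubini K_Cp sumS (fun s => dbl_row theta n s p_gt0).
have rowS' := has_fam_sum_Fubini K_Cp sumS' (fun s => dbl_row sigma n s (ltn0Sn 0)).
have tau1 : ps_subst tau 1 = tau :> fps K.
  by apply/funext => i; rewrite /ps_subst dvd1n divn1.
have thetaE : theta * (ps_subst tau p : fps K) = sigma * (ps_subst tau 1 : fps K).
  by rewrite tau1; exact: (theta_theta_hat1 p_prime K_Cp).
have SS' : S = S'.
  by apply: (has_fam_sum_uniq K_Cp rowS); apply: eq_has_fam_sum rowS' => s; rewrite thetaE.
have sumC : has_fam_sum nrm (fun i => tau i * Cseq (n - i%:Z)) S'.
  apply: (has_fam_sum_Fubini K_Cp (c := fun si => dbl sigma 1 n (si.2, si.1))).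
    by apply: (has_fam_sum_bij K_Cp (g := fun si => (si.2, si.1)) _ _ sumS') => -[].
  move=> i; apply: eq_has_fam_sum (has_fam_sumZ K_Cp (tau i) (Cseq_sum (n - i%:Z))) => s.
  rewrite /dbl/= mul1n; have -> : n - i%:Z - p%:Z * s = n - p%:Z * s - i%:Z by ring.
  by ring.
have sumG : has_fam_sum nrm (fun m : int => coefz theta (n - p%:Z * m) * ghat z m) S.
  apply: (has_fam_sum_Fubini K_Cp (c := fun mi => dbl theta p n (mi.1 - mi.2%:Z, mi.2))).
    apply: (has_fam_sum_bij K_Cp (g := fun si => (si.1 + si.2%:Z, si.2)) _ _ sumS).
      by move=> [m i]; rewrite /= subrK.
    by move=> [m i]; rewrite /= addrK.
  move=> m; apply: eq_has_fam_sum (has_fam_sumZ K_Cp _ (gsum m).1) => i.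
  rewrite /dbl/=; have -> : n - p%:Z * (m - i%:Z) - (p * i)%N%:Z = n - p%:Z * m by rewrite PoszM; ring.
  by ring.
suff <- : S = pi0 ^+ k0 * (H p nrm pi0 (- z) / brk z' (- k0%:Z)) * ghat z' l by [].
have cstE : cst = pi0 ^+ k0 * (H p nrm pi0 (- z) / brk z' (- k0%:Z)).
  by rewrite /cst /nbrk invfM -exprnN invrK; ring.
rewrite -cstE SS'.
have sumC' : has_fam_sum nrm (fun i : nat => cst * (b z' (l - i%:Z) * tau i)) S'.
  apply: eq_has_fam_sum sumC => i; have -> : n - i%:Z = l - i%:Z + k0%:Z by rewrite /n; ring.
  rewrite Cseq_nbrk => [|/eqP/ltop l0]; last by clear -l0; lia.
  by rewrite /b; ring.
(* Summability of the family defining [ghat] at z' is read off from that of its multiple by [cst],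
   hence the division; for cst = 0 both sides are 0. *)
have [cst0|cst0] := eqVneq cst 0.
  rewrite cst0 mul0r in sumC' *.
  apply: (has_fam_sum_uniq K_Cp sumC').
  have := has_fam_sum_fin K_Cp (c := fun i => 0 * (b z' (l - i%:Z) * tau i)) (n := 0).
  by rewrite big_ord0; apply => i _; rewrite mul0r.
have := has_fam_sumZ K_Cp cst^-1 sumC' => sumC''.
rewrite (@ghatE z' l (cst^-1 * S')) ?mulrA ?mulfV ?mul1r//.
by apply: eq_has_fam_sum sumC'' => i; rewrite mulrA mulVf ?mul1r.
Qed.

End Relation.
End OneVariable.

(** * Relative interior of the cone *)

Section RelativeInterior.
Variables (R : realType) (N n : nat) (A : 'M[int]_(N, n)).

Let negC : set 'rV[R]_n := [set - y | y in cone A].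

Lemma neg_coneP (y : 'rV[R]_n) : negC y <->
  exists2 t : 'rV[R]_N, (forall j, t 0 j <= 0) & y = t *m map_mx intr A.
Proof.
split=> [[_ [t t0 ->] <-]|[t t0 ->]].
  by exists (- t); rewrite ?mulNmx// => j; rewrite mxE oppr_le0.
exists ((- t) *m map_mx intr A); last by rewrite mulNmx opprK.
by exists (- t) => // j; rewrite mxE oppr_ge0.
Qed.

Lemma neg_cone_comb (a : R) (x y : 'rV[R]_n) : 0 <= a -> negC x -> negC y ->
  negC (a *: x + y).
Proof.
move=> a0 /neg_coneP[s s0 ->] /neg_coneP[t t0 ->]; apply/neg_coneP.
exists (a *: s + t); last by rewrite mulmxDl scalemxAl.
by move=> j; rewrite !mxE -[leRHS]addr0 lerD// mulr_ge0_le0.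
Qed.

Lemma neg_cone0 : negC 0.
Proof. by apply/neg_coneP; exists 0; rewrite ?mul0mx// => j; rewrite mxE. Qed.

(** The hull contains 0, so it is a linear subspace: the missing weight 1 - a - b is placed on the
    point 0. *)
Lemma affine_hull_comb (S : set 'rV[R]_n) (a b : R) (z c : 'rV[R]_n) :
  S 0 -> S c -> affine_hull S z -> affine_hull S (a *: z + b *: c).
Proof.
move=> S0 Sc [m [s [t [sS t1 ->]]]].
exists m.+2, (fun i => if unlift ord0 i is Some j then
    (if unlift ord0 j is Some k then s k else c) else 0),
  (fun i => if unlift ord0 i is Some j then
    (if unlift ord0 j is Some k then a * t k else b) else 1 - a - b); split.
- by move=> i; case: unliftP => // j _; case: unliftP.
- rewrite !big_ord_recl unlift_none liftK unlift_none.
  under eq_bigr => i _ do rewrite !liftK.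
  by rewrite -mulr_sumr t1; ring.
- rewrite !big_ord_recl unlift_none liftK unlift_none scaler0 add0r addrC.
  congr (_ + _); rewrite scaler_sumr; apply: eq_bigr => i _.
  by rewrite !liftK scalerA.
Qed.

(** The map z -> (z - c)/a carries the ball of radius a e around a y + c to the ball of radius e
    around y and preserves the affine hull. *)
Lemma relint_neg_cone_comb (a : R) (y c : 'rV[R]_n) : 0 < a ->
  relint negC y -> negC c -> relint negC (a *: y + c).
Proof.
move=> a0 [Sy nearS] Sc; split; first by apply: neg_cone_comb => //; exact: ltW.
have [e /= e0 ye] := (nbhs_ballP _ _).1 nearS.
apply/nbhs_ballP; exists (a * e) => /=; first exact: mulr_gt0.
move=> z yz zS; pose x := a^-1 *: (z - c).
have zE : z = a *: x + c by rewrite scalerA mulfV ?gt_eqF// scale1r subrK.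
rewrite zE; apply: neg_cone_comb => //; first exact: ltW.
apply: ye.
  split=> // i j; have : `|(a *: y + c) i j - z i j| < a * e := yz.2 i j.
  have coord u : (a *: u + c) i j = a * u i j + c i j by rewrite !mxE.
  rewrite zE !coord.
  have -> : a * y i j + c i j - (a * x i j + c i j) = a * (y i j - x i j) by ring.
  by rewrite normrM gtr0_norm// ltr_pM2l.
have -> : x = a^-1 *: z + (- a^-1) *: c by rewrite /x scalerBr scaleNr.
by apply: affine_hull_comb => //; exact: neg_cone0.
Qed.

End RelativeInterior.

(** * Weights, cosets and the effect of maximality *)

Section LatticeCone.
Variables (R : realType) (N n : nat) (A : 'M[int]_(N, n)).
Implicit Types (v t : 'rV[rat]_N) (l m : 'rV[int]_N).

Local Notation interior u :=
  (relint [set - y | y in cone A] (map_mx (ratr : rat -> R) u)).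

Lemma wtD v t : wt A (v + t) = wt A v + wt A t.
Proof. exact: mulmxDl. Qed.

Lemma wtZ (a : rat) v : wt A (a *: v) = a *: wt A v.
Proof. by rewrite /wt scalemxAl. Qed.

Lemma wt_intr m : wt A (map_mx intr m) = map_mx intr (m *m A).
Proof. by rewrite map_mxM. Qed.

Lemma wt_sum v : wt A v = \sum_(j < N) v 0 j *: row j (map_mx intr A).
Proof. exact: mulmx_sum_row. Qed.

Lemma interior_comb (a : rat) v t : 0 < a -> interior (wt A v) ->
  (forall j, t 0 j <= 0) -> interior (wt A (a *: v + t)).
Proof.
move=> a0 iv t0; rewrite wtD wtZ map_mxD map_mxZ.
apply: relint_neg_cone_comb => //; first by rewrite ltr0q.
apply/neg_coneP; exists (map_mx ratr t).
  by move=> j; rewrite mxE lerq0.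
rewrite /wt map_mxM; congr (_ *m _); apply/matrixP => i j.
by rewrite !mxE; exact: ratr_int.
Qed.

Lemma coset_wt_shift (Q : 'rV[rat]_n) v m :
  coset_ZA A Q (wt A v) -> coset_ZA A Q (wt A (v + map_mx intr m)).
Proof.
move=> [m' E]; exists (m' + m).
by rewrite wtD E wt_intr mulmxDl map_mxD addrA.
Qed.

Lemma coset_wt_scale (Q : 'rV[rat]_n) v (p : nat) :
  coset_ZA A Q (wt A v) -> coset_ZA A (p%:R *: Q) (wt A (p%:R *: v)).
Proof.
move=> [m E]; exists (p%:Z *: m).
rewrite wtZ E scalerDr -scalemxAl; congr (_ + _); apply/rowP => j.
by rewrite [LHS]mxE [RHS]mxE [in RHS]mxE intrM; congr (_ * _); rewrite mxE.
Qed.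

Variable w : 'rV[rat]_n.
Hypothesis w_A : forall j, wform w (row j (map_mx intr A)) = 1.

Lemma wform_wt v : wform w (wt A v) = \sum_j v 0 j.
Proof.
rewrite wt_sum /wform.
under eq_bigr => i _ do rewrite summxE mulr_sumr.
rewrite exchange_big/=; apply: eq_bigr => j _.
rewrite -[RHS]mulr1 -[X in _ = _ * X](w_A j) /wform mulr_sumr; apply: eq_bigr => i _.
by rewrite !mxE mulrCA.
Qed.

(* If l_j >= 1 with v_j = -1, then wt (v + e_j) is still in the interior: the
   coefficients at j and at the zeros of v of a representation of wt (v + l) are
   nonnegative and can be removed. *)
Lemma Eplus_sub_Eset (Q : 'rV[rat]_n) v l :
  (forall j, -1 <= v 0 j <= 0) -> coset_ZA A Q (wt A v) ->
  ubound [set wform w u | u in Mset R A Q] (wform w (wt A v)) ->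
  Eplus v l -> Mset R A Q (wt A (v + map_mx intr l)) -> Eset v l.
Proof.
move=> v_range vQ vmax lE [_ lint] j; split; last exact: lE.
move=> vj; rewrite leNgt; apply/negP => lj.
pose m : 'rV[int]_N := delta_mx 0 j; pose t := v + map_mx intr m.
have tE i : t 0 i = if i == j then 0 else v 0 i.
  rewrite !mxE /=; case: eqP => [->|_]; last by rewrite addr0.
  by rewrite vj addNr.
(* The weight of wt t exceeds that of wt v by 1, against maximality. *)
suff tM : Mset R A Q (wt A t).
  have := vmax _ (imageP _ tM); rewrite !wform_wt (bigD1 j)//= [X in _ <= X](bigD1 j)//=.
  rewrite tE eqxx vj (eq_bigr (fun i => v 0 i)) => [|i /negPf ij]; last by rewrite tE ij.
  by rewrite lerD2r; lra.
split; first exact: coset_wt_shift.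
(* S makes t - (v + l)/S nonpositive: where v_i < 0 one needs S |v_i| >= |v_i| + |l_i|, and 1 bounds
   |v_i|. Where v_i = 0 the quotient is 0 by convention and the coordinate is treated apart. *)
pose S : rat := 1 + \sum_i (1 + `|l 0 i|%:~R) / `|v 0 i|.
have term0 i : 0 <= (1 + `|l 0 i|%:~R) / `|v 0 i| :> rat.
  by rewrite divr_ge0// addr_ge0// ler0z.
have S1 : 1 <= S by rewrite lerDl sumr_ge0.
have S0 : 0 < S by rewrite (lt_le_trans ltr01).
have termS i : (1 + `|l 0 i|%:~R) / `|v 0 i| <= S.
  by rewrite /S (bigD1 i)//= addrCA lerDl addr_ge0// sumr_ge0.
have -> : t = S^-1 *: (v + map_mx intr l) + (t - S^-1 *: (v + map_mx intr l)) by rewrite addrC subrK.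
apply: interior_comb; rewrite ?invr_gt0// => i.
have coord (x y : 'rV[rat]_N) c : (x - c *: y) 0 i = x 0 i - c * y 0 i by rewrite !mxE.
have vl : (v + map_mx intr l) 0 i = v 0 i + (l 0 i)%:~R by rewrite !mxE.
rewrite coord vl tE subr_le0; case: eqP => [->|_].
  apply: mulr_ge0; first by rewrite invr_ge0 ltW.
  by rewrite vj addrC subr_ge0 ler1z -gtz0_ge1.
have [vi|vi] := eqVneq (v 0 i) 0.
  rewrite vi add0r; apply: mulr_ge0; first by rewrite invr_ge0 ltW.
  by rewrite ler0z lE.
have /andP[v1 v0] := v_range i.
have v00 : 0 < `|v 0 i| by rewrite normr_gt0.
have := termS i; rewrite ler_pdivrMr// => H.
rewrite mulrC ler_pdivlMr//; move: H; rewrite (ler0_norm v0) mulrN [S * _]mulrC.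
have : - `|l 0 i|%:~R <= (l 0 i)%:~R :> rat.
  by rewrite -mulrNz ler_int; have := ler_norm (- l 0 i); rewrite normrN lerNl.
by move: (v 0 i * S) v1 => x; lra.
Qed.

End LatticeCone.

(** * Formal series in several variables *)

Section Monomials.
Variables (R : realType) (p : nat) (K : fieldType) (nrm : K -> R).
Variables (N n : nat) (A : 'M[int]_(N, n)).
Implicit Types (v : 'rV[rat]_N) (l : 'rV[int]_N).

Lemma mon_inj v : injective (mon A v).
Proof.
move=> l l' [/addrI E _]; apply/rowP => j; have /rowP/(_ j) := E.
by rewrite !mxE => /eqP; rewrite eqr_int => /eqP.
Qed.

Lemma mono_series_mon v (S : set 'rV[int]_N) (c : 'rV[int]_N -> K) l : S l ->
  mono_series A v S c (mon A v l) = c l.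
Proof.
move=> Sl; rewrite /mono_series.
have -> : [set l' | S l' /\ mon A v l' = mon A v l] = [set l].
  by apply/seteqP; split=> [l' /= [_ /mon_inj]//|_ /= ->].
exact: fsbig_set1.
Qed.

Lemma mono_series_off v (S : set 'rV[int]_N) (c : 'rV[int]_N -> K) e :
  (forall l, S l -> mon A v l <> e) -> mono_series A v S c e = 0.
Proof.
move=> H; rewrite /mono_series.
have -> : [set l | S l /\ mon A v l = e] = set0.
  by apply/seteqP; split=> [l' /= [/H]//|].
exact: fsbig_set0.
Qed.

Lemma mono_series_mon_off v (S : set 'rV[int]_N) (c : 'rV[int]_N -> K) l : ~ S l ->
  mono_series A v S c (mon A v l) = 0.
Proof. by move=> nS; apply: mono_series_off => l' Sl' /mon_inj ll'; rewrite ll' in Sl'. Qed.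

Lemma G_mono_series pi0 v (E : set 'rV[int]_N) (e : expo N n) :
  G p nrm pi0 A v E e.2 e.1 =
  mono_series A v E (fun l => \prod_(j < N) g p nrm pi0 (ratr (v 0 j)) (l 0 j)) e.
Proof.
rewrite /G /mono_series; congr (\sum_(l \in _) _).
apply/seteqP; split=> l /=; first by case: e => mu u /= [El E1 E2]; split=> //; rewrite /mon E1 E2.
by move=> [El <-].
Qed.

Lemma finite_row_absz (k : nat) :
  finite_set [set l : 'rV[int]_N | (\sum_(j < N) absz (l 0%R j) <= k)%N].
Proof.
pose h (f : {ffun 'I_N -> 'I_(k + k).+1}) : 'rV[int]_N := \row_j ((f j)%:Z - k%:Z).
apply: (@sub_finite_set _ _ (h @` setT)); last first.
  by apply: finite_image; exact: finite_finset.
move=> l /= lk; have lj j : (absz (l 0%R j) <= k)%N.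
  by rewrite (leq_trans _ lk)// (bigD1 j)//= leq_addr.
exists [ffun j => inord (absz (l 0%R j + k%:Z)%R)] => //.
apply/rowP => j; rewrite mxE ffunE inordK; have := lj j; lia.
Qed.

End Monomials.

(** * Fractional powers of pi0 *)

Section Pi0Powers.
Variables (K : fieldType) (rho : K) (d : nat).
Hypothesis rho_neq0 : rho != 0.

(** [numq] reads off the exponent d r only when it is an integer, hence the two hypotheses. *)
Lemma pi0powD (r s : rat) : d%:R * r \is a Num.int -> d%:R * s \is a Num.int ->
  pi0pow rho d (r + s) = pi0pow rho d r * pi0pow rho d s.
Proof.
move=> /intrP[a aE] /intrP[b bE]; rewrite /pi0pow mulrDr aE bE -intrD !numq_int.
exact: expfzDr.
Qed.

Lemma pi0pow_int (m : int) : pi0pow rho d m%:~R = (rho ^+ d) ^ m.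
Proof.
rewrite /pi0pow -[d%:R]/(d%:Z%:~R) -intrM numq_int.
by rewrite exprnP exprz_exp.
Qed.

End Pi0Powers.

Lemma expfz_sum (K : fieldType) (x : K) (I : Type) (r : seq I) (F : I -> int) :
  x != 0 -> x ^ (\sum_(j <- r) F j) = \prod_(j <- r) x ^ F j.
Proof. by move=> x0; apply: (big_morph _ _ (expr0z x)) => a b; exact: expfzDr. Qed.

Lemma ord_pow (R : realType) (p : nat) (K : fieldType) (nrm : K -> R) (x : K) :
  prime p -> is_Cp p nrm -> ord p nrm x = p.-1%:R^-1 -> nrm x ^+ p.-1 = p%:R^-1.
Proof.
move=> pp K_Cp; rewrite /ord => ordx.
have p1 : (0 < p.-1)%N by case: p pp {K_Cp ordx} => [|[|]].
have pR : 0 < p%:R :> R by rewrite ltr0n prime_gt0.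
have lnp : ln (p%:R : R) != 0 by rewrite gt_eqF// ln_gt0// ltr1n prime_gt1.
have p1R : p.-1%:R != 0 :> R by rewrite pnatr_eq0 -lt0n.
have x0 : 0 < nrm x.
  (* With ln 0 = 0 by convention, x = 0 would have [ord] 0 instead of 1/(p-1). *)
  rewrite lt_neqAle (nrm_ge0 K_Cp) andbT eq_sym; apply/eqP => nx0.
  move: ordx; rewrite nx0 ln0// mul0r oppr0 => /esym/eqP.
  by rewrite invr_eq0 (negPf p1R).
have lnx : ln (nrm x) *+ p.-1 = - ln p%:R.
  have q : ln (nrm x) / ln p%:R = - p.-1%:R^-1 by rewrite -ordx opprK.
  rewrite -[LHS]mulr_natr -[ln (nrm x)](mulfVK lnp) q.
  by rewrite mulNr mulNr mulrAC mulVf// mul1r.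
apply: (@ln_inj R); rewrite ?posrE ?exprn_gt0 ?invr_gt0//.
by rewrite lnXn// lnx lnV ?posrE.
Qed.

(** * Reduction of the several-variable statement to one variable *)

Section Assembly.
Variables (R : realType) (p : nat) (K : fieldType) (nrm : K -> R).
Variables (N n : nat) (A : 'M[int]_(N, n)) (w Q : 'rV[rat]_n) (pi0 rho : K) (d : nat).
Hypotheses (p_prime : prime p) (K_Cp : is_Cp p nrm).
Hypothesis w_A : forall j, wform w (row j (map_mx intr A)) = 1.
Hypothesis pi0_pow : nrm pi0 ^+ p.-1 = p%:R^-1.
Hypothesis pi0_root : has_series nrm (fun i => pi0 ^+ (p ^ i) / (p ^ i)%:R) 0.
Hypotheses (d_gt0 : (0 < d)%N) (rho_pi0 : rho ^+ d = pi0).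

Let p_gt0 : (0 < p)%N := prime_gt0 p_prime.
Let n_ge0 := nrm_ge0 K_Cp.
Let pi0_neq0 : pi0 != 0 := pi0_neq0 p_prime K_Cp pi0_pow.
Let gh (x : rat) (l : int) : K := ghat p nrm pi0 (ratr x) l.

Let rho_neq0 : rho != 0.
Proof. by apply: contraNneq pi0_neq0 => r0; rewrite -rho_pi0 r0 expr0n gtn_eqF. Qed.

Section SeriesGM.
Variables (v : 'rV[rat]_N) (E : set 'rV[int]_N) (M : set 'rV[rat]_n).
Hypothesis d_v : forall j, d%:R * v 0 j \is a Num.int.

Let d_sum : d%:R * (\sum_j v 0 j) \is a Num.int.
Proof. by rewrite mulr_sumr rpred_sum. Qed.

(** Since w(u) is the sum of the v_j plus that of the l_j, the integral part of pi0^(w(u))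
    distributes over the factors g and turns them into [ghat]. *)
Lemma GM_mon l : E l -> M (wt A (v + map_mx intr l)) ->
  GM p nrm pi0 rho d A w v E M (mon A v l) =
  pi0pow rho d (\sum_j v 0 j) * \prod_j gh (v 0 j) (l 0 j).
Proof.
move=> El Ml; rewrite /GM mem_set// G_mono_series mono_series_mon// (wform_wt w_A).
have -> : \sum_j (v + map_mx intr l) 0 j = \sum_j v 0 j + (\sum_j l 0 j)%:~R.
  rewrite rmorph_sum -big_split; apply: eq_bigr => j _.
  by rewrite !mxE.
rewrite pi0powD//; last by rewrite -[d%:R]/(d%:Z%:~R) -intrM intr_int.
rewrite pi0pow_int rho_pi0 expfz_sum// mulrCA -big_split/=; congr (_ * _).
by apply: eq_bigr => j _; rewrite /gh /ghat mulrC.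
Qed.

Lemma GM_off e : (forall l, E l -> M (wt A (v + map_mx intr l)) -> mon A v l <> e) ->
  GM p nrm pi0 rho d A w v E M e = 0.
Proof.
move=> H; rewrite /GM; case: ifPn => // /set_mem Me.
rewrite G_mono_series mono_series_off ?mul0r// => l El le.
by apply: (H l El _ le); rewrite -le in Me.
Qed.

Hypotheses (v_range : forall j, -1 <= v 0 j <= 0).
Hypothesis v_pint : forall j, ~~ (p %| absz (denq (v ord0 j)))%N.

(** Needed because [alpha_star] takes a dummy value off its domain. The factors grow more slowly
    than any k^|l| with k > 1, so delta < 1 wins. *)
Lemma GM_Cspace : Cspace nrm A v E (GM p nrm pi0 rho d A w v E M).
Proof.
pose c l := if l \in [set l | M (wt A (v + map_mx intr l))] then
  pi0pow rho d (\sum_j v 0 j) * \prod_j gh (v 0 j) (l 0 j) else 0.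
exists c.
  apply/funext => e; have [[l [El <-]]|H] := pselect (exists l, E l /\ mon A v l = e).
    rewrite mono_series_mon// /c; case: ifPn => [/set_mem Ml|/negP Ml].
      exact: GM_mon.
    rewrite GM_off// => l' _ Ml' /mon_inj ll'; apply: Ml.
    by rewrite -ll'; exact: mem_set.
  rewrite mono_series_off => [|l El le]; last by apply: H; exists l.
  by rewrite GM_off// => l El _ le; apply: H; exists l.
move=> delta eps delta0 delta1 eps0.
have [r0 [r0_gt0 r0_lt1 pi0_r0 p_r0]] := radius_ex p_prime pi0_pow.
(* k must satisfy both k r0 < 1, for the growth bound, and k delta < 1, for the decay; it is the
   midpoint of 1 and 1/s. *)
pose s := Num.max r0 delta.
have s0 : 0 < s by rewrite lt_max r0_gt0.
have s1 : s < 1 by rewrite gt_max r0_lt1.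
pose k := (1 + s^-1) / 2.
have k1 : 1 < k.
  have : 1 < s^-1 by rewrite invf_gt1.
  by rewrite /k => ?; lra.
have k0 : 0 < k := lt_trans ltr01 k1.
have ks : k * s < 1.
  have -> : k * s = (s + 1) / 2 by rewrite /k mulrAC mulrDl mul1r mulVf ?gt_eqF.
  by move: s1; lra.
have kr0 : k * r0 < 1 by apply: le_lt_trans ks; rewrite ler_pM2l// le_max lexx.
have kd : k * delta < 1 by apply: le_lt_trans ks; rewrite ler_pM2l// le_max lexx orbT.
have [D D0 HD] : exists2 D : 'I_N -> R, forall j, 0 <= D j &
    forall j l, nrm (gh (v 0 j) l) <= D j * k ^+ absz l.
  pose P j := cid2 (ghat_growth p_prime K_Cp pi0_pow pi0_root (v_range j) (v_pint j)
    r0_gt0 r0_lt1 p_r0 k1 kr0).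
  exists (fun j => s2val (P j)) => j; first exact: (s2valP (P j)).
  by move=> l; have [] := s2valP' (P j) l.
pose C := nrm (pi0pow rho d (\sum_j v 0 j)) * \prod_j D j.
have C0 : 0 <= C by rewrite mulr_ge0// prodr_ge0.
have bound l : nrm (c l) * delta ^+ (\sum_(j < N) absz (l 0%R j))%N
    <= C * (k * delta) ^+ (\sum_(j < N) absz (l 0%R j))%N.
  rewrite exprMn mulrA ler_wpM2r ?exprn_ge0 ?(ltW delta0)// /c; case: ifP => _; last first.
    by rewrite (nrm0 K_Cp) mulr_ge0// exprn_ge0// ltW.
  rewrite (nrmM K_Cp) /C -mulrA ler_wpM2l// (nrm_prod K_Cp) -prodrXr -big_split/=.
  by apply: ler_prod => j _; rewrite n_ge0 HD.
have kd0 : 0 <= k * delta by rewrite mulr_ge0 ?ltW.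
have [m Hm] := geometric_small C kd0 kd eps0.
apply: (sub_finite_set _ (finite_row_absz N m)) => l /= [_ le].
rewrite leqNgt; apply/negP => /ltnW/Hm; rewrite ltNge => /negP; apply.
exact: le_trans le (bound l).
Qed.

End SeriesGM.
Section FrobeniusAction.
Variables (v v' : 'rV[rat]_N) (k : 'I_N -> nat).
Hypotheses (v_range : forall j, -1 <= v 0 j <= 0) (v'_range : forall j, -1 <= v' 0 j <= 0).
Hypothesis v_pint : forall j, ~~ (p %| absz (denq (v ord0 j)))%N.
Hypothesis k_lt : forall j, (k j <= p.-1)%N.
Hypothesis v'_v : forall j, p%:R * v 0 j - v' 0 j = - (k j)%:R.
Hypothesis d_v : forall j, d%:R * v 0 j \is a Num.int.
Hypothesis v_M : Mset R A Q (wt A v).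

Let M := Mset R A Q.
Let M' := Mset R A (p%:R *: Q).
Let kv : 'rV[int]_N := \row_j (k j)%:Z.

Lemma v'E : v' = p%:R *: v + map_mx intr kv.
Proof.
apply/rowP => j; rewrite !mxE; have := v'_v j.
by rewrite -[(k j)%:Z%:~R]/((k j)%:R); lra.
Qed.

Lemma coset_v' : coset_ZA A (p%:R *: Q) (wt A v').
Proof. by rewrite v'E; apply: coset_wt_shift; apply: coset_wt_scale; exact: v_M.1. Qed.

Let p0 : p%:R != 0 :> rat. Proof. by rewrite pnatr_eq0 gtn_eqF. Qed.

(** Exponent bookkeeping for p (v + l2) + (l + kv - p l2) = v' + l, as kv = v' - p v. *)
Lemma mon_Frobenius l l2 :
  (p%:R^-1 *: ((mon A v' l).1 - (mon A 0 (l + kv - p%:Z *: l2)).1),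
   p%:R^-1 *: ((mon A v' l).2 - (mon A 0 (l + kv - p%:Z *: l2)).2)) = mon A v l2.
Proof.
suff E : p%:R^-1 *: ((v' + map_mx intr l) - (0 + map_mx intr (l + kv - p%:Z *: l2)))
    = v + map_mx intr l2.
  by rewrite /mon /= E -E wtZ /wt mulmxBl.
rewrite v'E; apply/rowP => j.
rewrite !mxE intrD intrN intrM !intrD -[p%:Z%:~R]/(p%:R).
by field.
Qed.

(** v + l2 is 1/p times v' + l minus a nonnegative vector, and subtracting cone elements keeps a
    point in the interior of the negative cone. *)
Lemma M_Frobenius l l2 : M' (wt A (v' + map_mx intr l)) ->
  (forall j, 0 <= (l + kv - p%:Z *: l2) 0 j) -> M (wt A (v + map_mx intr l2)).
Proof.
move=> [_ li] l1; split; first by apply: coset_wt_shift; exact: v_M.1.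
have -> : v + map_mx intr l2 = p%:R^-1 *: (v' + map_mx intr l) +
    - (p%:R^-1 *: map_mx intr (l + kv - p%:Z *: l2)).
  rewrite v'E; apply/rowP => j.
  rewrite !mxE intrD intrN intrM !intrD -[p%:Z%:~R]/(p%:R).
  by field.
apply: interior_comb => // [|j]; first by rewrite invr_gt0 ltr0n.
rewrite mxE oppr_le0 mxE mulr_ge0 ?invr_ge0// [X in _ <= X]mxE ler0z.
exact: l1.
Qed.

(** For v_j = -1: p l2_j <= l_j + k_j <= p - 1, so l2_j <= 0. *)
Lemma Eset_of_index l l2 : Eset v l -> (forall j, 0 <= (l + kv - p%:Z *: l2) 0 j) ->
  (forall j, v 0 j = 0 -> 0 <= l2 0 j) -> Eset v l2.
Proof.
move=> El l1 l20 j; split; last exact: l20.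
move=> vj; have := (El j).1 vj; have := l1 j; rewrite !mxE.
have := k_lt j; have := prednK p_gt0; move: (l 0 j) (l2 0 j) (k j) => a b c.
by clear; nia.
Qed.

(** [0]_m has the factor 0 for m < 0. This lets the sum over l2 run over all of Z^N although the
    series is supported on E. *)
Lemma gh0_neg l : l < 0 -> gh 0 l = 0.
Proof.
move=> l0; apply: (ghatE p_prime K_Cp pi0_pow).
have := has_fam_sum_fin K_Cp (n := 0)
  (c := fun i : nat => nbrk pi0 (ratr 0) (l - i%:Z) * theta_hat1 p pi0 i).
rewrite big_ord0; apply => i _; rewrite /nbrk.
case E : (l - i%:Z) => [m|m]; first by exfalso; clear -l0 E; lia.
by rewrite /brk big_ord_recl (ratr_nat K 0) subr0 mul0r mulr0 mul0r.
Qed.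

(** Nonzero terms occur only at exponents l + kv - p l2 of theta. Indexed by l2 in Z^N the terms
    factor over j, and the one-variable relation evaluates each factor. *)
Lemma fs_mul_sum l : Eset v l -> M' (wt A (v' + map_mx intr l)) ->
  has_fam_sum nrm (fun e1 : expo N n => theta_Lx p pi0 A e1 *
      Phi_star p (GM p nrm pi0 rho d A w v (Eset v) M) (mon A v' l - e1))
    (pi0pow rho d (\sum_j v 0 j) *
     \prod_j (pi0 ^+ k j * (H p nrm pi0 (- ratr (v 0 j)) /
                brk (ratr (v' 0 j)) (- (k j)%:Z)) * gh (v' 0 j) (l 0 j))).
Proof.
move=> El Ml; have [r0 [r0_gt0 r0_lt1 pi0_r0 p_r0]] := radius_ex p_prime pi0_pow.
pose h (l2 : 'rV[int]_N) : expo N n := mon A 0 (l + kv - p%:Z *: l2).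
have h_inj : injective h.
  move=> x y /mon_inj /(addrI _) /oppr_inj /rowP xy; apply/rowP => j.
  by have := xy j; rewrite !mxE; apply: mulfI; rewrite eqz_nat gtn_eqF.
apply: (has_fam_sum_reindex K_Cp h_inj).
  move=> e1 he1; apply/eqP; rewrite mulf_eq0; apply/orP.
  have [[l1 l1E]|no1] := pselect (exists l1, mon A 0 l1 = e1); last first.
    by left; rewrite /theta_Lx mono_series_off// => l1 _ E; apply: no1; exists l1.
  right; rewrite /Phi_star GM_off// => l2 _ _ [E _]; have := he1 l2.
  suff -> : h l2 = e1 by rewrite eqxx.
  rewrite -l1E /h; congr mon; apply/rowP => j.
  have Ej : v 0 j + (l2 0 j)%:~R = p%:R^-1 * (v' 0 j + (l 0 j)%:~R - (l1 0 j)%:~R).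
    by move/rowP/(_ j): E; rewrite -l1E !mxE add0r.
  have {Ej} : p%:R * v 0 j + p%:R * (l2 0 j)%:~R = v' 0 j + (l 0 j)%:~R - (l1 0 j)%:~R.
    by rewrite -mulrDr Ej mulrA mulfV// mul1r.
  have := v'_v j; rewrite !mxE => v'j Ej; apply/eqP; rewrite -(eqr_int rat); apply/eqP.
  have pz : (p%:Z)%:~R = p%:R :> rat by [].
  have kz : ((k j)%:Z)%:~R = (k j)%:R :> rat by [].
  rewrite intrD intrN intrM intrD pz kz.
  by move: v'j Ej; move: (p%:R * v 0 j) (p%:R * _) => x y; lra.
pose f j (m : int) := coefz (theta p pi0) (l 0 j + (k j)%:Z - p%:Z * m) * gh (v 0 j) m.
have sum1 : has_fam_sum nrm (fun l2 : 'rV[int]_N => \prod_j f j (l2 0 j))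
  (\prod_j (pi0 ^+ k j * (H p nrm pi0 (- ratr (v 0 j)) /
                brk (ratr (v' 0 j)) (- (k j)%:Z)) * gh (v' 0 j) (l 0 j))).
  apply: (has_fam_sum_prod K_Cp) => j.
  exact: (ghat_Frobenius p_prime K_Cp pi0_pow pi0_root (v_range j) (v'_range j) (v_pint j)
    (k_lt j) (v'_v j) r0_gt0 r0_lt1 pi0_r0 p_r0 (El j).1).
apply: eq_has_fam_sum (has_fam_sumZ K_Cp (pi0pow rho d (\sum_j v 0 j)) sum1) => l2; rewrite [RHS]/=.
rewrite /Phi_star mon_Frobenius /theta_Lx /h.
have lE j : (l + kv - p%:Z *: l2) 0 j = l 0 j + (k j)%:Z - p%:Z * l2 0 j by rewrite !mxE.
(* A negative exponent kills both sides: theta has no such monomial, and [coefz] vanishes there. *)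
have [pos|neg] := pselect (forall j, 0 <= (l + kv - p%:Z *: l2) 0 j); last first.
  rewrite mono_series_mon_off// mul0r.
  have [j jneg] : exists j, (l + kv - p%:Z *: l2) 0 j < 0.
    by apply: contrapT => H; apply: neg => j; rewrite leNgt; apply/negP => jneg; apply: H; exists j.
  have fj : f j (l2 0 j) = 0 by rewrite /f -lE coefz_lt0// mul0r.
  have prod0 : \prod_j f j (l2 0 j) = 0 by apply/eqP/prodf_eq0; exists j; rewrite ?fj.
  by rewrite prod0 mulr0.
rewrite mono_series_mon//.
have [l20|l2neg] := pselect (forall j, v 0 j = 0 -> 0 <= l2 0 j); last first.
  rewrite [X in _ = _ * X]GM_off => [|l' El' _ /mon_inj E]; last first.
    by apply: l2neg => j /(El' j).2; rewrite E.
  have [j [vj jneg]] : exists j, v 0 j = 0 /\ l2 0 j < 0.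
    apply: contrapT => H; apply: l2neg => j vj; rewrite leNgt; apply/negP => jneg.
    by apply: H; exists j.
  have fj : f j (l2 0 j) = 0 by rewrite /f vj gh0_neg// mulr0.
  have prod0 : \prod_j f j (l2 0 j) = 0 by apply/eqP/prodf_eq0; exists j; rewrite ?fj.
  by rewrite prod0 !mulr0.
rewrite (GM_mon d_v (Eset_of_index El pos l20) (M_Frobenius Ml pos)).
rewrite mulrCA; congr (_ * _); rewrite -big_split/=; apply: eq_bigr => j _.
rewrite /f -lE; congr (_ * _); have := pos j.
by case: (_ 0 j).
Qed.

End FrobeniusAction.
End Assembly.

Theorem theorem10p5 (R : realType) (p : nat) (K : fieldType) (nrm : K -> R)
    (N n : nat) (A : 'M[int]_(N, n)) (w Q beta : 'rV[rat]_n)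
    (v v' : 'rV[rat]_N) (pi0 rho : K) (d : nat)
    (p_prime : prime p) (K_Cp : is_Cp p nrm)
    (w_A : forall j, wform w (row j (map_mx intr A)) = 1)
    (Q_QA : exists c : 'rV[rat]_N, Q = c *m map_mx intr A)
    (beta_M : Mset R A Q beta)
    (v_range : forall j, -1 <= v 0 j <= 0)
    (beta_v : beta = \sum_(j < N) v 0 j *: row j (map_mx intr A))
    (v_pint : forall j, ~~ (p %| absz (denq (v ord0 j)))%N)
    (v'_range : forall j, -1 <= v' 0 j <= 0)
    (v'_v : forall j, exists2 k : nat,
              (k <= p.-1)%N & p%:R * v 0 j - v' 0 j = - k%:R)
    (pi0_root : has_series nrm (fun i : nat => pi0 ^+ (p ^ i) / (p ^ i)%:R) 0)
    (pi0_ord : ord p nrm pi0 = (p.-1)%:R^-1)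
    (d_gt0 : (0 < d)%N)
    (d_v : forall j, d%:R * v 0 j \is a Num.int)
    (rho_pi0 : rho ^+ d = pi0) :
  let beta' := \sum_(j < N) v' 0 j *: row j (map_mx intr A) in
  let M := Mset R A Q in
  let M' := Mset R A (p%:R *: Q) in
  [set wform w u' | u' in M'] (wform w beta') ->
  ubound [set wform w u' | u' in M'] (wform w beta') ->
  alpha_star p nrm pi0 A v v' M'
    (GM p nrm pi0 rho d A w v (Eset v) M) =
  fs_scale
    (pi0pow rho d (- ((p.-1)%:R * wform w beta)) *
     \prod_(j < N) (H p nrm pi0 (ratr (- v 0 j)) /
                    brk (ratr (v' 0 j)) (numq (p%:R * v 0 j - v' 0 j))))
    (GM p nrm pi0 rho d A w v' (Eset v) M').
Proof.

move=> beta' M M' _ w_max.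
have [k k_lt k_v] : exists2 k : 'I_N -> nat, forall j, (k j <= p.-1)%N &
    forall j, p%:R * v 0 j - v' 0 j = - (k j)%:R.
  exists (fun j => s2val (cid2 (v'_v j))) => j; first exact: (s2valP (cid2 (v'_v j))).
  exact: (s2valP' (cid2 (v'_v j))).
have pi0_pow := ord_pow p_prime K_Cp pi0_ord.
have pi0_neq0 : pi0 != 0 := pi0_neq0 p_prime K_Cp pi0_pow.
have rho_neq0 : rho != 0.
  by apply: contraNneq pi0_neq0 => r0; rewrite -rho_pi0 r0 expr0n gtn_eqF.
have betaE : beta = wt A v by rewrite wt_sum.
have beta'E : beta' = wt A v' by rewrite wt_sum.
have v_M : Mset R A Q (wt A v) by rewrite -betaE.
have d_v' j : d%:R * v' 0 j \is a Num.int.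
  have -> : v' 0 j = p%:R * v 0 j + (k j)%:R by have := k_v j; lra.
  by rewrite mulrDr mulrCA; apply: rpredD; apply: rpredM; rewrite ?natr_int.
(* Maximality enters here: every exponent kept by [gamma] lies in E. The sets E of v and v' have to
   be matched, as -1 and 0 occur at the same places in both. *)
have E'E l : M' (wt A (v' + map_mx intr l)) -> Eplus v' l -> Eset v l.
  move=> Ml Epl; have El' : Eset v' l.
    apply: (Eplus_sub_Eset w_A v'_range _ _ Epl Ml); last by rewrite -beta'E.
    exact: (coset_v' k_v v_M).
  move=> j; split=> [vj|vj].
    by apply: (El' j).1; have [] := vN1_v' p_prime (v'_range j) (k_lt j) (k_v j) vj.
  apply: (El' j).2; have := k_v j; rewrite vj mulr0 sub0r => /oppr_inj v'k.
  apply/eqP; rewrite eq_le; have /andP[_ ->] := v'_range j.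
  by rewrite v'k ler0n.
have EE' l : Eset v l -> Eplus v' l.
  move=> El j v'0; apply: (El j).2.
  by have [] := v'0_v p_prime K_Cp (v_pint j) (k_lt j) (k_v j) v'0.
rewrite /alpha_star mem_set; last exact: GM_Cspace.
apply/funext => e; rewrite /gamma /fs_scale; case: ifPn => [/set_mem[l [El Ml] <-]|/negP eM]; last first.
  rewrite GM_off ?mulr0// => l El Ml le; apply: eM; apply/mem_set.
  by exists l => //; split=> //; exact: EE'.
have {}El := E'E l Ml El.
rewrite /fs_mul (fam_sumE K_Cp (fs_mul_sum p_prime K_Cp w_A pi0_pow pi0_root d_gt0 rho_pi0
  v_range v'_range v_pint k_lt k_v d_v v_M El Ml)).
rewrite (GM_mon p_prime K_Cp w_A pi0_pow d_gt0 rho_pi0 d_v' El Ml).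
have d_sum : d%:R * (\sum_j v 0 j) \is a Num.int by rewrite mulr_sumr rpred_sum.
have sumE : \sum_j v' 0 j = p%:R * \sum_j v 0 j + (\sum_j (k j)%:Z)%:~R.
  rewrite mulr_sumr rmorph_sum -big_split; apply: eq_bigr => j _ /=.
  by have := k_v j; rewrite -[(k j)%:Z%:~R]/((k j)%:R); lra.
(* The k_j sum to w(beta') - p w(beta), so the left exponent is w(beta') - (p-1) w(beta). *)
have powE : pi0pow rho d (\sum_j v 0 j) * pi0 ^ (\sum_j (k j)%:Z) =
    pi0pow rho d (- (p.-1%:R * wform w beta)) * pi0pow rho d (\sum_j v' 0 j).
  rewrite betaE (wform_wt w_A) -{1}rho_pi0 -pi0pow_int -!pi0powD//.
  - congr pi0pow; rewrite sumE; have : p%:R = p.-1%:R + 1 :> rat by rewrite natr1 prednK ?prime_gt0.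
    by move=> ->; ring.
  - by rewrite mulrN rpredN mulrCA rpredM ?natr_int.
  - by rewrite mulr_sumr rpred_sum.
  - by rewrite rpredM ?natr_int// intr_int.
have -> : \prod_j (pi0 ^+ k j * (H p nrm pi0 (- ratr (v 0 j)) / brk (ratr (v' 0 j)) (- (k j)%:Z)) *
    ghat p nrm pi0 (ratr (v' 0 j)) (l 0 j)) =
  pi0 ^ (\sum_j (k j)%:Z) * (\prod_(j < N) (H p nrm pi0 (ratr (- v 0 j)) /
    brk (ratr (v' 0 j)) (numq (p%:R * v 0 j - v' 0 j))) *
    \prod_j ghat p nrm pi0 (ratr (v' 0 j)) (l 0 j)).
  rewrite expfz_sum// -!big_split/=; apply: eq_bigr => j _.
  rewrite k_v (Cp_ratrN p_prime K_Cp) -mulrA; congr (_ * (_ / brk _ _ * _)).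
  by rewrite -[LHS]numq_int mulrNz.
rewrite [LHS]mulrA powE.
exact: mulrACA.
Qed.
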